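(* There is a universal constant $\mathsf C''>0$ (one may take $\mathsf C''=\frac{1}{40000\pi}$) such that the following holds. Let $\pi\in\mathcal P(\mathbb R^d)$ satisfy the MALA assumption with constants $\mathsf M,\mathsf L,\mathsf m$, set $\kappa=\mathsf M/\mathsf m$, and let $\mathsf P$ be the (subgradient) MALA kernel with step size $h$, where $0<h\le\frac{1}{200}\min\{\frac{1}{d\kappa\mathsf M},\frac{1}{d\mathsf L^2}\}$. Then $$\mathrm{Gap}(\mathsf P)\ \ge\ \mathsf C''\,\mathsf m\,h .$$
   Context: MALA assumption: $\pi$ has a positive density with $\log\pi=f+g$, where $f$ is concave and differentiable with $\|\nabla f(x)-\nabla f(y)\|\le\mathsf M\|x-y\|$, $g$ satisfies $|g(x)-g(y)|\le\mathsf L\|x-y\|$, and $\pi$ is $\mathsf m$-strongly log-concave, i.e. $\log\pi(\lambda x+(1-\lambda)y)\ge\lambda\log\pi(x)+(1-\lambda)\log\pi(y)+\frac{\mathsf m}{2}\lambda(1-\lambda)\|x-y\|^2$ for all $x,y$, $\lambda\in(0,1)$. Superdifferential: $\partial\log\pi(x)=\{v:\ \log\pi(y)\le\log\pi(x)+v\cdot(y-x)\ \forall y\}$. Fix any selection $v(x)\in\partial\log\pi(x)$; then $v(x)=\nabla f(x)+v_s(x)$ with $\|v_s(x)\|\le\mathsf L$. MALA proposal: $\mathsf Q(x,\cdot)=\mathcal N(x+hv(x),2hI)$. Metropolis kernel: $\alpha(x,x')=\min\{1,\frac{\pi(x')\mathsf Q(x',x)}{\pi(x)\mathsf Q(x,x')}\}$,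 $\mathsf P(x,y)=\alpha(x,y)\mathsf Q(x,y)+(1-\int\alpha(x,x')\mathsf Q(x,x')dx')\delta_x(y)$. Spectral gap: $\mathrm{Gap}(\mathsf P)=\inf\{1-\mathbb E_\pi[u\,\mathsf Pu]/\mathbb E_\pi[u^2]: 0\ne u\in L^2(\pi),\ \mathbb E_\pi u=0\}$, where $\mathsf Pu(x)=\int\mathsf P(x,y)u(y)dy$. *)

(* Defs.v *)
From HB Require Import structures.
From mathcomp Require Import all_boot all_order all_algebra.
From mathcomp Require Import all_classical all_reals all_analysis.
Set Implicit Arguments.
Unset Strict Implicit.
Unset Printing Implicit Defensive.
Import Order.TTheory GRing.Theory Num.Theory.
Import numFieldNormedType.Exports.
Local Open Scope classical_set_scope.
Local Open Scope ring_scope.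

Section MALA.
Variable R : realType.

Definition dotv (d : nat) (x y : 'rV[R]_d) : R := \sum_(i < d) x ord0 i * y ord0 i.
Definition enorm (d : nat) (x : 'rV[R]_d) : R := Num.sqrt (dotv x x).

Definition grad (d : nat) (f : 'rV[R]_d -> R) (x : 'rV[R]_d) : 'rV[R]_d :=
  \row_(i < d) ('d f x (delta_mx ord0 i : 'rV[R]_d)).

Definition cons_row (n : nat) (t : R) (y : 'rV[R]_n) : 'rV[R]_n.+1 :=
  \row_(i < n.+1) (match unlift ord0 i with Some j => y ord0 j | None => t end).

(* integral of a nonnegative function w.r.t. d-dimensional Lebesgue measure,
   computed as iterated one-dimensional Lebesgue integrals *)
Fixpoint iint (n : nat) : ('rV[R]_n -> \bar R) -> \bar R :=
  match n return ('rV[R]_n -> \bar R) -> \bar R with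
  | 0 => fun f => f 0
  | n'.+1 => fun f =>
      (\int[@lebesgue_measure R]_t iint (fun y : 'rV[R]_n' => f (cons_row t y)))%E
  end.

Definition Rint (n : nat) (f : 'rV[R]_n -> R) : R :=
  fine (iint (fun x => (Num.max (f x) 0)%:E) - iint (fun x => (Num.max (- f x) 0)%:E))%E.

Definition borelRn (n : nat) : set_system 'rV[R]_n :=
  <<s [set: 'rV[R]_n], (@open 'rV[R]_n) >>.
Definition borel_fun (n : nat) (u : 'rV[R]_n -> R) : Prop :=
  forall B : set R, measurable B -> borelRn (u @^-1` B).

(* ---------- the target pi (through its Lebesgue density p) ---------- *)
Definition MALA_assumption (d : nat) (p : 'rV[R]_d -> R) (M L m : R) : Prop :=
  [/\ (forall x, 0 < p x), borel_fun p, Rint p = 1 &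
  exists (f g : 'rV[R]_d -> R),
    [/\ (forall x, ln (p x) = f x + g x),
        (forall x y (lam : R), 0 < lam < 1 ->
           lam * f x + (1 - lam) * f y <= f (lam *: x + (1 - lam) *: y)),
        (forall x, differentiable f x) /\
        (forall x y, enorm (grad f x - grad f y) <= M * enorm (x - y)),
        (forall x y, `|g x - g y| <= L * enorm (x - y)) &
        (forall x y (lam : R), 0 < lam < 1 ->
           lam * ln (p x) + (1 - lam) * ln (p y)
             + m / 2 * lam * (1 - lam) * enorm (x - y) ^+ 2
           <= ln (p (lam *: x + (1 - lam) *: y)))]].

Definition superdiff (d : nat) (lp : 'rV[R]_d -> R) (x v : 'rV[R]_d) : Prop :=
  forall y, lp y <= lp x + dotv v (y - x).

(* density of the proposal Q(x, .) = N(x + h v(x), 2h I) at y *)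
Definition Qdens (d : nat) (v : 'rV[R]_d -> 'rV[R]_d) (h : R) (x y : 'rV[R]_d) : R :=
  (Num.sqrt (4 * pi * h) ^+ d)^-1 * expR (- (enorm (y - x - h *: v x) ^+ 2) / (4 * h)).

Definition alpha (d : nat) (p : 'rV[R]_d -> R) (v : 'rV[R]_d -> 'rV[R]_d) (h : R)
  (x y : 'rV[R]_d) : R :=
  Num.min 1 ((p y * Qdens v h y x) / (p x * Qdens v h x y)).

Definition Pop (d : nat) (p : 'rV[R]_d -> R) (v : 'rV[R]_d -> 'rV[R]_d) (h : R)
  (u : 'rV[R]_d -> R) (x : 'rV[R]_d) : R :=
  Rint (fun y => alpha p v h x y * Qdens v h x y * u y)
  + (1 - Rint (fun y => alpha p v h x y * Qdens v h x y)) * u x.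

Definition Epi (d : nat) (p : 'rV[R]_d -> R) (w : 'rV[R]_d -> R) : R :=
  Rint (fun x => p x * w x).

Definition L2pi (d : nat) (p : 'rV[R]_d -> R) (u : 'rV[R]_d -> R) : Prop :=
  borel_fun u /\ (iint (fun x => (p x * u x ^+ 2)%:E) < +oo)%E.

(* Gap(P) = inf { 1 - E[u Pu]/E[u^2] : 0 <> u in L^2(pi), E u = 0 } (in \bar R);
   u <> 0 in L^2(pi) means E_pi[u^2] <> 0 *)
Definition Gap (d : nat) (p : 'rV[R]_d -> R) (v : 'rV[R]_d -> 'rV[R]_d) (h : R) : \bar R :=
  ereal_inf [set r : \bar R | exists u : 'rV[R]_d -> R,
    [/\ L2pi p u, Epi p u = 0, Epi p (fun x => u x ^+ 2) != 0 &
        r = (1 - Epi p (fun x => u x * Pop p v h u x) / Epi p (fun x => u x ^+ 2))%:E]].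

End MALA.

(* Main.v *)
Require Import Defs.
From HB Require Import structures.
From mathcomp Require Import all_boot all_order all_algebra.
From mathcomp Require Import all_classical all_reals all_analysis.
From mathcomp Require Import measurable_realfun ring lra.
Set Implicit Arguments.
Unset Strict Implicit.
Unset Printing Implicit Defensive.
Import Order.TTheory GRing.Theory Num.Theory.
Import numFieldNormedType.Exports.
Local Open Scope classical_set_scope.
Local Open Scope ring_scope.

(** No isoperimetry is used.  With
    [k(x, y) = min(p(x) Q(x, y), p(y) Q(y, x))] the Dirichlet form is
    [E(u^2) - E(u Pu) = 1/2 \iint k(x, y) (u(x) - u(y))^2].
    Testing the superdifferential at [x - 4 h d (v(y) - v(x))] bounds the
    Metropolis ratio below and gives [k(x, y) >= e^-2 p(x) G_t(y - b(x))],
    where [b(x) = x + h grad f(x)] and [t = h / (1 + 2 / d)]: shrinking the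
    variance slightly absorbs the error in the exponent, at a cost independent
    of the dimension.  It remains to prove a Poincare inequality in which the
    gradient is replaced by local averages against [G_t(. - b(x))].  If [phi]
    is the local mean of [u] and [J] its local variance, the midpoint
    Prekopa-Leindler inequality for [p e^(eps phi - eps^2 A J)],
    [p e^(- eps phi)] and [p] bounds the variance of [phi] as [eps] tends to
    [0]: the weight [eps^2 A J(x)] and the factor [e^(m |x - y|^2 / 4)] that
    strong log-concavity provides at the midpoint dominate
    [eps (phi(x) - phi(y))].  The selection [v] need not be Borel, but it is
    determined off a null set, where the concave function [ln p] has no kinks
    along the coordinate lines. *)

(** * Lebesgue measure on row vectors *)

(** The selection [v] is in general discontinuous, while the local means in the Poincare inequality
    need a Lipschitz centre; this is why the minorizing kernel is recentred from [x + h v(x)] to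
    [x + h grad f(x)], at distance at most [h L]. The Metropolis ratio contains a cross term between
    [v(y) - v(x)] and the proposal noise [xi]. As [|xi|^2] is of typical size [2 h d] and unbounded,
    no constant bounds it. The test point yields a gain [t |v(y) - v(x)|^2] with [t = 4 h d]; half
    of it absorbs the cross term up to [|xi|^2 / (8 t)], a fraction [1 / (8 d)] of the proposal
    exponent. Recentring costs a further fraction [1 / d], and enlarging the exponent by [1 + 2 / d]
    changes the normalization by at most [(1 + 2 / d)^(d / 2) <= e]. The dimension in the step-size
    condition is what keeps [M t] and [t L^2] small. The exponentials of [phi] force bounded test
    functions, so a general [u] is truncated first. Since [v] is arbitrary, the integrands of [Pop]
    may be nonmeasurable, and their integrals are handled as suprema over simple functions. *)

HB.instance Definition _ (R : realType) (n : nat) :=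
  Measurable.copy 'rV[R]_n (g_sigma_algebraType (@open 'rV[R]_n)).

Section borel_rV.
Context {R : realType}.

Lemma open_measurable_rV n (A : set 'rV[R]_n) : open A -> measurable A.
Proof. exact: sub_sigma_algebra. Qed.

Lemma borel_funP n (u : 'rV[R]_n -> R) : borel_fun u <-> measurable_fun setT u.
Proof.
split=> [bu _ B mB|mu B mB]; first by rewrite setTI; exact: bu.
by have := mu measurableT B mB; rewrite setTI.
Qed.

Lemma continuous_measurable_rV n (f : 'rV[R]_n -> R) :
  continuous f -> measurable_fun setT f.
Proof.
move=> /continuousP cf; apply: (measurability _ (RGenOpens.measurableE R)).
move=> _ [_ [a [b ->] <-]]; rewrite setTI; apply: open_measurable_rV.
exact/cf/interval_open.
Qed.

Lemma measurable_coord n (i : 'I_n) :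
  measurable_fun setT (fun x : 'rV[R]_n => x ord0 i).
Proof. by apply: continuous_measurable_rV; exact: coord_continuous. Qed.

Lemma rV_ball_rat n (x : 'rV[R]_n) (e : R) : 0 < e ->
  exists q : 'rV[rat]_n, ball x e (map_mx ratr q).
Proof.
move=> e0.
have H i : exists r : rat, ball (x ord0 i) e (ratr r : R).
  have [r] := @rat_in_itvoo R (x ord0 i - e) (x ord0 i + e) ltac:(lra).
  rewrite in_itv/= => /andP[h1 h2]; exists r.
  by rewrite /ball/= ltr_norml; apply/andP; split; lra.
have [q Hq] := choice H.
exists (\row_i q i); split => // i j; rewrite !mxE (ord1 i); exact: Hq.
Qed.

(** Every open set is the union of the countably many rational balls it contains, and the preimage
    of a sup-norm ball is a finite intersection of coordinate preimages. *)
Lemma measurable_fun_rV d (T : measurableType d) n (F : T -> 'rV[R]_n) :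
  (forall i, measurable_fun setT (fun x => F x ord0 i)) -> measurable_fun setT F.
Proof.
move=> mF.
have mball (c : 'rV[R]_n) (e : R) : 0 < e -> measurable (F @^-1` (ball c e)).
  move=> e0.
  rewrite (_ : _ @^-1` _ =
    \bigcap_(i in [set: 'I_n]) ((fun x => F x ord0 i) @^-1` ball (c ord0 i) e)).
    apply: fin_bigcap_measurable => [|i _]; first exact: finite_finset.
    rewrite -[X in measurable X]setTI.
    by apply: mF => //; apply: open_measurable; exact: ball_open.
  apply/seteqP; split => x /=.
    by move=> [_ H] i _; exact: H.
  by move=> H; split => // i j; rewrite (ord1 i); exact: H.
apply: (measurability (@open 'rV[R]_n)) => //.
move=> _ [U oU <-]; rewrite setTI.
pose B (qk : 'rV[rat]_n * nat) : set 'rV[R]_n :=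
  ball (map_mx ratr qk.1 : 'rV[R]_n) (qk.2.+1%:R^-1).
rewrite (_ : U = \bigcup_(qk in [set qk | B qk `<=` U]) B qk).
  rewrite preimage_bigcup bigcup_mkcond.
  apply: countable_bigcupT_measurable => // qk.
  by case: ifPn => // _; apply: mball; rewrite invr_gt0.
apply/seteqP; split => [x Ux|x [qk /= sub]]; last by move=> /sub.
have /nbhs_ballP[e /= e0 He] := open_nbhs_nbhs (conj oU Ux).
have [k ke] : exists k : nat, k.+1%:R^-1 < e / 2.
  have e20 : 0 < e / 2 by rewrite divr_gt0.
  have [k _ kP] := near_infty_natSinv_lt (PosNum e20).
  by exists k; exact: (kP k (leqnn _)).
have k0 : 0 < k.+1%:R^-1 :> R by rewrite invr_gt0.
have [q qx] := rV_ball_rat x k0.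
exists (q, k); last exact: ball_sym.
move=> y By; apply: He.
apply: (@ball_split R 'rV[R]_n (map_mx ratr q : 'rV[R]_n)).
  by apply: le_ball qx; exact: ltW.
by apply: le_ball By; exact: ltW.
Qed.

Lemma measurable_fun_rVP d (T : measurableType d) n (F : T -> 'rV[R]_n) :
  measurable_fun setT F <->
  (forall i, measurable_fun setT (fun x => F x ord0 i)).
Proof.
split=> [mF i|]; last exact: measurable_fun_rV.
exact: (measurableT_comp (measurable_coord i) mF).
Qed.

Lemma measurable_cons_row n :
  measurable_fun setT (fun ty : R * 'rV[R]_n => cons_row ty.1 ty.2).
Proof.
apply: measurable_fun_rV => i.
under eq_fun do rewrite mxE.
case: (unlift ord0 i) => [j|]; last exact: measurable_fst.
exact: (measurableT_comp (measurable_coord j) measurable_snd).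
Qed.

End borel_rV.

Section lebn.
Context {R : realType}.
Notation leb := (@lebesgue_measure R).
Notation sfm T := {sigma_finite_measure set T -> \bar R}.

Lemma cons_row0 n t (y : 'rV[R]_n) : cons_row t y ord0 ord0 = t.
Proof. by rewrite mxE unlift_none. Qed.

Lemma cons_rowS n t (y : 'rV[R]_n) j : cons_row t y ord0 (lift ord0 j) = y ord0 j.
Proof. by rewrite mxE liftK. Qed.

Lemma sigma_finite_dirac0 n : sigma_finite setT (@dirac _ 'rV[R]_n 0 R).
Proof.
exists (fun=> setT); first by rewrite bigcup_const.
by move=> i; split => //; rewrite diracT ltry.
Qed.

Definition dirac_rV n : sfm 'rV[R]_n :=
  HB.pack_for (sfm 'rV[R]_n) (@dirac _ 'rV[R]_n 0 R)
    (Measure_isSigmaFinite.Build _ _ _ _ (@sigma_finite_dirac0 n)).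

Section step.
Variables (n : nat) (mu : sfm 'rV[R]_n).

Definition cons_pair (ty : R * 'rV[R]_n) : 'rV[R]_n.+1 := cons_row ty.1 ty.2.
Definition uncons_pair (x : 'rV[R]_n.+1) : R * 'rV[R]_n :=
  (x ord0 ord0, \row_j x ord0 (lift ord0 j)).

Lemma cons_pairK : cancel cons_pair uncons_pair.
Proof.
move=> [t y]; rewrite /uncons_pair cons_row0; congr pair.
by apply/rowP => j; rewrite mxE cons_rowS.
Qed.

Lemma measurable_uncons_pair : measurable_fun setT uncons_pair.
Proof.
apply: measurable_fun_pair; first exact: measurable_coord.
apply: measurable_fun_rV => i; under eq_fun do rewrite mxE.
exact: measurable_coord.
Qed.

Definition lebn_step0 : {measure set 'rV[R]_n.+1 -> \bar R} :=
  measure_function_pushforward__canonical__measure_function_Measure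
    (leb \x mu)%E (@measurable_cons_row R n).

Lemma sigma_finite_lebn_step0 : sigma_finite setT lebn_step0.
Proof.
have /sigma_finiteP [F [FT Fnd Ffin]] := sigma_finiteT (leb : sfm _).
have /sigma_finiteP [G [GT Gnd Gfin]] := sigma_finiteT mu.
have mFG k : measurable (F k `*` G k).
  apply: measurableX; by [case: (Ffin k)|case: (Gfin k)].
exists (fun k => uncons_pair @^-1` (F k `*` G k)).
  apply/esym/seteqP; split => // x _.
  have : [set: R] (uncons_pair x).1 by [].
  have : [set: 'rV[R]_n] (uncons_pair x).2 by [].
  rewrite FT GT => -[j _ Gj] [i _ Fi]; exists (maxn i j) => //; split.
    by have /subsetPset := Fnd _ _ (leq_maxl i j); apply.
  by have /subsetPset := Gnd _ _ (leq_maxr i j); apply.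
move=> k; split.
  by rewrite -[X in measurable X]setTI; exact: (measurable_uncons_pair measurableT (mFG k)).
rewrite /lebn_step0/= /pushforward -comp_preimage.
rewrite (_ : _ \o _ = id); last by apply/funext => ty; exact: cons_pairK.
case: (Ffin k) (Gfin k) => mF Foo [mG Goo].
by rewrite preimage_id product_measure1E// lte_mul_pinfty// ge0_fin_numE.
Qed.

Definition lebn_step : sfm 'rV[R]_n.+1 :=
  HB.pack_for (sfm 'rV[R]_n.+1) (lebn_step0 : set _ -> \bar R)
    (Measure.class lebn_step0)
    (Measure_isSigmaFinite.Build _ _ _ _ sigma_finite_lebn_step0).

End step.

(** The recursion is the one of [iint], so [integral_lebnS] is Tonelli's theorem for a pushforward.
    Sigma-finiteness is rebuilt at each step because Tonelli asks for it on the remaining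
    coordinates. *)
Fixpoint lebn n : sfm 'rV[R]_n :=
  if n is n'.+1 then lebn_step (lebn n') else dirac_rV 0.

Local Open Scope ereal_scope.

Lemma integral_lebn0 (f : 'rV[R]_0 -> \bar R) : measurable_fun setT f ->
  \int[lebn 0]_x f x = f 0%R.
Proof. by move=> mf; rewrite integral_dirac// diracT mul1e. Qed.

Lemma measurable_fun_cons_row n d (T : measurableType d) (f : 'rV[R]_n.+1 -> T) :
  measurable_fun setT f ->
  measurable_fun setT (fun ty : R * 'rV[R]_n => f (cons_row ty.1 ty.2)).
Proof. by move=> mf; exact: (measurableT_comp mf (@measurable_cons_row R n)). Qed.

Lemma measurable_fun_cons_rowr n d (T : measurableType d)
  (f : 'rV[R]_n.+1 -> T) t : measurable_fun setT f ->
  measurable_fun setT (fun y : 'rV[R]_n => f (cons_row t y)).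
Proof.
by move/measurable_fun_cons_row => mf; exact: (measurable_fun_pair2 t mf).
Qed.

Lemma integral_lebnS n (f : 'rV[R]_n.+1 -> \bar R) : measurable_fun setT f ->
  (forall x, 0 <= f x) ->
  \int[lebn n.+1]_x f x = \int[leb]_t \int[lebn n]_y f (cons_row t y).
Proof.
move=> mf f0; rewrite /= [LHS]ge0_integral_pushforward//; last first.
  exact: measurable_cons_row.
rewrite preimage_setT.
apply: (@fubini_tonelli1 _ _ _ _ R leb (lebn n) (fun ty => f (cons_row ty.1 ty.2))) => //.
exact: measurable_fun_cons_row.
Qed.

Lemma integral_lebnS_swap n (f : 'rV[R]_n.+1 -> \bar R) : measurable_fun setT f ->
  (forall x, 0 <= f x) ->
  \int[lebn n.+1]_x f x = \int[lebn n]_y \int[leb]_t f (cons_row t y).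
Proof.
move=> mf f0; rewrite integral_lebnS//.
apply: (@fubini_tonelli _ _ _ _ R leb (lebn n) (fun ty => f (cons_row ty.1 ty.2))) => //.
exact: measurable_fun_cons_row.
Qed.

Lemma measurable_integral_cons_row n (f : 'rV[R]_n.+1 -> \bar R) :
  measurable_fun setT f -> (forall x, 0 <= f x) ->
  measurable_fun setT (fun t => \int[lebn n]_y f (cons_row t y)).
Proof.
move=> /measurable_fun_cons_row mf f0.
exact: (@measurable_fun_fubini_tonelli_F _ _ _ _ R (lebn n) (fun ty => f (cons_row ty.1 ty.2))).
Qed.

Lemma iintE n (f : 'rV[R]_n -> \bar R) : measurable_fun setT f ->
  (forall x, 0 <= f x) -> iint f = \int[lebn n]_x f x.
Proof.
elim: n f => [|n IH] f mf f0; first by rewrite integral_lebn0.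
rewrite integral_lebnS//=; apply: eq_integral => t _.
by apply: IH => //; exact: measurable_fun_cons_rowr.
Qed.

End lebn.

(** * Integrals of nonnegative functions that may be nonmeasurable *)

Section ge0_integral_nonmeasurable.
Local Open Scope ereal_scope.
Context d (T : measurableType d) (R : realType) (mu : {measure set T -> \bar R}).
Implicit Types f g : T -> \bar R.
Import HBNNSimple.

(** The integral of a nonnegative function is a supremum over the simple functions below it, which
    is monotone whether or not the function is measurable. *)
Lemma ge0_le_integralT f g : (forall x, 0 <= f x) -> (forall x, f x <= g x) ->
  \int[mu]_x f x <= \int[mu]_x g x.
Proof.
move=> f0 fg; have g0 x : 0 <= g x by exact: le_trans (fg x).
rewrite !ge0_integralTE//; apply: ge_ereal_sup => _ [h hf <-].
by apply: ereal_sup_ubound; exists h => // x; exact: le_trans (hf x) (fg x).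
Qed.

(** Upper bound: a simple function below [f] lies below [g] almost everywhere. Lower bound: [g] set
    to zero on [N] is measurable, has the same integral and lies below [f] everywhere. *)
Lemma ge0_integral_off_null f g N : measurable N -> mu N = 0 ->
  (forall x, 0 <= f x) -> (forall x, 0 <= g x) -> measurable_fun setT g ->
  (forall x, ~ N x -> f x = g x) -> \int[mu]_x f x = \int[mu]_x g x.
Proof.
move=> mN N0 f0 g0 mg fg; apply/eqP; rewrite eq_le; apply/andP; split.
  rewrite ge0_integralTE//; apply: ge_ereal_sup => _ [h /= hf <-].
  have -> : sintegral mu h = \int[mu]_x (h x)%:E.
    by rewrite integral_nnsfun// patch_setT.
  apply: ae_ge0_le_integral => //.
  - by move=> x _; rewrite lee_fin.
  - exact/measurable_EFinP.
  - exists N; split => // x /= /not_implyP[_]; apply: contra_notP => Nx.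
    by rewrite -fg.
pose g' := g \_ (~` N).
have mg' : measurable_fun setT g'.
  apply/(measurable_restrictT _ _).1 => //; first exact: measurableC.
  exact: measurable_funS mg.
have g'0 x : 0 <= g' x by rewrite /g' patchE; case: ifPn.
have -> : \int[mu]_x g x = \int[mu]_x g' x.
  apply: ge0_ae_eq_integral => //; exists N; split => // x /=.
  apply: contra_notP => Nx _; rewrite /g' patchE ifT//.
  by rewrite inE.
apply: ge0_le_integralT => // x; rewrite /g' patchE.
by case: ifPn => //; rewrite inE/= => Nx; rewrite fg.
Qed.

Lemma measure_support_integral0 f : measurable_fun setT f ->
  (forall x, 0 <= f x) -> \int[mu]_x f x = 0 ->
  measurable [set x | f x != 0] /\ mu [set x | f x != 0] = 0.
Proof.
move=> mf f0 If0.
have ms : measurable [set x | f x != 0].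
  by rewrite -[X in measurable X]setTI; exact: emeasurable_neq.
split => //.
have [+ _] := ae_eq_integral_abs mu measurableT mf.
under eq_integral do rewrite gee0_abs//.
move=> /(_ If0)[N [mN N0 sub]].
apply: (subset_measure0 ms mN _ N0) => x /= fx0; apply: sub => /=.
by apply/not_implyP; split => //; exact/eqP.
Qed.

End ge0_integral_nonmeasurable.

Section iint_off_null.
Local Open Scope ereal_scope.
Context {R : realType}.
Notation leb := (@lebesgue_measure R).

Lemma iint_ge0 n (f : 'rV[R]_n -> \bar R) : (forall x, 0 <= f x) -> 0 <= iint f.
Proof.
elim: n f => [|n IH] f f0 //=.
by apply: integral_ge0 => t _; exact: IH.
Qed.

Lemma lebn0E (N : set 'rV[R]_0) : measurable N -> lebn 0 N = 0 -> ~ N 0%R.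
Proof.
by move=> mN /= + N0; rewrite diracE mem_set//= => /eqP; rewrite eqe oner_eq0.
Qed.

Lemma measurable_cons_slice n (N : set 'rV[R]_n.+1) t : measurable N ->
  measurable [set y | N (cons_row t y)].
Proof.
move=> mN; rewrite -[X in measurable X]setTI.
exact: (measurable_fun_cons_rowr t (@measurable_id _ _ setT)).
Qed.

Lemma measurable_lebn_slice n (N : set 'rV[R]_n.+1) : measurable N ->
  measurable_fun setT (fun t => lebn n [set y | N (cons_row t y)]).
Proof.
move=> mN; have mI : measurable_fun setT (fun x => (\1_N x)%:E : \bar R).
  by apply/measurable_EFinP; exact: measurable_indic.
apply: eq_measurable_fun (measurable_integral_cons_row mI _) => [t _|x].
  rewrite (eq_integral (fun y => (\1_[set y | N (cons_row t y)] y)%:E))//.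
  rewrite integral_indic ?setIT//; exact: measurable_cons_slice.
by rewrite lee_fin.
Qed.

Lemma lebnSE n (N : set 'rV[R]_n.+1) : measurable N ->
  lebn n.+1 N = \int[leb]_t lebn n [set y | N (cons_row t y)].
Proof.
move=> mN; have -> : lebn n.+1 N = \int[lebn n.+1]_x (\1_N x)%:E.
  by rewrite integral_indic// setIT.
rewrite integral_lebnS//; last first.
  by apply/measurable_EFinP; exact: measurable_indic.
apply: eq_integral => t _.
rewrite (eq_integral (fun y => (\1_[set y | N (cons_row t y)] y)%:E))//.
rewrite integral_indic ?setIT//; exact: measurable_cons_slice.
Qed.

(** By Tonelli almost every slice of a null set is null, so the induction replaces the inner
    integral for almost every [t]. The left side is a bare [iint] because the integrands of [Pop]
    inherit any nonmeasurability of [v]. *)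
Lemma iint_off_null n (f g : 'rV[R]_n -> \bar R) N : measurable N ->
  lebn n N = 0 -> (forall x, 0 <= f x) -> (forall x, 0 <= g x) ->
  measurable_fun setT g -> (forall x, ~ N x -> f x = g x) ->
  iint f = \int[lebn n]_x g x.
Proof.
elim: n f g N => [|n IH] f g N mN N0 f0 g0 mg fg.
  by rewrite integral_lebn0//=; exact/fg/lebn0E.
have slice0 : \int[leb]_t lebn n [set y | N (cons_row t y)] = 0.
  by rewrite -lebnSE.
have [mB B0] := @measure_support_integral0 _ _ R leb _
  (measurable_lebn_slice mN) (fun t => measure_ge0 _ _) slice0.
rewrite integral_lebnS//=.
apply: (ge0_integral_off_null mB B0).
- by move=> t; exact: iint_ge0.
- by move=> t; exact: integral_ge0.
- exact: measurable_integral_cons_row.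
move=> t /= /negP; rewrite negbK => /eqP Bt.
apply: (IH _ _ [set y | N (cons_row t y)]) => //.
- exact: measurable_cons_slice.
- exact: measurable_fun_cons_rowr.
- by move=> y; exact: fg.
Qed.
End iint_off_null.

(** * The Brunn-Minkowski and Prekopa-Leindler inequalities *)

Section lebesgue_affine.
Local Open Scope ereal_scope.
Context {R : realType}.
Notation leb := (@lebesgue_measure R).

Lemma measurable_affine (a c : R) : measurable_fun setT (fun x : R => a * x + c)%R.
Proof. by apply: measurable_funD => //; exact: measurable_funM. Qed.

(** The pushforward scaled by [a] gives half-open intervals their length, which characterizes
    Lebesgue measure. *)
Lemma lebesgue_measure_affine (a c : R) (A : set R) : (0 < a)%R -> measurable A ->
  leb A = a%:E * leb ((fun x => a * x + c)%R @^-1` A).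
Proof.
move=> a0 mA.
pose nu : {measure set (measurableTypeR R) -> \bar R} := mscale (NngNum (ltW a0))
  (measure_function_pushforward__canonical__measure_function_Measure leb
    (measurable_affine a c : measurable_fun setT (_ : measurableTypeR R -> measurableTypeR R))).
rewrite (@lebesgue_measure_unique R nu _ A)// => _ [[u v]] _ <-.
rewrite /nu/= /mscale/= /pushforward.
rewrite (_ : _ @^-1` _ = `]((u - c) / a)%R, ((v - c) / a)%R]%classic); last first.
  apply/seteqP; split => x /=; rewrite !in_itv/= ltr_pdivrMr// ler_pdivlMr//;
  by rewrite mulrC => /andP[? ?]; apply/andP; split; lra.
rewrite !lebesgue_measure_itv/= !lte_fin ltr_pM2r ?invr_gt0// ltrD2r.
case: ifPn => _; rewrite ?mule0// -!EFinB -EFinM; congr EFin.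
by field; rewrite gt_eqF.
Qed.

Lemma lebesgue_measure_shift (c : R) (A : set R) : measurable A ->
  leb ((fun x => x + c)%R @^-1` A) = leb A.
Proof.
move=> mA; rewrite (@lebesgue_measure_affine 1 c A)// mul1e.
by congr (leb _); apply/funext => x; rewrite /preimage/= mul1r.
Qed.

Lemma lebesgue_measure_half (A : set R) : measurable A ->
  leb ((fun x => 2^-1 * x)%R @^-1` A) = 2%:E * leb A.
Proof.
move=> mA; rewrite (@lebesgue_measure_affine 2^-1 0 A)//.
rewrite muleA -EFinM mulfV// mul1e.
by congr (leb _); apply/funext => x; rewrite /preimage/= addr0.
Qed.

End lebesgue_affine.

Section brunn_minkowski.
Local Open Scope ereal_scope.
Context {R : realType}.
Notation leb := (@lebesgue_measure R).

Lemma measure_bigcup_le d (T : measurableType d) (mu : {measure set T -> \bar R})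
    (F : (set T)^nat) K : (forall n, measurable (F n)) -> nondecreasing_seq F ->
  (forall n, mu (F n) <= K) -> mu (\bigcup_n F n) <= K.
Proof.
move=> mF ndF FK.
have cF := @nondecreasing_cvg_mu _ _ _ mu F mF (bigcupT_measurable F mF) ndF.
rewrite -(cvg_lim _ cF)//; apply: lime_le; first by apply/cvg_ex; eexists; exact: cF.
exact: nearW.
Qed.

(** Cutting [A] at its own points loses no measure: if [A] is unbounded above, its points go beyond
    every integer; otherwise they come within every [1 / (n + 1)] of [sup A], and [sup A] itself
    adds at most one point. Brunn-Minkowski needs cut points that belong to the sets. *)
Lemma leb_le_left_parts (A : set R) K : measurable A -> A !=set0 ->
  (forall a, A a -> leb (A `&` `]-oo, a]) <= K) -> leb A <= K.
Proof.
move=> mA [a0 Aa0] AK.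
have K0 : 0 <= K by apply: le_trans (AK _ Aa0).
have part r a : A a -> (r <= a)%R -> leb (A `&` `]-oo, r]) <= K.
  move=> Aa ra; apply: le_trans (AK _ Aa); apply: le_measure; rewrite ?inE.
  - by apply: measurableI => //; exact: measurable_itv.
  - by apply: measurableI => //; exact: measurable_itv.
  - by apply: setIS => x /=; rewrite !in_itv/= => /le_trans; apply.
have mpart r : measurable (A `&` `]-oo, r]).
  by apply: measurableI => //; exact: measurable_itv.
have ndpart (r : nat -> R) : {homo r : n m / (n <= m)%N >-> (n <= m)%R} ->
    nondecreasing_seq (fun n => A `&` `]-oo, r n]).
  move=> hr n m nm; apply/subsetPset; apply: setIS => x /=.
  by rewrite !in_itv/= => /le_trans; apply; exact: hr.
have [ubA|nubA] := pselect (has_ubound A); last first.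
  rewrite (_ : A = \bigcup_n (A `&` `]-oo, n%:R])).
    apply: measure_bigcup_le; first by move=> n; exact: mpart.
      by apply: (ndpart (fun n => n%:R)%R) => n m; rewrite ler_nat.
    move=> n; have [a [Aa na]] : exists a, A a /\ (n%:R <= a)%R.
      apply: contrapT => /forallNP H; apply: nubA; exists n%:R => a Aa.
      by have /not_andP[//|/negP] := H a; rewrite -ltNge => /ltW.
    exact: part Aa na.
  apply/seteqP; split => [x Ax|x [n _ []//]].
  exists (Num.truncn `|x|).+1 => //; split => //=; rewrite in_itv/=.
  by rewrite (le_trans (ler_norm x))// ltW// truncnS_gt.
have supA : has_sup A by split => //; exists a0.
pose s := sup A.
have As : A `<=` \bigcup_n (A `&` `]-oo, (s - n.+1%:R^-1)%R]) `|` [set s].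
  move=> x Ax; have : (x <= s)%R by exact: sup_upper_bound.
  rewrite le_eqVlt => /predU1P[->|xs]; [by right|left].
  have sx0 : (0 < s - x)%R by rewrite subr_gt0.
  have [k _ kP] := near_infty_natSinv_lt (PosNum sx0).
  exists k => //; split => //=; rewrite in_itv/=.
  by rewrite lerBrDr -lerBrDl ltW//; exact: (kP k (leqnn _)).
have mU : measurable (\bigcup_n (A `&` `]-oo, (s - n.+1%:R^-1)%R])).
  exact: bigcupT_measurable.
apply: (@le_trans _ _ (leb (\bigcup_n (A `&` `]-oo, (s - n.+1%:R^-1)%R]) `|` [set s]))).
  by apply: le_measure; rewrite ?inE//; exact: measurableU.
apply: (le_trans (measureU2 _ _ _)) => //.
rewrite [X in _ + X]lebesgue_measure_set1 adde0.
apply: measure_bigcup_le; first by move=> n; exact: mpart.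
  apply: (ndpart (fun n => s - n.+1%:R^-1)%R) => n m nm; rewrite lerD2l lerN2 lef_pV2 ?posrE//.
  by rewrite ler_nat.
move=> n; have n0 k : (0 < k.+1%:R^-1 :> R)%R by rewrite invr_gt0.
have [a Aa sa] := sup_adherent (n0 n) supA.
by apply: part Aa _; exact: ltW.
Qed.

Lemma leb_le_right_parts (A : set R) K : measurable A -> A !=set0 ->
  (forall a, A a -> leb (A `&` `[a, +oo[) <= K) -> leb A <= K.
Proof.
move=> mA [a0 Aa0] AK.
have mN (B : set R) : measurable B -> measurable ((-%R : R -> R) @^-1` B).
  by move=> mB; rewrite -[X in measurable X]setTI; exact: oppr_measurable.
rewrite -lebesgue_measureN//; apply: leb_le_left_parts; first exact: mN.
  by exists (- a0)%R; rewrite /= opprK.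
move=> a Aa; apply: le_trans (AK _ Aa).
rewrite -[leRHS]lebesgue_measureN; last first.
  by apply: measurableI => //; exact: measurable_itv.
rewrite /pushforward preimage_setI; apply: le_measure; rewrite ?inE.
- by apply: measurableI; [exact: mN|exact: measurable_itv].
- by apply: measurableI; apply: mN => //; exact: measurable_itv.
- by apply: setIS => x /=; rewrite !in_itv/= andbT lerN2.
Qed.

Lemma brunn_minkowski (A B C : set R) :
  measurable A -> measurable B -> measurable C -> A !=set0 -> B !=set0 ->
  (forall x y, A x -> B y -> C (2^-1 * (x + y))%R) ->
  leb A + leb B <= 2%:E * leb C.
Proof.
move=> mA mB mC A0 B0 ABC.
rewrite -lebesgue_measure_half//; set D := _ @^-1` C.
have mD : measurable D.
  rewrite -[X in measurable X]setTI.
  have mh : measurable_fun setT (fun x : R => 2^-1 * x)%R by exact: measurable_funM.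
  exact: (mh measurableT C mC).
have mshift (S : set R) c : measurable S -> measurable ((fun x => x + c)%R @^-1` S).
  move=> mS; rewrite -[X in measurable X]setTI.
  have mh : measurable_fun setT (fun x : R => x + c)%R by exact: measurable_funD.
  exact: (mh measurableT S mS).
(* The left part of [A] moved by [b] and the right part of [B] moved by [a] meet at most at [a + b],
   and both lie in [D], the dilation of [C] by 2. Opening the interval at [b] makes them disjoint at
   the cost of one null point. *)
have key a b : A a -> B b -> leb (A `&` `]-oo, a]) + leb (B `&` `[b, +oo[) <= leb D.
  move=> Aa Bb.
  have mA' : measurable (A `&` `]-oo, a]).
    by apply: measurableI => //; exact: measurable_itv.
  have mB' : measurable (B `&` `]b, +oo[).
    by apply: measurableI => //; exact: measurable_itv.
  have -> : leb (B `&` `[b, +oo[) = leb (B `&` `]b, +oo[).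
    apply/eqP; rewrite eq_le; apply/andP; split; last first.
      apply: le_measure; rewrite ?inE//; last first.
        by apply: setIS => x /=; rewrite !in_itv/= !andbT => /ltW.
      by apply: measurableI => //; exact: measurable_itv.
    apply: (@le_trans _ _ (leb ((B `&` `]b, +oo[) `|` [set b]))).
      apply: le_measure; rewrite ?inE//.
      - by apply: measurableI => //; exact: measurable_itv.
      - exact: measurableU.
      - move=> x [Bx]; rewrite /= !in_itv/= !andbT le_eqVlt => /predU1P[->|bx].
          by right.
        by left; split => //=; rewrite in_itv/= andbT.
    apply: (le_trans (measureU2 _ _ _)) => //.
    by rewrite [X in _ + X]lebesgue_measure_set1 adde0.
  rewrite -(lebesgue_measure_shift (- b) mA') -(lebesgue_measure_shift (- a) mB').
  rewrite -measureU; last first.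
  - apply/seteqP; split => // z [[_ /=]] + [_ /=].
    by rewrite !in_itv/= andbT; lra.
  - exact: mshift.
  - exact: mshift.
  - apply: le_measure; rewrite ?inE//; first by apply: measurableU; exact: mshift.
    move=> z [[/= Az _]|[/= Bz _]]; rewrite /D/=.
      by rewrite -[z](subrK b); exact: ABC.
    by rewrite -[z](subrK a) addrC; exact: ABC.
(* Once [leb D] is finite so are the parts, and the two exhaustions by cut points can be carried out
   one after the other by moving terms across the inequality. *)
have [->|Dfin] := eqVneq (leb D) +oo; first exact: leey.
have fD : leb D \is a fin_num by rewrite ge0_fin_numE// ltey.
have fin_le (S : set R) K : leb S + K <= leb D -> 0 <= K -> leb S \is a fin_num.
  move=> SK K0; rewrite ge0_fin_numE//; apply: (@le_lt_trans _ _ (leb D)).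
    by apply: le_trans SK; rewrite leeDl.
  by rewrite -ge0_fin_numE.
rewrite -leeBrDr; last first.
  move: (B0) => [b Bb]; apply: (@fin_le _ 0) => //; rewrite adde0.
  apply: leb_le_right_parts => // b' Bb'; case: A0 => a Aa.
  by apply: le_trans (key a b' Aa Bb'); rewrite leeDr.
apply: leb_le_left_parts => // a Aa; rewrite leeBrDr; last first.
  move: (B0) => [b Bb]; apply: (@fin_le _ 0) => //; rewrite adde0.
  apply: leb_le_right_parts => // b' Bb'.
  by apply: le_trans (key a b' Aa Bb'); rewrite leeDr.
rewrite addeC -leeBrDr; last first.
  move: (B0) => [b Bb].
  exact: (fin_le _ _ (key a b Aa Bb)).
apply: leb_le_right_parts => // b Bb; rewrite leeBrDr 1?addeC; first exact: key.
exact: (fin_le _ _ (key a b Aa Bb)).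
Qed.

End brunn_minkowski.

Section prekopa_leindler1.
Local Open Scope ereal_scope.
Context {R : realType}.
Notation leb := (@lebesgue_measure R).

Lemma measurable_superlevel (f : R -> R) r : measurable_fun setT f ->
  measurable [set x | (r < f x)%R].
Proof.
move=> mf; rewrite (_ : [set x | _] = f @^-1` `]r, +oo[).
  by rewrite -[X in measurable X]setTI; apply: mf => //; exact: measurable_itv.
by apply/seteqP; split => x /=; rewrite in_itv/= andbT.
Qed.

Lemma measurable_leb_superlevel (f : R -> R) : measurable_fun setT f ->
  measurable_fun setT (fun r : R => leb [set x | (r < f x)%R]).
Proof.
move=> mf; pose S : set (R * R) := [set xr | (xr.2 < f xr.1)%R].
have mS : measurable S.
  have : measurable_fun setT (fun xr : R * R => (xr.2 < f xr.1)%R).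
    apply: measurable_fun_ltr => //.
    exact: (measurableT_comp mf measurable_fst).
  move=> /(_ measurableT [set true]); rewrite setTI.
  by rewrite (_ : _ @^-1` _ = S)//; apply.
have mI : measurable_fun setT (fun xr : R * R => (\1_S xr)%:E : \bar R).
  by apply/measurable_EFinP; exact: measurable_indic.
have I0 (xr : R * R) : 0 <= (\1_S xr)%:E :> \bar R by rewrite lee_fin.
have := @measurable_fun_fubini_tonelli_G _ _ _ _ R leb _ mI I0.
apply: eq_measurable_fun => r _; rewrite /fubini_G.
rewrite (eq_integral (fun x : measurableTypeR R => (\1_[set x : R | (r < f x)%R] x)%:E)).
  by rewrite integral_indic ?setIT//; exact: measurable_superlevel.
by move=> x _; congr EFin; rewrite !indicE; congr (_ _); apply/propext; rewrite !inE.
Qed.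

(** Truncation at height 1 confines the levels to []0, 1[], the range in which the superlevel sets
    of functions with supremum 1 are nonempty. *)
Lemma layer_cake1 (f : R -> R) : measurable_fun setT f -> (forall x, 0 <= f x)%R ->
  \int[leb]_x (Num.min (f x) 1)%:E =
  \int[leb]_(r in `]0%R, 1%R[) leb [set x | (r < f x)%R].
Proof.
move=> mf f0.
pose S : set (R * R) := [set xr | (0 < xr.2)%R && (xr.2 < Num.min (f xr.1) 1)%R].
have mS : measurable S.
  have mf1 : measurable_fun setT (fun xr : R * R => f xr.1).
    exact: (measurableT_comp mf measurable_fst).
  have : measurable_fun setT (fun xr : R * R =>
    (0 < xr.2)%R && (xr.2 < Num.min (f xr.1) 1)%R).
    apply: measurable_and.
      exact: measurable_fun_ltr.
    apply: measurable_fun_ltr => //.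
    exact: measurable_minr.
  move=> /(_ measurableT [set true]); rewrite setTI.
  by rewrite (_ : _ @^-1` _ = S)//; apply.
have mI : measurable_fun setT (fun xr : R * R => (\1_S xr)%:E : \bar R).
  by apply/measurable_EFinP; exact: measurable_indic.
transitivity (\int[leb]_x \int[leb]_r (\1_S (x, r))%:E).
  apply: eq_integral => x _.
  rewrite (eq_integral (fun r : measurableTypeR R => (\1_(`]0%R, (Num.min (f x) 1)%R[%classic) r)%:E)).
    rewrite integral_indic ?setIT//= .
    rewrite lebesgue_measure_itv/= lte_fin; case: ifPn => [|]; first by rewrite sube0.
    rewrite -leNgt => m0; congr EFin; apply/eqP; rewrite eq_le m0/=.
    by rewrite le_min f0 ler01.
  by move=> r _; congr EFin; rewrite !indicE; congr (nat_of_bool _)%:R.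
rewrite (@fubini_tonelli _ _ _ _ R leb leb (fun xr => (\1_S xr)%:E))//.
rewrite [RHS]integral_mkcond; apply: eq_integral => r _.
rewrite patchE; case: ifPn => r01.
  rewrite (eq_integral (fun x : measurableTypeR R => (\1_[set x : R | (r < f x)%R] x)%:E)).
    by rewrite integral_indic ?setIT//; exact: measurable_superlevel.
  move=> x _; congr EFin; rewrite !indicE; congr (nat_of_bool _)%:R.
  move: r01; rewrite inE/= in_itv/= => /andP[r0 r1].
  by apply/idP/idP; rewrite !inE /S/= r0 lt_min r1 andbT.
apply: integral0_eq => x _; rewrite indicE memNset//.
move=> /= /andP[r0]; rewrite lt_min => /andP[_ r1].
by move/negP: r01; apply; rewrite inE/= in_itv/= r0.
Qed.

(** Brunn-Minkowski is applied level by level: [f x > r] and [g y > r] force [h > r] at the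
    midpoint. Supremum 1 for both functions makes the two superlevel sets nonempty at the same
    levels, which gives the additive form. *)
Lemma prekopa_leindler1_normalized (f g h : R -> R) :
  measurable_fun setT f -> measurable_fun setT g -> measurable_fun setT h ->
  (forall x, 0 <= f x <= 1)%R -> (forall x, 0 <= g x <= 1)%R ->
  (forall x, 0 <= h x)%R ->
  (forall r, r < 1 -> exists x, r < f x)%R ->
  (forall r, r < 1 -> exists x, r < g x)%R ->
  (forall x y, f x * g y <= h (2^-1 * (x + y)) ^+ 2)%R ->
  \int[leb]_x (f x)%:E + \int[leb]_x (g x)%:E <= 2%:E * \int[leb]_x (h x)%:E.
Proof.
move=> mf mg mh f01 g01 h0 supf supg fgh.
have trunc (k : R -> R) : (forall x, 0 <= k x <= 1)%R ->
    \int[leb]_x (k x)%:E = \int[leb]_x (Num.min (k x) 1)%:E.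
  by move=> k1; apply: eq_integral => x _; case/andP: (k1 x) => _ /min_idPl ->.
have k0 (k : R -> R) : (forall x, 0 <= k x <= 1)%R -> forall x, (0 <= k x)%R.
  by move=> k1 x; case/andP: (k1 x).
rewrite (trunc f)// (trunc g)//.
apply: (@le_trans _ _ (2%:E * \int[leb]_x (Num.min (h x) 1)%:E)); last first.
  rewrite lee_pmul2l//; apply: ge0_le_integralT => x.
    by rewrite lee_fin le_min h0 ler01.
  by rewrite lee_fin ge_min lexx.
have mI : measurable (`]0%R, 1%R[%classic : set R) by exact: measurable_itv.
have mlev (k : R -> R) : measurable_fun setT k ->
    measurable_fun (`]0%R, 1%R[%classic : set R) (fun r : R => leb [set x | (r < k x)%R]).
  by move=> mk; apply: measurable_funTS; exact: measurable_leb_superlevel.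
rewrite !layer_cake1//; [|exact: k0|exact: k0].
rewrite -ge0_integralD//; [|exact: mlev|exact: mlev].
rewrite -ge0_integralZl//; last exact: mlev.
rewrite integral_mkcond [leRHS]integral_mkcond.
apply: ge0_le_integralT => r; rewrite !patchE; case: ifPn => //.
  by rewrite adde_ge0.
rewrite inE/= in_itv/= => /andP[r0 r1].
apply: brunn_minkowski; try exact: measurable_superlevel.
- exact: supf.
- exact: supg.
move=> x y /= rf rg; rewrite -(ltr_pXn2r (n:=2))// ?nnegrE ?(ltW r0)//.
apply: lt_le_trans (fgh x y); rewrite expr2.
by apply: ltr_pM => //; exact: ltW.
Qed.

Lemma prekopa_leindler1_bounded (f g h : R -> R) (K : R) :
  measurable_fun setT f -> measurable_fun setT g -> measurable_fun setT h ->
  (forall x, 0 <= f x <= K)%R -> (forall x, 0 <= g x <= K)%R ->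
  (forall x, 0 <= h x)%R ->
  (forall x y, f x * g y <= h (2^-1 * (x + y)) ^+ 2)%R ->
  (\int[leb]_x (f x)%:E) * (\int[leb]_x (g x)%:E) <= (\int[leb]_x (h x)%:E) ^+ 2.
Proof.
move=> mf mg mh fK gK h0 fgh.
have Ige0 (k : R -> R) : (forall x, 0 <= k x)%R -> 0 <= \int[leb]_x (k x)%:E.
  by move=> k0; apply: integral_ge0 => x _; rewrite lee_fin.
have f0 x : (0 <= f x)%R by case/andP: (fK x).
have g0 x : (0 <= g x)%R by case/andP: (gK x).
have hs (k : R -> R) : (forall x, 0 <= k x <= K)%R -> has_sup (range k).
  move=> kK; split; first by exists (k 0%R); exists 0%R.
  by exists K => _ [x _ <-]; case/andP: (kK x).
have ub (k : R -> R) : (forall x, 0 <= k x <= K)%R ->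
    forall x, (k x <= sup (range k))%R.
  by move=> kK x; apply: sup_upper_bound; [exact: hs|exists x].
set a := sup (range f); set b := sup (range g).
have [a0|a0] := leP a 0%R.
  have -> : \int[leb]_x (f x)%:E = 0.
    apply: integral0_eq => x _; congr EFin; apply/eqP; rewrite eq_le f0 andbT.
    by apply: le_trans a0; exact: ub.
  by rewrite mul0e expe2 mule_ge0// Ige0.
have [b0|b0] := leP b 0%R.
  have -> : \int[leb]_x (g x)%:E = 0.
    apply: integral0_eq => x _; congr EFin; apply/eqP; rewrite eq_le g0 andbT.
    by apply: le_trans b0; exact: ub.
  by rewrite mule0 expe2 mule_ge0// Ige0.
(* Dividing [f], [g], [h] by [a], [b], [sqrt (a b)] preserves the midpoint hypothesis and normalizes
   both suprema to 1. *)
set c := Num.sqrt (a * b).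
have c0 : (0 < c)%R by rewrite sqrtr_gt0 mulr_gt0.
have c2 : (c ^+ 2 = a * b)%R by rewrite sqr_sqrtr// ltW// mulr_gt0.
have scale (k : R -> R) (t : R) : measurable_fun setT k -> (forall x, 0 <= k x)%R ->
    (0 < t)%R -> \int[leb]_x (t^-1 * k x)%:E = t^-1%:E * \int[leb]_x (k x)%:E.
  move=> mk k0 t0; rewrite -ge0_integralZl_EFin//.
  - by move=> x _; rewrite lee_fin.
  - exact/measurable_EFinP.
  - by rewrite invr_ge0 ltW.
have := @prekopa_leindler1_normalized (fun x => a^-1 * f x)%R
  (fun x => b^-1 * g x)%R (fun x => c^-1 * h x)%R.
rewrite !scale// => /(_ _ _ _ _ _ _ _ _ _)/wrap[].
- exact: measurable_funM.
- exact: measurable_funM.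
- exact: measurable_funM.
- move=> x; rewrite mulr_ge0 ?invr_ge0 ?(ltW a0)//=.
  by rewrite ler_pdivrMl// mulr1; exact: ub.
- move=> x; rewrite mulr_ge0 ?invr_ge0 ?(ltW b0)//=.
  by rewrite ler_pdivrMl// mulr1; exact: ub.
- by move=> x; rewrite mulr_ge0 ?invr_ge0 ?(ltW c0).
- move=> r r1; have ra : (r * a < a)%R by rewrite gtr_pMl.
  have [_ [x _ <-]] := sup_gt (hs _ fK).1 ra.
  by exists x; rewrite ltr_pdivlMl// mulrC.
- move=> r r1; have rb : (r * b < b)%R by rewrite gtr_pMl.
  have [_ [x _ <-]] := sup_gt (hs _ gK).1 rb.
  by exists x; rewrite ltr_pdivlMl// mulrC.
- move=> x y; rewrite mulrACA -invfM exprMn exprVn c2.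
  by apply: ler_wpM2l => //; rewrite invr_ge0 mulr_ge0// ltW.
have := Ige0 _ f0; have := Ige0 _ g0; have := Ige0 _ h0.
move: (\int[leb]_x (f x)%:E) (\int[leb]_x (g x)%:E) (\int[leb]_x (h x)%:E).
move=> X Y Z; case: Z => [z| |]//; last first.
  by move=> _ _ _ _; rewrite expe2 mulyy leey.
move=> z0 Y0 X0.
have inf_case (t : R) : (0 < t)%R -> t^-1%:E * +oo = +oo :> \bar R.
  by move=> t0; rewrite gt0_muley// lte_fin invr_gt0.
case: X X0 => [x| |]//; last first.
  move=> _; rewrite inf_case// addye ?gt_eqF//.
  by apply: lt_le_trans (ltNyr 0) _; rewrite mule_ge0// lee_fin invr_ge0 ltW.
move=> x0; case: Y Y0 => [y| |]//; last first.
  by move=> _; rewrite inf_case.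
move=> y0; rewrite !lee_fin in x0 y0 z0.
rewrite expe2 -!EFinM -EFinD !lee_fin.
set p := (a^-1 * x)%R; set q := (b^-1 * y)%R => pq.
have p0 : (0 <= p)%R by rewrite mulr_ge0// invr_ge0 ltW.
have q0 : (0 <= q)%R by rewrite mulr_ge0// invr_ge0 ltW.
have -> : x = (a * p)%R by rewrite /p mulVKf// gt_eqF.
have -> : y = (b * q)%R by rewrite /q mulVKf// gt_eqF.
have -> : z = (c * (c^-1 * z))%R by rewrite mulVKf// gt_eqF.
rewrite mulrACA [leRHS]mulrACA -[X in (_ <= X * _)%R]expr2 c2.
apply: ler_wpM2l; first by rewrite mulr_ge0// ltW.
set w := (c^-1 * z)%R in pq *.
have w0 : (0 <= w)%R by rewrite mulr_ge0// invr_ge0 ltW.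
(* AM-GM turns the additive bound [p + q <= 2 w] into [p q <= w^2]. *)
have : ((p + q) ^+ 2 <= (2 * w) ^+ 2)%R by apply: lerXn2r; rewrite ?nnegrE ?addr_ge0// mulr_ge0.
by have := sqr_ge0 (p - q)%R; nra.
Qed.

End prekopa_leindler1.

(** * Truncation of extended real functions *)

Section truncation.
Local Open Scope ereal_scope.
Context {R : realType}.

Definition etrunc (n : nat) (x : \bar R) : R := fine (mine x n%:R%:E).

Lemma etruncE n x : 0 <= x -> (etrunc n x)%:E = mine x n%:R%:E.
Proof.
case: x => [r| |]// _; by rewrite /etrunc -EFin_min.
Qed.

Lemma etrunc_ge0 n x : 0 <= x -> (0 <= etrunc n x)%R.
Proof. by move=> x0; rewrite -lee_fin etruncE// le_min x0 lee_fin/=. Qed.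

Lemma etrunc_le n x : 0 <= x -> (etrunc n x <= n%:R)%R.
Proof. by move=> x0; rewrite -lee_fin etruncE// ge_min lexx orbT. Qed.

Lemma etrunc_lee n x : 0 <= x -> (etrunc n x)%:E <= x.
Proof. by move=> x0; rewrite etruncE// ge_min lexx. Qed.

Lemma etrunc_nd x : 0 <= x -> {homo (fun n => (etrunc n x)%:E) : n m / (n <= m)%N >-> n <= m}.
Proof.
move=> x0 n m nm; rewrite !etruncE// le_min ge_min lexx/= ge_min; apply/orP; right.
by rewrite lee_fin ler_nat.
Qed.

Lemma cvg_etrunc x : 0 <= x -> (fun n => (etrunc n x)%:E) @ \oo --> x.
Proof.
case: x => [r| |]// x0.
  apply: cvg_near_cst; exists (Num.truncn r).+1 => // n /= rn.
  rewrite etruncE//; apply/min_idPl; rewrite lee_fin.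
  by apply: le_trans (ltW (truncnS_gt r)) _; rewrite ler_nat.
rewrite (_ : (fun n => _) = (fun n => n%:R%:E)); first exact/cvgeryP/cvgr_idn.
by apply/funext => n; rewrite etruncE//; apply/min_idPr; rewrite leey.
Qed.

Lemma measurable_etrunc d (T : measurableType d) (f : T -> \bar R) n :
  measurable_fun setT f -> measurable_fun setT (fun x => etrunc n (f x)).
Proof.
move=> mf; have mm : measurable_fun setT (fun x => mine (f x) n%:R%:E).
  exact: measurable_mine.
exact: (measurableT_comp (@fine_measurable R _ measurableT) mm).
Qed.

Lemma cvg_integral_etrunc d (T : measurableType d) (mu : {measure set T -> \bar R})
    (f : T -> \bar R) : measurable_fun setT f -> (forall x, 0 <= f x) ->
  (fun n => \int[mu]_x (etrunc n (f x))%:E) @ \oo --> \int[mu]_x f x.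
Proof.
move=> mf f0.
rewrite (_ : \int[mu]_x f x = \int[mu]_x limn (fun n => (etrunc n (f x))%:E)).
  apply: cvg_monotone_convergence => //.
  - by move=> n; apply/measurable_EFinP; exact: measurable_etrunc.
  - by move=> n x _; rewrite lee_fin etrunc_ge0.
  - by move=> x _; exact: etrunc_nd.
by apply: eq_integral => x _; apply/esym/cvg_lim => //; exact: cvg_etrunc.
Qed.

(** Zero limits are split off so that the limit of the product is taken only where the product of
    the limits is not [0] times [+oo]. *)
Lemma mule_lim_le (u v : (\bar R)^nat) x y K : 0 <= K -> 0 <= x -> 0 <= y ->
  u @ \oo --> x -> v @ \oo --> y -> (forall n, u n * v n <= K) -> x * y <= K.
Proof.
move=> K0 x0 y0 ux vy uvK.
have [->|xn0] := eqVneq x 0; first by rewrite mul0e.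
have [->|yn0] := eqVneq y 0; first by rewrite mule0.
have xy : x *? y.
  by apply: neq0_mule_def; rewrite mule_eq0 negb_or xn0.
have uv : (fun n => u n * v n) @ \oo --> x * y by exact: cvgeM.
by apply: (cvge_to_le uv); exact: nearW.
Qed.

End truncation.

Section prekopa_leindler.
Local Open Scope ereal_scope.
Context {R : realType}.
Notation leb := (@lebesgue_measure R).

(** Truncation keeps the midpoint hypothesis: where [z] exceeds [n], both truncated factors on the
    left are at most [n]. *)
Lemma etrunc_mul_le n (x y z : \bar R) : 0 <= x -> 0 <= y -> 0 <= z ->
  x * y <= z ^+ 2 -> (etrunc n x * etrunc n y <= etrunc n z ^+ 2)%R.
Proof.
move=> x0 y0 z0 xyz.
have xn := etrunc_le n x0; have yn := etrunc_le n y0.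
have x0' := etrunc_ge0 n x0; have y0' := etrunc_ge0 n y0.
have nn : (etrunc n x * etrunc n y <= n%:R ^+ 2)%R by rewrite expr2 ler_pM.
have [zn|nz] := leP z n%:R%:E; last first.
  rewrite {3}/etrunc; have -> : mine z n%:R%:E = n%:R%:E by apply/min_idPr/ltW.
  exact: nn.
rewrite -lee_fin EFin_expe [(etrunc n z)%:E]etruncE//.
have -> : mine z n%:R%:E = z by apply/min_idPl.
apply: le_trans xyz; rewrite EFinM.
by apply: lee_pmul; rewrite ?lee_fin// etrunc_lee.
Qed.

(** Extended real values are allowed because the induction on the dimension applies this to
    marginals, which may be infinite. *)
Lemma prekopa_leindler1 (f g h : R -> \bar R) :
  measurable_fun setT f -> measurable_fun setT g -> measurable_fun setT h ->
  (forall x, 0 <= f x) -> (forall x, 0 <= g x) -> (forall x, 0 <= h x) ->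
  (forall x y, f x * g y <= h (2^-1 * (x + y))%R ^+ 2) ->
  (\int[leb]_x f x) * (\int[leb]_x g x) <= (\int[leb]_x h x) ^+ 2.
Proof.
move=> mf mg mh f0 g0 h0 fgh.
have Ih0 : 0 <= \int[leb]_x h x by exact: integral_ge0.
have cf := @cvg_integral_etrunc R _ _ leb f mf f0.
have cg := @cvg_integral_etrunc R _ _ leb g mg g0.
apply: (mule_lim_le _ _ _ cf cg).
- by rewrite expe2 mule_ge0.
- exact: integral_ge0.
- exact: integral_ge0.
move=> n; apply: le_trans (@prekopa_leindler1_bounded R (fun x => etrunc n (f x))
  (fun x => etrunc n (g x)) (fun x => etrunc n (h x)) n%:R _ _ _ _ _ _ _) _.
- exact: measurable_etrunc.
- exact: measurable_etrunc.
- exact: measurable_etrunc.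
- by move=> x; rewrite etrunc_ge0// etrunc_le.
- by move=> x; rewrite etrunc_ge0// etrunc_le.
- by move=> x; rewrite etrunc_ge0.
- by move=> x y; exact: etrunc_mul_le.
rewrite !expe2; have H : \int[leb]_x (etrunc n (h x))%:E <= \int[leb]_x h x.
  apply: ge0_le_integralT => x; first by rewrite lee_fin etrunc_ge0.
  exact: etrunc_lee.
by apply: lee_pmul => //; apply: integral_ge0 => x _; rewrite lee_fin etrunc_ge0.
Qed.

Theorem prekopa_leindler n (f g h : 'rV[R]_n -> \bar R) :
  measurable_fun setT f -> measurable_fun setT g -> measurable_fun setT h ->
  (forall x, 0 <= f x) -> (forall x, 0 <= g x) -> (forall x, 0 <= h x) ->
  (forall x y, f x * g y <= h (2^-1 *: (x + y))%R ^+ 2) ->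
  (\int[lebn n]_x f x) * (\int[lebn n]_x g x) <= (\int[lebn n]_x h x) ^+ 2.
Proof.
elim: n f g h => [|n IH] f g h mf mg mh f0 g0 h0 fgh.
  by rewrite !integral_lebn0//; have := fgh 0%R 0%R; rewrite addr0 scaler0.
rewrite (integral_lebnS mf f0) (integral_lebnS mg g0) (integral_lebnS mh h0).
apply: prekopa_leindler1.
- exact: measurable_integral_cons_row.
- exact: measurable_integral_cons_row.
- exact: measurable_integral_cons_row.
- by move=> t; exact: integral_ge0.
- by move=> t; exact: integral_ge0.
- by move=> t; exact: integral_ge0.
(* For fixed first coordinates [s] and [t] the slices satisfy the hypothesis in one dimension less,
   so the marginals satisfy it in dimension one. *)
move=> s t; apply: IH => //; try exact: measurable_fun_cons_rowr.
move=> x y; apply: le_trans (fgh _ _) _.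
have -> : (2^-1 *: (cons_row s x + cons_row t y) =
    cons_row (2^-1 * (s + t)) (2^-1 *: (x + y)))%R.
  by apply/rowP => i; rewrite !mxE; case: unliftP => [j _|_]; rewrite ?mxE.
exact: lexx.
Qed.

End prekopa_leindler.

(** * Gaussian densities *)

Section euclid.
Context {R : realType} {n : nat}.
Implicit Types (x y z : 'rV[R]_n) (a b : R).

Lemma dotvC x y : dotv x y = dotv y x.
Proof. by apply: eq_bigr => i _; rewrite mulrC. Qed.

Lemma dotvDl x y z : dotv (x + y) z = dotv x z + dotv y z.
Proof. by rewrite -big_split; apply: eq_bigr => i _; rewrite mxE mulrDl. Qed.

Lemma dotvDr x y z : dotv z (x + y) = dotv z x + dotv z y.
Proof. by rewrite dotvC dotvDl !(dotvC z). Qed.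

Lemma dotvZl a x y : dotv (a *: x) y = a * dotv x y.
Proof. by rewrite mulr_sumr; apply: eq_bigr => i _; rewrite mxE mulrA. Qed.

Lemma dotvZr a x y : dotv x (a *: y) = a * dotv x y.
Proof. by rewrite dotvC dotvZl dotvC. Qed.

Lemma dotvNl x y : dotv (- x) y = - dotv x y.
Proof. by rewrite -scaleN1r dotvZl mulN1r. Qed.

Lemma dotvNr x y : dotv x (- y) = - dotv x y.
Proof. by rewrite dotvC dotvNl dotvC. Qed.

Definition dotvE := (dotvDl, dotvDr, dotvNl, dotvNr, dotvZl, dotvZr).

Lemma dotv_ge0 x : 0 <= dotv x x.
Proof. by apply: sumr_ge0 => i _; rewrite -expr2 sqr_ge0. Qed.

Lemma dotv_eq0 x : dotv x x = 0 -> x = 0.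
Proof.
move=> /eqP; rewrite psumr_eq0 => [/allP x0|i _]; last by rewrite -expr2 sqr_ge0.
apply/rowP => i; have := x0 i (mem_index_enum _).
by rewrite /= -expr2 sqrf_eq0 mxE => /eqP.
Qed.

Lemma enorm_ge0 x : 0 <= enorm x. Proof. exact: sqrtr_ge0. Qed.

Lemma enorm2 x : enorm x ^+ 2 = dotv x x.
Proof. by rewrite sqr_sqrtr// dotv_ge0. Qed.

Lemma enorm_eq0 x : enorm x = 0 -> x = 0.
Proof. by move=> x0; apply: dotv_eq0; rewrite -enorm2 x0 expr0n. Qed.

Lemma enormN x : enorm (- x) = enorm x.
Proof. by rewrite /enorm !dotvE opprK. Qed.

Lemma enormZ a x : enorm (a *: x) = `|a| * enorm x.
Proof. by rewrite /enorm !dotvE mulrA -expr2 sqrtrM ?sqr_ge0// sqrtr_sqr. Qed.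

Lemma dotv_le_enorm x y : dotv x y <= enorm x * enorm y.
Proof.
have [x0|x0] := eqVneq (enorm x) 0.
  by rewrite x0 mul0r (enorm_eq0 x0) /dotv big1// => i _; rewrite mxE mul0r.
have [y0|y0] := eqVneq (enorm y) 0.
  by rewrite y0 mulr0 (enorm_eq0 y0) /dotv big1// => i _; rewrite mxE mulr0.
have xy0 : 0 < enorm x * enorm y by rewrite mulr_gt0// lt_def enorm_ge0 andbT.
have := dotv_ge0 (enorm y *: x - enorm x *: y).
rewrite !dotvE (dotvC y x) -!enorm2 => H.
rewrite -subr_ge0 -(pmulr_rge0 _ xy0) -(pmulr_rge0 _ (ltr0Sn R 1)).
by apply: le_trans H _; rewrite le_eqVlt; apply/orP; left; apply/eqP; ring.
Qed.

Lemma enormD x y : enorm (x + y) <= enorm x + enorm y.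
Proof.
rewrite -(ler_pXn2r (n:=2))// ?nnegrE ?addr_ge0 ?enorm_ge0//.
rewrite enorm2 !dotvE (dotvC y x) sqrrD !enorm2.
have := dotv_le_enorm x y; lra.
Qed.

Lemma enormB x y : enorm (x - y) = enorm (y - x).
Proof. by rewrite -enormN opprB. Qed.

End euclid.

Lemma measurable_dotv (R : realType) d (T : measurableType d) n (f g : T -> 'rV[R]_n) :
  measurable_fun setT f -> measurable_fun setT g ->
  measurable_fun setT (fun x => dotv (f x) (g x)).
Proof.
move=> /measurable_fun_rVP mf /measurable_fun_rVP mg.
apply: measurable_sum => i; exact: measurable_funM.
Qed.

Lemma measurable_enorm (R : realType) d (T : measurableType d) n (f : T -> 'rV[R]_n) :
  measurable_fun setT f -> measurable_fun setT (fun x => enorm (f x)).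
Proof.
move=> mf.
exact: (measurableT_comp (continuous_measurable_fun (@sqrt_continuous R))
  (measurable_dotv mf mf)).
Qed.

Lemma measurable_fun_rVD (R : realType) d (T : measurableType d) n (f g : T -> 'rV[R]_n) :
  measurable_fun setT f -> measurable_fun setT g ->
  measurable_fun setT (fun x => f x + g x).
Proof.
move=> /measurable_fun_rVP mf /measurable_fun_rVP mg.
apply: measurable_fun_rV => i; under eq_fun do rewrite mxE.
exact: measurable_funD.
Qed.

Lemma measurable_fun_rVZ (R : realType) d (T : measurableType d) n (a : R) (f : T -> 'rV[R]_n) :
  measurable_fun setT f -> measurable_fun setT (fun x => a *: f x).
Proof.
move=> /measurable_fun_rVP mf.
apply: measurable_fun_rV => i; under eq_fun do rewrite mxE.
exact: measurable_funM.
Qed.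

Lemma measurable_fun_rVB (R : realType) d (T : measurableType d) n (f g : T -> 'rV[R]_n) :
  measurable_fun setT f -> measurable_fun setT g ->
  measurable_fun setT (fun x => f x - g x).
Proof.
move=> mf mg; under eq_fun do rewrite -scaleN1r.
by apply: measurable_fun_rVD => //; exact: measurable_fun_rVZ.
Qed.

Section gauss.
Context {R : realType}.
Variable (t : R).
Hypothesis t0 : 0 < t.

(** Density of [N(0, 2 t I)], in the parametrization of [Qdens]. *)
Definition gaussd n (z : 'rV[R]_n) : R :=
  (Num.sqrt (4 * pi * t) ^+ n)^-1 * expR (- (enorm z ^+ 2) / (4 * t)).

Lemma gauss_norm_gt0 : 0 < Num.sqrt (4 * pi * t) :> R.
Proof. by rewrite sqrtr_gt0 !mulr_gt0// pi_gt0. Qed.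

Lemma gaussd_gt0 n (z : 'rV[R]_n) : 0 < gaussd z.
Proof. by rewrite mulr_gt0 ?expR_gt0// invr_gt0 exprn_gt0// gauss_norm_gt0. Qed.

Lemma measurable_gaussd d (T : measurableType d) n (f : T -> 'rV[R]_n) :
  measurable_fun setT f -> measurable_fun setT (fun x => gaussd (f x)).
Proof.
move=> mf; apply: measurable_funM => //.
apply: (measurableT_comp (@measurable_expR R)).
apply: measurable_funM => //; apply: measurable_funN.
by apply: measurable_funX; exact: measurable_enorm.
Qed.

Lemma gaussd_cons n (s : R) (y : 'rV[R]_n) (c : 'rV[R]_n.+1) :
  gaussd (cons_row s y - c) =
  normal_pdf (c ord0 ord0) (Num.sqrt (2 * t)) s *
  gaussd (y - \row_j c ord0 (lift ord0 j)).
Proof.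
have s0 : Num.sqrt (2 * t) != 0 :> R by rewrite gt_eqF// sqrtr_gt0 mulr_gt0.
rewrite normal_pdfE// /normal_peak /normal_fun /gaussd.
have s2 : Num.sqrt (2 * t) ^+ 2 = 2 * t by rewrite sqr_sqrtr// mulr_ge0// ltW.
rewrite s2.
rewrite exprS invfM !enorm2 /dotv big_ord_recl !mxE unlift_none.
have -> : 2 * t * pi *+ 2 = 4 * pi * t :> R by ring.
have -> : 2 * t *+ 2 = 4 * t :> R by ring.
have E (a b : R) : expR (- (a + b) / (4 * t)) = expR (- a / (4 * t)) * expR (- b / (4 * t)).
  by rewrite -expRD -mulrDl opprD.
rewrite E [in RHS]expr2.
rewrite [in LHS](eq_bigr (fun i => (y - \row_j c ord0 (lift ord0 j)) ord0 i *
  (y - \row_j c ord0 (lift ord0 j)) ord0 i)); last first.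
  by move=> i _; rewrite !mxE liftK.
by rewrite -!mulrA; congr (_ * _); rewrite mulrCA.
Qed.

Lemma integral_gaussd n (c : 'rV[R]_n) :
  (\int[lebn n]_y (gaussd (y - c))%:E = 1)%E.
Proof.
elim: n c => [|n IH] c.
  rewrite integral_lebn0; last first.
    apply/measurable_EFinP; apply: measurable_gaussd.
    by apply: measurable_fun_rVB.
  by rewrite /gaussd expr0 invr1 mul1r enorm2 /dotv big_ord0 oppr0 mul0r expR0.
rewrite integral_lebnS.
- under eq_integral do under eq_integral do rewrite gaussd_cons EFinM.
  rewrite -[RHS](@integral_normal_pdf R (c ord0 ord0) (Num.sqrt (2 * t))).
  apply: eq_integral => s _.
  rewrite ge0_integralZl_EFin//.
  + by rewrite IH mule1.
  + by move=> y _; rewrite lee_fin ltW// gaussd_gt0.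
  + apply/measurable_EFinP; apply: measurable_gaussd.
    by apply: measurable_fun_rVB.
  + exact: normal_pdf_ge0.
- apply/measurable_EFinP; apply: measurable_gaussd.
  by apply: measurable_fun_rVB.
- by move=> x; rewrite lee_fin ltW// gaussd_gt0.
Qed.

(** The integrand of the chi-square divergence between two Gaussians of equal variance is a multiple
    of a third Gaussian, so that divergence is exactly [expR (|b - b'|^2 / (2 t)) - 1]. *)
Lemma gaussd_sqr_div n (y b b' : 'rV[R]_n) :
  gaussd (y - b') ^+ 2 / gaussd (y - b) =
  expR (enorm (b - b') ^+ 2 / (2 * t)) * gaussd (y - (2 *: b' - b)).
Proof.
rewrite /gaussd; set K := (_ ^+ n)^-1.
have K0 : K != 0 by rewrite invr_neq0// expf_neq0// gt_eqF// gauss_norm_gt0.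
set A := - _ / _; set B := - _ / _; set C := enorm _ ^+ 2 / _; set D := - _ / _.
have -> : (K * expR A) ^+ 2 / (K * expR B) = K * (expR (2 * A) * expR (- B)).
  rewrite expRN [2 * A](_ : _ = A + A) ?expRD; last by ring.
  by field; rewrite K0 gt_eqF// expR_gt0.
rewrite [RHS]mulrCA -!expRD; congr (_ * expR _).
rewrite /A /B /C /D.
rewrite !enorm2 !dotvE !(dotvC b) !(dotvC b').
by field; rewrite gt_eqF.
Qed.
End gauss.

(** * A Poincare inequality for Gaussian averages *)

Section bounded_measurable.
Context d (T : measurableType d) (R : realType).
Implicit Types (u w : T -> R).

(** Boundedness survives products and exponentials, so every expectation against a probability
    density exists. *)
Definition bmf w := measurable_fun setT w /\ exists B, forall x, `|w x| <= B.

Lemma bmf_cst (c : R) : bmf (fun=> c).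
Proof. by split => //; exists `|c|. Qed.

Lemma bmfD u w : bmf u -> bmf w -> bmf (fun x => u x + w x).
Proof.
move=> [mu [B uB]] [mw [C wC]]; split; first exact: measurable_funD.
by exists (B + C) => x; apply: le_trans (ler_normD _ _) _; exact: lerD.
Qed.

Lemma bmfM u w : bmf u -> bmf w -> bmf (fun x => u x * w x).
Proof.
move=> [mu [B uB]] [mw [C wC]]; split; first exact: measurable_funM.
by exists (B * C) => x; rewrite normrM ler_pM.
Qed.

Lemma bmfZ (c : R) w : bmf w -> bmf (fun x => c * w x).
Proof. by apply: bmfM; exact: bmf_cst. Qed.

Lemma bmfN w : bmf w -> bmf (fun x => - w x).
Proof. by move=> /(bmfZ (-1)); under eq_fun do rewrite mulN1r. Qed.

Lemma bmfB u w : bmf u -> bmf w -> bmf (fun x => u x - w x).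
Proof. by move=> bu /bmfN; exact: bmfD. Qed.

Lemma bmfX w n : bmf w -> bmf (fun x => w x ^+ n).
Proof.
move=> bw; elim: n => [|n IH]; first exact: bmf_cst.
by under eq_fun do rewrite exprS; exact: bmfM.
Qed.

Lemma bmf_exp w : bmf w -> bmf (fun x => expR (w x)).
Proof.
move=> [mw [B wB]]; split; first exact: (measurableT_comp (@measurable_expR R)).
exists (expR B) => x; rewrite ger0_norm ?expR_ge0// ler_expR.
exact: le_trans (ler_norm _) (wB x).
Qed.

End bounded_measurable.

Section weight.
Context d (T : measurableType d) (R : realType) (mu : {measure set T -> \bar R}).
Implicit Types (k u w : T -> R).

Definition weight k := [/\ measurable_fun setT k, forall x, 0 <= k x &
  (\int[mu]_x (k x)%:E = 1)%E].

Definition EV k w : R := (\int[mu]_x (k x * w x))%R.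

Section EV.
Variable k : T -> R.
Hypothesis wk : weight k.

Lemma EV_integrable w : bmf w -> mu.-integrable setT (EFin \o (fun x => k x * w x)).
Proof.
case: wk => mk k0 k1 [mw [B wB]].
have ik : mu.-integrable setT (EFin \o k).
  apply/integrableP; split; first exact/measurable_EFinP.
  under eq_integral do rewrite /= ger0_norm//.
  by rewrite k1 ltry.
apply: (le_integrable measurableT _ _ (integrableZl measurableT B ik)).
  by apply/measurable_EFinP; exact: measurable_funM.
move=> x _ /=; rewrite lee_fin !normrM (ger0_norm (k0 x)) mulrC.
by apply: ler_wpM2r => //; exact: le_trans (wB x) (ler_norm B).
Qed.

Lemma EFin_EV w : bmf w -> ((EV k w)%:E = \int[mu]_x (k x * w x)%:E)%E.
Proof.
move=> bw; rewrite /EV /Rintegral fineK//.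
exact: (integrable_fin_num measurableT (EV_integrable bw)).
Qed.

Lemma EVD u w : bmf u -> bmf w -> EV k (fun x => u x + w x) = EV k u + EV k w.
Proof.
move=> bu bw; rewrite /EV -RintegralD//; [|exact: EV_integrable|exact: EV_integrable].
by apply: eq_Rintegral => x _; rewrite mulrDr.
Qed.

Lemma EVZ c w : bmf w -> EV k (fun x => c * w x) = c * EV k w.
Proof.
move=> bw; rewrite /EV -RintegralZl//; last exact: EV_integrable.
by apply: eq_Rintegral => x _; rewrite mulrCA.
Qed.

Lemma EVB u w : bmf u -> bmf w -> EV k (fun x => u x - w x) = EV k u - EV k w.
Proof.
move=> bu bw; rewrite /EV -RintegralB//; [|exact: EV_integrable|exact: EV_integrable].
by apply: eq_Rintegral => x _; rewrite mulrBr.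
Qed.

Lemma EV_cst c : EV k (fun=> c) = c.
Proof.
case: wk => mk k0 k1; have := EVZ c (bmf_cst _ 1).
under eq_fun do rewrite mulr1.
by move=> ->; rewrite /EV; under eq_Rintegral do rewrite mulr1; rewrite /Rintegral k1 mulr1.
Qed.

Lemma EV_le u w : bmf u -> bmf w -> (forall x, u x <= w x) -> EV k u <= EV k w.
Proof.
case: wk => mk k0 k1 bu bw uw.
apply: le_Rintegral => //; [exact: EV_integrable|exact: EV_integrable|].
by move=> x _; apply: ler_wpM2l.
Qed.

Lemma EV_ge0 w : (forall x, 0 <= w x) -> 0 <= EV k w.
Proof.
by case: wk => mk k0 k1 w0; apply: Rintegral_ge0 => x _; rewrite mulr_ge0.
Qed.

Lemma EV_var w : bmf w ->
  EV k (fun x => (w x - EV k w) ^+ 2) = EV k (fun x => w x ^+ 2) - EV k w ^+ 2.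
Proof.
move=> bw; set c := EV k w.
have -> : (fun x => (w x - c) ^+ 2) = (fun x => w x ^+ 2 - (2 * c * w x - c ^+ 2)).
  by apply/funext => x; ring.
have b2 := bmfX 2 bw; have b1 := bmfZ (2 * c) bw; have b0 := bmf_cst T (c ^+ 2).
rewrite EVB//; last exact: bmfB.
by rewrite EVB// EVZ// EV_cst -/c; ring.
Qed.

Lemma EV_sqr_le w : bmf w -> EV k w ^+ 2 <= EV k (fun x => w x ^+ 2).
Proof.
move=> bw; rewrite -subr_ge0 -EV_var//; apply: EV_ge0 => x; exact: sqr_ge0.
Qed.

Lemma EV_norm_le w B : measurable_fun setT w -> (forall x, `|w x| <= B) -> `|EV k w| <= B.
Proof.
move=> mw wB; have bw : bmf w by split => //; exists B.
rewrite ler_norml -{1}[- B]EV_cst -{2}[B]EV_cst; apply/andP; split;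
apply: EV_le => //; try exact: bmf_cst.
- by move=> x; have := wB x; rewrite ler_norml => /andP[].
- by move=> x; have := wB x; rewrite ler_norml => /andP[].
Qed.

End EV.
End weight.

Lemma measurable_param_EV d d' (S : measurableType d) (T : measurableType d')
  (R : realType) (mu : {sigma_finite_measure set T -> \bar R})
  (k w : S * T -> R) (B : R) :
  measurable_fun setT k -> (forall x, weight mu (fun y => k (x, y))) ->
  measurable_fun setT w -> (forall z, `|w z| <= B) ->
  measurable_fun setT (fun x => EV mu (fun y => k (x, y)) (fun y => w (x, y))).
Proof.
move=> mk wk mw wB.
have wm x : measurable_fun setT (fun y => w (x, y)) by exact: measurable_fun_pair2.
have bw x : bmf (fun y => w (x, y)) by split => //; exists B.
(* Adding [B] makes the integrand nonnegative, as Tonelli requires; the weights have mass 1, so the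
   expectation shifts by exactly [B]. *)
have -> : (fun x => EV mu (fun y => k (x, y)) (fun y => w (x, y))) =
    (fun x => fine (\int[mu]_y (k (x, y) * (w (x, y) + B))%:E) - B).
  apply/funext => x; rewrite -[fine _]/(EV mu (fun y => k (x, y)) (fun y => w (x, y) + B)).
  by rewrite EVD//; [rewrite EV_cst// addrK|exact: bmf_cst].
apply: measurable_funB => //.
apply: (measurableT_comp (@fine_measurable R _ measurableT)).
apply: (@measurable_fun_fubini_tonelli_F _ _ S T R mu
  (fun z => (k z * (w z + B))%:E)).
  by apply/measurable_EFinP; apply: measurable_funM => //; exact: measurable_funD.
move=> [x y]; have [_ k0 _] := wk x; rewrite lee_fin mulr_ge0//.
by have := wB (x, y); rewrite ler_norml => /andP[+ _]; lra.
Qed.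

Section aux.
Context {R : realType}.

(** Pointwise, [e (1 - g2 / g1) w <= e^2 A w^2 + (1 - g2 / g1)^2 / (4 A)]; weighted by [g1], the
    last term integrates to [(r - 1) / (4 A)]. Writing [g2^2 / g1] as [r g3] keeps every piece an
    expectation of a bounded function. *)
Lemma EV_diff_le d (T : measurableType d) (nu : {measure set T -> \bar R})
    (g1 g2 g3 w : T -> R) (r e A : R) :
  weight nu g1 -> weight nu g2 -> weight nu g3 -> bmf w -> 0 < A ->
  (forall y, 0 < g1 y) -> (forall y, r * g3 y = g2 y ^+ 2 / g1 y) ->
  e * (EV nu g1 w - EV nu g2 w) <=
  e ^+ 2 * A * EV nu g1 (fun y => w y ^+ 2) + (r - 1) / (4 * A).
Proof.
move=> w1 w2 w3 bw A0 g1_gt0 rg3.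
have c1 := bmf_cst T (1 : R); have bw2 := bmfX 2 bw.
have ebw := bmfZ e bw; have ebw2 := bmfZ (e ^+ 2 * A) bw2.
have cA c := bmf_cst T (c : R).
pose k := (4 * A)^-1.
have b1 : bmf (fun y => e ^+ 2 * A * w y ^+ 2 + k - e * w y).
  by apply: bmfB => //; exact: bmfD.
have b2 : bmf (fun y : T => r * k) by [].
have b3 : bmf (fun y => 2 * k - e * w y) by exact: bmfB.
have E1 : EV nu g1 (fun y => e ^+ 2 * A * w y ^+ 2 + k - e * w y) =
    e ^+ 2 * A * EV nu g1 (fun y => w y ^+ 2) + k - e * EV nu g1 w.
  rewrite (EVB w1)//; last exact: bmfD.
  by rewrite (EVD w1)// (EVZ w1)// (EVZ w1)// (EV_cst w1).
have E3 : EV nu g2 (fun y => 2 * k - e * w y) = 2 * k - e * EV nu g2 w.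
  by rewrite (EVB w2)// (EVZ w2)// (EV_cst w2).
have E2 : EV nu g3 (fun=> r * k) = r * k by rewrite (EV_cst w3).
have i1 := EV_integrable w1 b1.
have i2 := EV_integrable w3 b2.
have i3 := EV_integrable w2 b3.
have i23 := integrableB measurableT i2 i3.
have : 0 <= \int[nu]_y (g1 y * (e ^+ 2 * A * w y ^+ 2 + k - e * w y) +
    (g3 y * (r * k) - g2 y * (2 * k - e * w y))).
  apply: Rintegral_ge0 => y _.
  have sA0 : 0 < Num.sqrt A by rewrite sqrtr_gt0.
  have H : r * g3 y * k = g2 y ^+ 2 / g1 y * k by rewrite rg3.
  rewrite (mulrA (g3 y)) (mulrC (g3 y)) H.
  have : 0 <= g1 y * (e * Num.sqrt A * w y - (1 - g2 y / g1 y) / (2 * Num.sqrt A)) ^+ 2.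
    by rewrite mulr_ge0 ?sqr_ge0// ltW.
  move: (g1_gt0 y); move: (g1 y) (g2 y) (w y) => a b' c a0.
  congr (_ <= _); rewrite /k -[in RHS](@sqr_sqrtr _ A) ?ltW//.
  by field; rewrite !gt_eqF.
rewrite (RintegralD measurableT i1 i23) (RintegralB measurableT i2 i3).
rewrite -[X in X + _]/(EV nu g1 _) -[X in _ + (X - _)]/(EV nu g3 _) -[X in _ + (_ - X)]/(EV nu g2 _).
rewrite E1 E2 E3.
move: (EV nu g1 w) (EV nu g2 w) (EV nu g1 _) => a b' c.
rewrite [(r - 1) / _]mulrBl mul1r -/k; lra.
Qed.

Lemma expR_sub1_le (r : R) : 0 <= r -> r <= 2^-1 -> expR r - 1 <= 2 * r.
Proof.
move=> r0 r12; have := expR_ge1Dx (- r); rewrite expRN.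
have E := expR_gt0 r => H.
have : (1 + - r) * expR r <= 1.
  by rewrite -ler_pdivlMr// mul1r.
by nra.
Qed.

(** Square of [1 + s / 2 <= expR (s / 2)], allowed as soon as the left side is nonnegative. *)
Lemma expR_ge_quad (s : R) : -2 <= s -> 1 + s + s ^+ 2 / 4 <= expR s.
Proof.
move=> s2; have -> : expR s = expR (s / 2) ^+ 2.
  by rewrite expr2 -expRD; congr expR; lra.
have -> : 1 + s + s ^+ 2 / 4 = (1 + s / 2) ^+ 2 by field.
by apply: lerXn2r; rewrite ?nnegrE ?expR_ge0 ?expR_ge1Dx//; lra.
Qed.

Lemma ler_small_perturbation (X Y K e0 : R) : 0 <= K -> 0 < e0 ->
  (forall e, 0 < e -> e <= e0 -> X <= Y + e ^+ 2 * K) -> X <= Y.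
Proof.
move=> K0 e00 H; apply/ler_addgt0Pr => d d0.
pose e := Num.min (Num.min e0 1) (d / (K + 1)).
have K1 : 0 < K + 1 by lra.
have e_gt0 : 0 < e by rewrite !lt_min e00 ltr01 divr_gt0.
have ee0 : e <= e0 by rewrite !ge_min lexx.
have e1 : e <= 1 by rewrite !ge_min lexx orbT.
have ed : e * (K + 1) <= d by rewrite -ler_pdivlMr// ge_min lexx orbT.
apply: le_trans (H _ e_gt0 ee0) _; rewrite lerD2l.
have : e ^+ 2 * K <= e * K.
  by apply: ler_wpM2r => //; rewrite expr2 ler_piMr// ltW.
by lra.
Qed.

(** Here [s] stands for [|b x - b x'|^2] and [q] for [|x - x'|^2]. For [s <= t] the exponential is
    linear up to a factor 2, and [A] is the value that brings the chi-square term down to [m q / 4].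
    For [s > t] the points are far apart, and the crude bound [|phi - phi'| <= 2 B] suffices because
    [e] is small. *)
Lemma contract_aux (m t l B e s q phi phi' J : R) :
  0 < m -> 0 < t -> 0 < l -> 0 < B -> 0 < e -> 8 * e * B * l ^+ 2 <= m * t ->
  let A := l ^+ 2 / (m * t) in
  s <= l ^+ 2 * q -> 0 <= s -> 0 <= J -> `|phi| <= B -> `|phi'| <= B ->
  e * (phi - phi') <= e ^+ 2 * A * J + (expR (s / (2 * t)) - 1) / (4 * A) ->
  e * phi - e ^+ 2 * A * J - e * phi' <= m / 4 * q.
Proof.
move=> m0 t0 l0 B0 e0 small A bl s0 J0 H1 H2 H.
have A0 : 0 < A by rewrite divr_gt0 ?exprn_gt0 ?mulr_gt0.
rewrite addrAC -mulrBr.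
have [st|ts] := leP (s / (2 * t)) 2^-1.
  have H3 : (expR (s / (2 * t)) - 1) / (4 * A) <= m / 4 * q.
    rewrite ler_pdivrMr; last by rewrite mulr_gt0.
    apply: le_trans (expR_sub1_le _ st) _; first by rewrite divr_ge0// mulr_ge0// ltW.
    have -> : 2 * (s / (2 * t)) = s / t by field; rewrite gt_eqF.
    have -> : m / 4 * q * (4 * A) = l ^+ 2 * q / t by rewrite /A; field; rewrite !gt_eqF.
    by rewrite ler_pM2r ?invr_gt0.
  by rewrite lerBlDr; apply: le_trans H _; rewrite addrC lerD2r.
have {}ts : t < s.
  by move: ts; rewrite ltr_pdivlMr ?mulr_gt0// mulrA mulVf// mul1r.
have H3 : phi - phi' <= 2 * B.
  by move: H1 H2; rewrite !ler_norml => /andP[_ ?] /andP[? _]; lra.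
have H4 : e * (phi - phi') <= e * (2 * B) by rewrite ler_pM2l.
have H5 : 0 <= e ^+ 2 * A * J.
  by apply: mulr_ge0 => //; apply: mulr_ge0; [exact: sqr_ge0|exact: ltW].
have H6 : e * (2 * B) <= m / 4 * q.
  have l2 : 0 < l ^+ 2 by rewrite exprn_gt0.
  rewrite -(ler_pM2l l2); have tq : t <= l ^+ 2 * q by lra.
  have mtq : m * t <= m * (l ^+ 2 * q) by rewrite ler_pM2l.
  by clear -small mtq; lra.
by apply: le_trans H6; apply: le_trans H4; rewrite gerBl.
Qed.

End aux.

(** * Variance bound for the local means *)

Section contract_variance.
Context {R : realType} (n : nat).
Notation V := 'rV[R]_n.
Notation mu := (@lebn R n).
Variables (p : V -> R) (m : R).
Hypotheses (wp : weight mu p) (m0 : 0 < m)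
  (pmid : forall x y, p x * p y * expR (m / 4 * enorm (x - y) ^+ 2) <=
     p (2^-1 *: (x + y)) ^+ 2).

Lemma prekopa_leindler_EV (f g : V -> R) : bmf f -> bmf g ->
  (forall x y, f x - g y <= m / 4 * enorm (x - y) ^+ 2) ->
  EV mu p (fun x => expR (f x)) * EV mu p (fun x => expR (- g x)) <= 1.
Proof.
move=> bf bg fg; case: wp => mp p0 p1.
have bef := bmf_exp bf; have beg := bmf_exp (bmfN bg).
rewrite -lee_fin EFinM !EFin_EV// -[leRHS]mule1 -p1 -expe2.
have mbm (w : V -> R) : bmf w -> measurable_fun setT (fun x => (p x * w x)%:E).
  by move=> [mw _]; apply/measurable_EFinP; exact: measurable_funM.
apply: prekopa_leindler.
- exact: mbm.
- exact: mbm.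
- exact/measurable_EFinP.
- by move=> x; rewrite lee_fin mulr_ge0 ?expR_ge0.
- by move=> x; rewrite lee_fin mulr_ge0 ?expR_ge0.
- by move=> x; rewrite lee_fin.
move=> x y; rewrite -EFinM expe2 -EFinM lee_fin -expr2.
apply: le_trans (pmid x y); rewrite mulrACA -expRD.
by apply: ler_wpM2l; rewrite ?mulr_ge0// ler_expR.
Qed.

Variables (phi J : V -> R) (A e0 : R).
Hypotheses (bphi : bmf phi) (bJ : bmf J) (J0 : forall x, 0 <= J x) (A0 : 0 < A)
  (e00 : 0 < e0) (contr : forall e x y, 0 < e -> e <= e0 ->
    e * phi x - e ^+ 2 * A * J x - e * phi y <= m / 4 * enorm (x - y) ^+ 2).

(** As [psi] is centred, the factor with [expR (- e psi)] is at least 1, so the other factor is at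
    most 1. Its second-order expansion compares [e^2 E(psi^2) / 8] with [e^2 A E(J)], and dividing
    by [e^2] leaves an error of order [e^2]. *)
Lemma contract_variance :
  EV mu p (fun x => (phi x - EV mu p phi) ^+ 2) <= 8 * A * EV mu p J.
Proof.
set c := EV mu p phi; pose psi x := phi x - c.
have bc := bmf_cst V c.
have bpsi : bmf psi by exact: bmfB.
have [_ [D psiD]] := bpsi; have [_ [C JC]] := bJ.
have D0 : 0 <= D by apply: le_trans (psiD 0).
have C0 : 0 <= C by apply: le_trans (JC 0).
have Epsi : EV mu p psi = 0 by rewrite (EVB wp)// (EV_cst wp) subrr.
have [bpsi2 bJ2] := (bmfX 2 bpsi, bmfX 2 bJ).
(* The bound [2 / (D + A C + 1)] keeps the exponent [a] above [-2], the range of [expR_ge_quad]; the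
   bound 1 lets [e^2] be replaced by [e]. *)
pose e1 := Num.min (Num.min 1 e0) (2 / (D + A * C + 1)).
have DC0 : 0 < D + A * C + 1 by rewrite ltr_wpDl// addr_ge0// mulr_ge0// ltW.
have e1_gt0 : 0 < e1 by rewrite !lt_min ltr01 e00 divr_gt0.
apply: (@ler_small_perturbation _ _ _ (2 * A ^+ 2 * EV mu p (fun x => J x ^+ 2)) e1) => //.
  apply: mulr_ge0; first by apply: mulr_ge0 => //; exact: sqr_ge0.
  by apply: EV_ge0 => // x; exact: sqr_ge0.
move=> e e_gt0; rewrite !le_min -andbA => /and3P[le1 ee0].
rewrite ler_pdivlMr// => e2.
pose a x := e * psi x - e ^+ 2 * A * J x.
have ba : bmf a by apply: bmfB; exact: bmfZ.
have bepsi : bmf (fun x => e * psi x) by exact: bmfZ.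
have PL : EV mu p (fun x => expR (a x)) * EV mu p (fun x => expR (- (e * psi x))) <= 1.
  apply: prekopa_leindler_EV => // x y.
  have := @contr e x y e_gt0 ee0.
  by rewrite /a /psi; lra.
have ge1 : 1 <= EV mu p (fun x => expR (- (e * psi x))).
  have -> : 1 = EV mu p (fun x => 1 - e * psi x).
    by rewrite EVB ?EV_cst ?EVZ ?Epsi ?mulr0 ?subr0//; exact: bmf_cst.
  apply: EV_le => //.
  - by apply: bmfB => //; exact: bmf_cst.
  - by apply: bmf_exp; exact: bmfN.
  - by move=> x; have := expR_ge1Dx (- (e * psi x)).
have Ele1 : EV mu p (fun x => expR (a x)) <= 1.
  apply: le_trans PL; apply: ler_peMr => //.
  by apply: EV_ge0 => // x; exact: expR_ge0.
(* The square [(e psi - e^2 A J)^2 / 4] is split by [(a - b)^2 >= a^2 / 2 - b^2]; this lowers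
   [1 / 4] to [1 / 8] and is the source of the constant 8. *)
have lower x : 1 + (e * psi x + - (e ^+ 2 * A * J x)) +
   (e ^+ 2 / 8 * psi x ^+ 2 + - (e ^+ 4 * A ^+ 2 / 4 * J x ^+ 2)) <= expR (a x).
  apply: le_trans (@expR_ge_quad _ (a x) _).
    have := sqr_ge0 (e * psi x / 2 - e ^+ 2 * A * J x).
    by rewrite /a; lra.
  have H1 : - (e * D) <= e * psi x.
    by rewrite -mulrN ler_pM2l//; have := psiD x; rewrite ler_norml => /andP[].
  have H2 : e ^+ 2 * A * J x <= e * (A * C).
    rewrite -mulrA; apply: ler_pM.
    - exact: sqr_ge0.
    - by rewrite mulr_ge0// ltW.
    - by rewrite expr2 ler_piMr// ltW.
    - by rewrite ler_pM2l//; exact: le_trans (ler_norm _) (JC x).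
  by rewrite /a; lra.
have b1 := bmf_cst V (1 : R).
have b2 := bmfN (bmfZ (e ^+ 2 * A) bJ).
have b3 := bmfZ (e ^+ 2 / 8) bpsi2.
have b4 := bmfN (bmfZ (e ^+ 4 * A ^+ 2 / 4) bJ2).
have b12 := bmfD bepsi b2; have b34 := bmfD b3 b4.
have := EV_le wp (bmfD (bmfD b1 b12) b34) (bmf_exp ba) lower.
rewrite (EVD wp (bmfD b1 b12) b34) (EVD wp b1 b12) (EVD wp bepsi b2) (EVD wp b3 b4).
have EVN (w : V -> R) : bmf w -> EV mu p (fun x => - w x) = - EV mu p w.
  move=> bw; have := EVZ wp (-1) bw; rewrite mulN1r => <-.
  by congr EV; apply/funext => x; rewrite mulN1r.
rewrite (EV_cst wp) (EVZ wp e bpsi) Epsi mulr0 add0r.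
rewrite (EVN _ (bmfZ _ bJ)) (EVN _ (bmfZ _ bJ2)) (EVZ wp _ bJ) (EVZ wp _ bJ2) (EVZ wp _ bpsi2).
have e2_gt0 : 0 < e ^+ 2 by rewrite exprn_gt0.
rewrite -[EV mu p (fun x => (phi x - c) ^+ 2)]/(EV mu p (fun x => psi x ^+ 2)).
move: Ele1.
move: (EV mu p (fun x => psi x ^+ 2)) (EV mu p J) (EV mu p (fun x => J x ^+ 2)) (EV mu p _).
move=> X Y Z W Ele1 H; rewrite -(ler_pM2l e2_gt0); lra.
Qed.

End contract_variance.

Section poincare.
Context {R : realType} (n : nat).
Notation V := 'rV[R]_n.
Notation mu := (@lebn R n).

Variables (p : V -> R) (m : R) (b : V -> V) (l t : R).
Hypotheses (wp : weight mu p) (m0 : 0 < m)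
  (pmid : forall x y, p x * p y * expR (m / 4 * enorm (x - y) ^+ 2) <=
     p (2^-1 *: (x + y)) ^+ 2)
  (mb : measurable_fun setT b) (l0 : 0 < l)
  (blip : forall x y, enorm (b x - b y) <= l * enorm (x - y)) (t0 : 0 < t).

Definition gker x y := gaussd t (y - b x).
Notation G := gker.

Lemma weight_gaussd (c : V) : weight mu (fun y => gaussd t (y - c)).
Proof.
split; last exact: integral_gaussd.
- by apply: measurable_gaussd; exact: measurable_fun_rVB.
- by move=> y; rewrite ltW// gaussd_gt0.
Qed.

Lemma measurable_gaussd_joint :
  measurable_fun setT (fun xy : V * V => gaussd t (xy.2 - b xy.1)).
Proof.
apply: measurable_gaussd; apply: measurable_fun_rVB => //.
exact: (measurableT_comp mb measurable_fst).
Qed.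

Definition local_mean (u : V -> R) x := EV mu (G x) u.
(** Centred at [u x] and not at the local mean: it is the mean squared jump out of [x], so averaging
    it against [p] gives a Dirichlet form. *)
Definition local_var (u : V -> R) x := EV mu (G x) (fun y => (u x - u y) ^+ 2).

Variables (u : V -> R) (B : R).
Hypotheses (mu_ : measurable_fun setT u) (B0 : 0 < B) (uB : forall x, `|u x| <= B).

Let bu : bmf u. Proof. by split => //; exists B. Qed.
Let bdiff2 x : bmf (fun y => (u x - u y) ^+ 2).
Proof. by apply: bmfX; apply: bmfB => //; exact: bmf_cst. Qed.

Let wG x : weight mu (G x). Proof. exact: (weight_gaussd (b x)). Qed.

Lemma local_meanE x : local_mean u x = EV mu (G x) u. Proof. by []. Qed.

Lemma local_varE x :
  local_var u x = EV mu (G x) (fun y => (u x - u y) ^+ 2).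
Proof. by []. Qed.

Lemma local_var_ge0 x : 0 <= local_var u x.
Proof. by apply: EV_ge0 => [|y]; [exact: wG|exact: sqr_ge0]. Qed.

Lemma local_mean_le x : `|local_mean u x| <= B.
Proof. by apply: EV_norm_le => //; exact: wG. Qed.

Lemma diff2_le x y : `|(u x - u y) ^+ 2| <= (2 * B) ^+ 2.
Proof.
rewrite normrX; apply: lerXn2r; rewrite ?nnegrE ?mulr_ge0 ?(ltW B0)//.
by apply: le_trans (ler_normB _ _) _; have := uB x; have := uB y; lra.
Qed.

Lemma local_mean_bmf : bmf (local_mean u).
Proof.
split; last by exists B; exact: local_mean_le.
apply: (@measurable_param_EV _ _ V V R mu (fun xy => gaussd t (xy.2 - b xy.1))
  (fun xy => u xy.2) B) => //.
- exact: measurable_gaussd_joint.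
- exact: (measurableT_comp mu_ measurable_snd).
Qed.

Lemma local_var_bmf : bmf (local_var u).
Proof.
split; last first.
  exists ((2 * B) ^+ 2) => x; apply: EV_norm_le.
  - exact: wG.
  - by case: (bdiff2 x).
  - exact: diff2_le.
apply: (@measurable_param_EV _ _ V V R mu (fun xy => gaussd t (xy.2 - b xy.1))
  (fun xy => (u xy.1 - u xy.2) ^+ 2) ((2 * B) ^+ 2)) => //.
- exact: measurable_gaussd_joint.
- apply: measurable_funX; apply: measurable_funB.
    exact: (measurableT_comp mu_ measurable_fst).
  exact: (measurableT_comp mu_ measurable_snd).
- by move=> xy; exact: diff2_le.
Qed.

(* AM-GM against the chi-square divergence of the two Gaussians *)
Lemma local_mean_diff x x' e A : 0 < A ->
  e * (local_mean u x - local_mean u x') <= e ^+ 2 * A * local_var u x +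
    (expR (enorm (b x - b x') ^+ 2 / (2 * t)) - 1) / (4 * A).
Proof.
move=> A0; pose w y := u y - u x.
have bw : bmf w by apply: bmfB => //; exact: bmf_cst.
pose G'' y := gaussd t (y - (2 *: b x' - b x)).
have meanE z : local_mean u z = EV mu (G z) w + u x.
  rewrite local_meanE /w (EVB (wG z))//; last exact: bmf_cst.
  by rewrite (EV_cst (wG z)) subrK.
have -> : local_var u x = EV mu (G x) (fun y => w y ^+ 2).
  by congr EV; apply/funext => y; rewrite /w; ring.
have wG'' : weight mu G'' by exact: (weight_gaussd (2 *: b x' - b x)).
have H (a b0 c : R) : a + c - (b0 + c) = a - b0 by ring.
rewrite [X in _ * X](etrans (congr2 (fun a b0 => a - b0) (meanE x) (meanE x')) (H _ _ _)).
apply: (EV_diff_le _ (wG x) (wG x') wG'' bw A0) => y; first exact: gaussd_gt0.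
exact/esym/gaussd_sqr_div.
Qed.

Let A := l ^+ 2 / (m * t).
Let A0 : 0 < A. Proof. by rewrite divr_gt0 ?exprn_gt0 ?mulr_gt0. Qed.

Lemma local_mean_contract e x x' : 0 < e -> 8 * e * B * l ^+ 2 <= m * t ->
  e * local_mean u x - e ^+ 2 * A * local_var u x - e * local_mean u x' <=
  m / 4 * enorm (x - x') ^+ 2.
Proof.
move=> e0 small.
have bl : enorm (b x - b x') ^+ 2 <= l ^+ 2 * enorm (x - x') ^+ 2.
  by rewrite -exprMn; apply: lerXn2r (blip x x'); rewrite nnegrE ?mulr_ge0 ?enorm_ge0// ltW.
have := local_mean_diff x x' e A0.
have := local_mean_le x'; have := local_mean_le x; have := local_var_ge0 x.
have := sqr_ge0 (enorm (b x - b x')); move: bl.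
move: (enorm (b x - b x') ^+ 2) (enorm (x - x') ^+ 2) => s q bl s0.
exact: contract_aux.
Qed.

(** By Jensen [(u - phi)^2 <= J] for the local mean [phi] and local variance [J], so
    [(u - c)^2 <= 2 J + 2 (phi - c)^2]; the last term contributes twice [8 A]. *)
Theorem poincare_bounded :
  EV mu p (fun x => u x ^+ 2) - EV mu p u ^+ 2 <=
  (16 * A + 2) * EV mu p (local_var u).
Proof.
set c := EV mu p (local_mean u).
have bphi := local_mean_bmf; have bJ := local_var_bmf.
have bc := bmf_cst V c.
have bpc2 := bmfX 2 (bmfB bphi bc); have buc2 := bmfX 2 (bmfB bu bc).
have E1 : EV mu p (fun x => u x ^+ 2) - EV mu p u ^+ 2 <= EV mu p (fun x => (u x - c) ^+ 2).
  have -> : (fun x => (u x - c) ^+ 2) = (fun x => u x ^+ 2 - (2 * c * u x - c ^+ 2)).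
    by apply/funext => x; ring.
  have b2 := bmfX 2 bu; have b1 := bmfZ (2 * c) bu; have b0 := bmf_cst V (c ^+ 2).
  rewrite EVB//; last exact: bmfB.
  rewrite EVB// EVZ// EV_cst//.
  by have := sqr_ge0 (EV mu p u - c); lra.
apply: le_trans E1 _.
have H x : (u x - c) ^+ 2 <= 2 * local_var u x + 2 * (local_mean u x - c) ^+ 2.
  have bd : bmf (fun y => u x - u y) by apply: bmfB => //; exact: bmf_cst.
  have := EV_sqr_le (wG x) bd; rewrite EVB//; last exact: bmf_cst.
  rewrite EV_cst// -local_meanE -local_varE => H.
  move: H; move: (local_mean u x) (local_var u x) (u x) => a J v H.
  by have := sqr_ge0 (v + c - 2 * a); nra.
apply: le_trans (EV_le wp buc2 (bmfD (bmfZ 2 bJ) (bmfZ 2 bpc2)) H) _.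
rewrite EVD//; [|exact: bmfZ|exact: bmfZ].
rewrite !EVZ//; have : EV mu p (fun x => (local_mean u x - c) ^+ 2) <= 8 * A * EV mu p (local_var u).
  have l2 : 0 < l ^+ 2 by rewrite exprn_gt0.
  (* The threshold on [e] is the smallness condition of [local_mean_contract] solved for [e]. *)
  apply: (@contract_variance _ _ _ _ wp pmid _ _ _ (m * t / (8 * B * l ^+ 2))) => //.
  - exact: local_var_ge0.
  - by rewrite divr_gt0 ?mulr_gt0.
  - move=> e x y e0; rewrite ler_pdivlMr ?mulr_gt0// => small.
    by apply: local_mean_contract => //; lra.
move: (EV mu p (local_var u)) (EV mu p _) => a b0; lra.
Qed.

End poincare.

(** * Minorization of the MALA kernel *)

Section gradient.
Context {R : realType} (d : nat).
Notation V := 'rV[R]_d.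

Lemma diff_dotv_grad (f : V -> R) (x y : V) : 'd f x y = dotv (grad f x) y.
Proof.
rewrite {1}(row_sum_delta y) linear_sum; apply: eq_bigr => i _.
by rewrite linearZ /= mxE mulrC.
Qed.

Lemma is_derive_line (f : V -> R) (x y : V) (s : R) : (forall z, differentiable f z) ->
  is_derive s 1 (fun s => f (x + s *: y)) (dotv (grad f (x + s *: y)) y).
Proof.
move=> df.
have dg : is_diff s (cst x + ( *:%R ^~ y)) (0 + ( *:%R ^~ y)) by exact: is_diffD.
have dfx : is_diff ((cst x + ( *:%R ^~ y)) s) f ('d f (x + s *: y)) by exact: differentiableP.
have [dl El] := is_diff_comp dg dfx.
apply: DeriveDef; first exact: diff_derivable.
rewrite deriveE; last exact: dl.
by rewrite (_ : (fun s => _) = f \o (cst x + ( *:%R ^~ y)))// El/= diff_dotv_grad add0r scale1r.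
Qed.

(** The mean value theorem along the segment, followed by Cauchy-Schwarz, gives [M] in place of the
    sharp [M / 2], which only affects constants. *)
Lemma gradient_lower_bound (f : V -> R) (M : R) : 0 < M ->
  (forall z, differentiable f z) ->
  (forall x y, enorm (grad f x - grad f y) <= M * enorm (x - y)) ->
  forall x y, f x + dotv (grad f x) y - M * enorm y ^+ 2 <= f (x + y).
Proof.
move=> M0 df Mlip x y.
have dline s := is_derive_line x y s df.
have [s] : exists2 s, s \in `]0, 1[%R &
    f (x + 1 *: y) - f (x + 0 *: y) = dotv (grad f (x + s *: y)) y * (1 - 0).
  apply: (@MVT _ (fun s => f (x + s *: y)) (fun s => dotv (grad f (x + s *: y)) y)) => //.
  apply: derivable_within_continuous => s _; exact: ex_derive.
rewrite in_itv/= => /andP[s0 s1].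
rewrite scale1r scale0r addr0 subr0 mulr1 => fE.
have -> : f (x + y) = f x + dotv (grad f (x + s *: y)) y by rewrite -fE [RHS]addrC subrK.
rewrite -addrA lerD2l lerBlDl -lerBlDr.
have -> : dotv (grad f x) y - dotv (grad f (x + s *: y)) y =
    dotv (grad f x - grad f (x + s *: y)) y by rewrite !dotvE.
apply: le_trans (dotv_le_enorm _ _) _.
rewrite expr2 mulrA; apply: ler_wpM2r; first exact: enorm_ge0.
apply: le_trans (Mlip _ _) _; rewrite ler_pM2l//.
rewrite opprD addrA subrr add0r enormN enormZ gtr0_norm//.
by rewrite ler_piMl ?enorm_ge0// ltW.
Qed.

End gradient.

Section minorization.
Context {R : realType} (d : nat).
Notation V := 'rV[R]_d.

Variables (lp f g : V -> R) (M L m : R) (v : V -> V).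
Hypotheses (d0 : (0 < d)%N) (M0 : 0 < M) (L0 : 0 <= L) (m0 : 0 < m)
  (lpE : forall x, lp x = f x + g x)
  (df : forall x, differentiable f x)
  (gradM : forall x y, enorm (grad f x - grad f y) <= M * enorm (x - y))
  (gL : forall x y, `|g x - g y| <= L * enorm (x - y))
  (lpm : forall x y (lam : R), 0 < lam < 1 ->
     lam * lp x + (1 - lam) * lp y + m / 2 * lam * (1 - lam) * enorm (x - y) ^+ 2
     <= lp (lam *: x + (1 - lam) *: y))
  (vsup : forall x, superdiff lp x (v x)).

Lemma lp_lower_bound (x y : V) :
  lp x + dotv (grad f x) y - M * enorm y ^+ 2 - L * enorm y <= lp (x + y).
Proof.
rewrite !lpE; have H := gradient_lower_bound M0 df gradM x y.
have := gL (x + y) x; rewrite [_ + y - x]addrAC subrr add0r ler_norml => /andP[H' _].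
lra.
Qed.

Lemma lp_midpoint (x y : V) :
  lp x + lp y + m / 4 * enorm (x - y) ^+ 2 <= 2 * lp (2^-1 *: (x + y)).
Proof.
have h : 0 < (2^-1 : R) < 1 by apply/andP; split; lra.
have := @lpm x y 2^-1 h; have -> : 1 - 2^-1 = 2^-1 :> R by lra.
by rewrite [2^-1 *: (x + y)]scalerDr => H; lra.
Qed.

(** The superdifferential inequality is tested along [s (grad f x - v x)]. After division by [s],
    letting [s] tend to 0 removes the quadratic term, while the [L]-Lipschitz part stays of first
    order. *)
Lemma superdiff_grad_le (x : V) : enorm (v x - grad f x) <= L.
Proof.
have [y yE] : exists y, y = grad f x - v x by exists (grad f x - v x).
have H (s : R) : 0 < s -> enorm y ^+ 2 <= M * enorm y ^+ 2 * s + L * enorm y.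
  move=> s0; have := lp_lower_bound x (s *: y).
  have := vsup x (x + s *: y); rewrite [_ + _ - x]addrAC subrr add0r.
  move=> H1 H2; have := le_trans H2 H1; rewrite enormZ gtr0_norm// !dotvE => H3.
  rewrite -(ler_pM2l s0).
  have E : enorm y ^+ 2 = dotv (grad f x) y - dotv (v x) y by rewrite enorm2 {1}yE !dotvE.
  by rewrite [in leLHS]E; lra.
rewrite enormB -yE.
have [->|y0] := eqVneq (enorm y) 0; first by [].
have {y0}y0 : 0 < enorm y by rewrite lt_def y0 enorm_ge0.
suff : enorm y ^+ 2 <= L * enorm y by rewrite expr2 ler_pM2r.
apply/ler_addgt0Pr => e e0.
have K0 : 0 < M * enorm y ^+ 2 by rewrite mulr_gt0// exprn_gt0.
have := H _ (divr_gt0 e0 K0).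
by rewrite [M * _ * (_ / _)]mulrCA mulfV ?gt_eqF// mulr1 addrC.
Qed.

(** If [m > 2 M], then at a distance [N] where the quadratic terms beat [L N], strong concavity at
    the midpoint of [y] and [- y] contradicts the lower bound with [M]. The result reads
    [M / m >= 1 / 2], so the step-size condition also controls [h d M]. *)
Lemma strong_concavity_le : m <= 2 * M.
Proof.
rewrite leNgt; apply/negP => Mm.
pose c := m / 2 - M; have c0 : 0 < c by rewrite /c; lra.
pose N := (L + 1) / c; have N0 : 0 < N by rewrite divr_gt0// ltr_wpDl.
have [y yN] : exists y : V, enorm y = N.
  pose i := Ordinal d0; exists (N *: delta_mx ord0 i).
  rewrite enormZ gtr0_norm// /enorm /dotv (bigD1 i)//= big1 => [|j ji].
    by rewrite !mxE !eqxx mulr1 addr0 sqrtr1 mulr1.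
  by rewrite !mxE eqxx (negbTE ji) mulr0.
have H1 := lp_lower_bound 0 y; have H2 := lp_lower_bound 0 (- y).
have := lp_midpoint (0 + y) (0 + - y).
have -> : 0 + y - (0 + - y) = 2 *: y by rewrite !add0r opprK scaler_nat mulr2n.
rewrite !add0r subrr scaler0 enormZ exprMn normr_nat yN.
move: H1 H2; rewrite !add0r enormN !dotvE yN => H1 H2 H3.
have H4 : (m / 2 - M) * N ^+ 2 <= L * N by lra.
have : c * N <= L by rewrite -(ler_pM2r N0) -mulrA -expr2.
by rewrite /N mulrCA mulfV ?gt_eqF// mulr1; lra.
Qed.

Variable (h : R).
Hypotheses (h0 : 0 < h) (hM : 200 * h * d%:R * (M / m) * M <= 1)
  (hL : 200 * h * d%:R * L ^+ 2 <= 1).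

Lemma hdM_le : 100 * (h * d%:R * M) <= 1.
Proof.
apply: le_trans hM.
have H : 2^-1 <= M / m.
  by rewrite ler_pdivlMr//; have := strong_concavity_le; lra.
have K0 : 0 <= h * d%:R * M by rewrite !mulr_ge0// ltW.
have : 2^-1 * (h * d%:R * M) <= M / m * (h * d%:R * M) by apply: ler_wpM2r.
lra.
Qed.

Let D : R := d%:R.
Let D1 : 1 <= D. Proof. by rewrite ler1n. Qed.

(* The test point of the superdifferential inequality at [y] is
   [x - 4 h d (v y - v x)]. *)
Lemma log_ratio_ge (x y : V) :
  - (1 / 10) - enorm (y - x - h *: v x) ^+ 2 / (32 * h * D) <=
  lp y - lp x + (enorm (y - x - h *: v x) ^+ 2 - enorm (x - y - h *: v y) ^+ 2) / (4 * h).
Proof.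
pose W := v y - v x; pose xi := y - x - h *: v x; pose t := 4 * h * D.
pose w := enorm W; pose z := enorm xi.
have t0 : 0 < t by rewrite /t !mulr_gt0// (lt_le_trans _ D1).
have w0 : 0 <= w by exact: enorm_ge0.
have z0 : 0 <= z by exact: enorm_ge0.
(* The difference of the proposal exponents produces [- dotv (v y) (y - x)]; together with
   [lp y - lp x] it is exactly what the superdifferential at [y] bounds from below. *)
have E1 : (enorm xi ^+ 2 - enorm (x - y - h *: v y) ^+ 2) / (4 * h) =
   dotv W xi / 2 - h / 4 * w ^+ 2 - dotv (v y) (y - x).
  rewrite /w /W /xi !enorm2 !dotvE !(dotvC x) !(dotvC y (v _)) (dotvC (v y) (v x)).
  by field; rewrite gt_eqF.
have H1 := lp_lower_bound x (- t *: W).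
have := vsup y (x + - t *: W); move=> H2; have := le_trans H1 H2.
have -> : enorm (- t *: W) = t * w by rewrite enormZ normrN gtr0_norm.
have -> : dotv (v y) (x + - t *: W - y) = - t * dotv (v y) W - dotv (v y) (y - x).
  by rewrite !dotvE; ring.
rewrite dotvZr => H3.
have Ws : - (L * w) <= dotv W (v x - grad f x).
  rewrite -lerN2 opprK -dotvNr; apply: le_trans (dotv_le_enorm _ _) _.
  by rewrite enormN mulrC ler_wpM2r// superdiff_grad_le.
have Ws' : dotv W (v x - grad f x) = dotv (v y) W - dotv (grad f x) W - w ^+ 2.
  by rewrite /w /W enorm2 !dotvE !(dotvC (v x)) !(dotvC (grad f x)); ring.
have H4 : t * w ^+ 2 - t * L * w - M * (t * w) ^+ 2 - L * (t * w) <=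
    lp y - lp x - dotv (v y) (y - x).
  have : t * (dotv (v y) W - dotv (grad f x) W) >= t * (w ^+ 2 - L * w).
    by rewrite ler_pM2l//; lra.
  by lra.
have Wz : - (w * z) <= dotv W xi.
  by rewrite -lerN2 opprK -dotvNr; apply: le_trans (dotv_le_enorm _ _) _; rewrite enormN.
rewrite -/xi E1 -/z.
suff : - (1 / 10) - z ^+ 2 / (32 * h * D) <=
  t * w ^+ 2 - t * L * w - M * (t * w) ^+ 2 - L * (t * w) - w * z / 2 - h / 4 * w ^+ 2.
  by lra.
(* Budget for [t w^2]: [1 / 25] for the smoothness of [f], [1 / 16] for [h w^2 / 4], [1 / 4] for the
   two Lipschitz terms and [1 / 2] for the cross term, in total below 1. The constant left over is
   [4 t L^2 <= 2 / 25]. *)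
have Mt : M * t <= 1 / 25.
  by have := hdM_le; rewrite /t -/D; lra.
have ht : h / 4 <= t / 16.
  have : h * 1 <= h * D by rewrite ler_pM2l.
  by rewrite /t; lra.
have tL : t * L ^+ 2 <= 1 / 50 by move: hL; rewrite /t -/D; lra.
have -> : z ^+ 2 / (32 * h * D) = z ^+ 2 / (8 * t).
  by rewrite /t; congr (_ / _); ring.
have w2 : 0 <= t * w ^+ 2 by rewrite mulr_ge0 ?sqr_ge0// ltW.
have B1 : M * (t * w) ^+ 2 <= (t * w ^+ 2) / 25.
  by rewrite (_ : M * _ = M * t * (t * w ^+ 2)); [nra|ring].
have B2 : h / 4 * w ^+ 2 <= t * w ^+ 2 / 16.
  by have := sqr_ge0 w; nra.
have B3 : 2 * (t * L * w) <= t * w ^+ 2 / 4 + 4 * (t * L ^+ 2).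
  by have := sqr_ge0 (w / 2 - 2 * L); nra.
have B4 : w * z / 2 <= t * w ^+ 2 / 2 + z ^+ 2 / (8 * t).
  rewrite -subr_ge0 (_ : _ - _ = (2 * t * w - z) ^+ 2 / (8 * t)).
    by rewrite divr_ge0 ?sqr_ge0// mulr_ge0// ltW.
  by field; rewrite gt_eqF.
lra.
Qed.

(** The factor [1 + 2 / D] dominates [(1 + 1 / (8 D)) (1 + 1 / D)], the product of the relative
    increases of the exponent due to the cross term and to recentring. *)
Definition shrunk_step : R := h / (1 + 2 / D).

Lemma shrunk_step_gt0 : 0 < shrunk_step.
Proof. by rewrite divr_gt0// ltr_wpDr// divr_ge0. Qed.

(** The normalizations differ by [(1 + 2 / D)^(d / 2)], and [1 + 2 / D <= expR (2 / D)]. *)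
Lemma gauss_norm_ratio :
  expR (- 1) * (Num.sqrt (4 * pi * shrunk_step) ^+ d)^-1 <= (Num.sqrt (4 * pi * h) ^+ d)^-1.
Proof.
have D0 : 0 < D by apply: lt_le_trans D1.
have K0 : 0 < 1 + 2 / D by rewrite ltr_wpDr// divr_ge0// ltW.
have -> : 4 * pi * h = 4 * pi * shrunk_step * (1 + 2 / D).
  by rewrite /shrunk_step; field; rewrite !gt_eqF// addr_gt0.
have : 0 < 4 * pi * shrunk_step by apply: mulr_gt0 shrunk_step_gt0; rewrite mulr_gt0// pi_gt0.
move: (4 * pi * shrunk_step) => a a0.
rewrite (sqrtrM _ (ltW a0)) exprMn invfM mulrC ler_pM2l; last first.
  by rewrite invr_gt0 exprn_gt0// sqrtr_gt0.
rewrite expRN lef_pV2 ?posrE ?expR_gt0 ?exprn_gt0 ?sqrtr_gt0//.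
have -> : expR 1 = expR D^-1 ^+ d :> R.
  by rewrite -expRM_natr mulVf// gt_eqF.
apply: lerXn2r; rewrite ?nnegrE ?sqrtr_ge0 ?expR_ge0//.
rewrite -(ler_pXn2r (n:=2))// ?nnegrE ?sqrtr_ge0 ?expR_ge0//.
rewrite (sqr_sqrtr (ltW K0)) -expRM_natr [D^-1 * _]mulrC.
exact: expR_ge1Dx.
Qed.

(** Replacing [v x] by [grad f x] moves the centre by [h s] with [|s| <= L]. Young's inequality with
    weight [D] makes the relative cost [1 / D]; the additive cost, of order [D h L^2], is bounded
    through [hL]. *)
Lemma exponent_bound (x y : V) :
  - (enorm (y - (x + h *: grad f x)) ^+ 2) / (4 * shrunk_step) - 1 / 50 <=
  - (enorm (y - x - h *: v x) ^+ 2) / (4 * h) -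
    enorm (y - x - h *: v x) ^+ 2 / (32 * h * D).
Proof.
have D0 : 0 < D by apply: lt_le_trans D1.
have -> : y - x - h *: v x = y - (x + h *: grad f x) - h *: (v x - grad f x).
  by apply/rowP => i; rewrite !mxE; ring.
move: (y - (x + h *: grad f x)) => zeta; have := superdiff_grad_le x.
move: (v x - grad f x) => s sL.
have s2 : enorm s ^+ 2 <= L ^+ 2 by apply: lerXn2r; rewrite ?nnegrE ?enorm_ge0.
have cross : - 2 * h * dotv zeta s <= enorm zeta ^+ 2 / D + D * h ^+ 2 * enorm s ^+ 2.
  have := dotv_ge0 (D^-1 *: zeta + h *: s).
  rewrite !dotvE (dotvC s zeta) -!enorm2 => H.
  have : 0 <= D * (D^-1 * (D^-1 * enorm zeta ^+ 2 + h * dotv zeta s) +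
     h * (D^-1 * dotv zeta s + h * enorm s ^+ 2)).
    by apply: mulr_ge0; [exact: ltW|move: H; rewrite !mulrDr; lra].
  have -> : D * (D^-1 * (D^-1 * enorm zeta ^+ 2 + h * dotv zeta s) +
     h * (D^-1 * dotv zeta s + h * enorm s ^+ 2)) = enorm zeta ^+ 2 / D +
     2 * h * dotv zeta s + D * h ^+ 2 * enorm s ^+ 2 by field; rewrite gt_eqF.
  by lra.
have xi2 : enorm (zeta - h *: s) ^+ 2 <=
    (1 + D^-1) * enorm zeta ^+ 2 + (1 + D) * h ^+ 2 * L ^+ 2.
  rewrite enorm2 !dotvE (dotvC s zeta) -!enorm2.
  have : (1 + D) * h ^+ 2 * enorm s ^+ 2 <= (1 + D) * h ^+ 2 * L ^+ 2.
    by apply: ler_wpM2l => //; rewrite mulr_ge0 ?sqr_ge0// addr_ge0// ltW.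
  by move: cross; lra.
have z0 : 0 <= enorm zeta ^+ 2 by exact: sqr_ge0.
move: xi2; move: (enorm (zeta - h *: s) ^+ 2) (enorm zeta ^+ 2) z0 => X Z Z0 XZ.
have i0 : 0 < D^-1 by rewrite invr_gt0.
have i1 : D^-1 <= 1 by rewrite invf_le1.
have hDL : 100 * ((1 + D) * h * L ^+ 2) <= 1.
  apply: le_trans hL; rewrite -/D.
  have : (1 + D) * (h * L ^+ 2) <= (2 * D) * (h * L ^+ 2).
    by apply: ler_wpM2r; [rewrite mulr_ge0 ?sqr_ge0// ltW|move: D1; lra].
  by lra.
rewrite -subr_ge0.
rewrite /shrunk_step.
have -> : - X / (4 * h) - X / (32 * h * D) - (- Z / (4 * (h / (1 + 2 / D))) - 1 / 50) =
  ((1 + 2 * D^-1) * Z - (1 + D^-1 / 8) * X + (2 / 25) * h) / (4 * h).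
  by field; rewrite !gt_eqF// addr_gt0.
apply: divr_ge0; last by rewrite mulr_ge0// ltW.
have X1 : (1 + D^-1 / 8) * X <=
    (1 + D^-1 / 8) * ((1 + D^-1) * Z + (1 + D) * h ^+ 2 * L ^+ 2).
  by apply: ler_wpM2l => //; lra.
have A1 : (1 + D^-1 / 8) * ((1 + D^-1) * Z) <= (1 + 2 * D^-1) * Z.
  by rewrite mulrA; apply: ler_wpM2r => //; nra.
have A2 : (1 + D^-1 / 8) * ((1 + D) * h ^+ 2 * L ^+ 2) <= 2 / 25 * h.
  have E : (1 + D) * h ^+ 2 * L ^+ 2 = h * ((1 + D) * h * L ^+ 2) by ring.
  rewrite E; have q0 : 0 <= (1 + D) * h * L ^+ 2.
    by rewrite !mulr_ge0 ?sqr_ge0// ?addr_ge0// ltW.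
  have : h * ((1 + D) * h * L ^+ 2) <= h * 100^-1 by rewrite ler_pM2l//; lra.
  have : 0 <= h * ((1 + D) * h * L ^+ 2) by rewrite mulr_ge0// ltW.
  move: (h * ((1 + D) * h * L ^+ 2)) => q q1 q2.
  have : (1 + D^-1 / 8) * q <= 2 * q by apply: ler_wpM2r => //; lra.
  by lra.
by lra.
Qed.

End minorization.

Section mala_minorization.
Context {R : realType} (d : nat).
Notation V := 'rV[R]_d.
Variables (p f g : V -> R) (M L m h : R) (v : V -> V).
Hypotheses (d0 : (0 < d)%N) (M0 : 0 < M) (L0 : 0 <= L) (m0 : 0 < m)
  (p0 : forall x, 0 < p x)
  (lpE : forall x, ln (p x) = f x + g x)
  (df : forall x, differentiable f x)
  (gradM : forall x y, enorm (grad f x - grad f y) <= M * enorm (x - y))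
  (gL : forall x y, `|g x - g y| <= L * enorm (x - y))
  (lpm : forall x y (lam : R), 0 < lam < 1 ->
     lam * ln (p x) + (1 - lam) * ln (p y) +
       m / 2 * lam * (1 - lam) * enorm (x - y) ^+ 2
     <= ln (p (lam *: x + (1 - lam) *: y)))
  (vsup : forall x, superdiff (fun y => ln (p y)) x (v x))
  (h0 : 0 < h) (hM : 200 * h * d%:R * (M / m) * M <= 1)
  (hL : 200 * h * d%:R * L ^+ 2 <= 1).

Lemma QdensE x y : Qdens v h x y = gaussd h (y - x - h *: v x).
Proof. by []. Qed.

Theorem mala_minorization (x y : V) :
  expR (- 2) * (p x * gaussd (shrunk_step d h) (y - (x + h *: grad f x))) <=
  Num.min (p x * Qdens v h x y) (p y * Qdens v h y x).
Proof.
have H1 := log_ratio_ge d0 M0 L0 m0 lpE df gradM gL lpm vsup h0 hM hL x y.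
have H2 := exponent_bound d0 M0 L0 lpE df gradM gL vsup h0 hL x y.
have H3 := gauss_norm_ratio d0 h0.
have pE z : p z = expR (ln (p z)) by rewrite lnK// posrE.
rewrite /gaussd /Qdens.
move: H1 H2 H3.
set K := (Num.sqrt (4 * pi * h) ^+ d)^-1.
set K' := (Num.sqrt (4 * pi * shrunk_step d h) ^+ d)^-1.
set X := enorm (y - x - h *: v x) ^+ 2.
set Y := enorm (x - y - h *: v y) ^+ 2.
set Z := enorm (y - (x + h *: grad f x)) ^+ 2.
move=> H1 H2 H3.
have K0 : 0 < K by rewrite invr_gt0 exprn_gt0// gauss_norm_gt0.
have E2 : expR (- 2) = expR (- 1) * expR (- 1) :> R by rewrite -expRD; congr expR; lra.
(* One factor [expR (- 1)] pays for the normalization, the other for [1 / 10 + 1 / 50] in the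
   exponent. *)
have lhs : expR (- 2) * (p x * (K' * expR (- Z / (4 * shrunk_step d h)))) <=
    p x * (K * expR (- X / (4 * h) - X / (32 * h * d%:R) - 1 / 10)).
  rewrite mulrCA ler_pM2l// E2.
  rewrite mulrACA.
  apply: ler_pM => //; rewrite ?mulr_ge0 ?expR_ge0//.
    by rewrite invr_ge0 exprn_ge0// sqrtr_ge0.
  by rewrite -expRD ler_expR; lra.
apply: (le_trans lhs); rewrite le_min; apply/andP; split.
  rewrite ler_pM2l// ler_pM2l// ler_expR.
  have : 0 <= X / (32 * h * d%:R).
    by rewrite divr_ge0 ?sqr_ge0// !mulr_ge0// ltW.
  by lra.
rewrite mulrCA [leRHS]mulrCA ler_pM2l// [in leLHS](pE x) [in leRHS](pE y) -!expRD ler_expR.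
have E : (X - Y) / (4 * h) = X / (4 * h) - Y / (4 * h) by ring.
by move: H1; rewrite E; lra.
Qed.

End mala_minorization.

(** * Superdifferentials off the kinks *)

Section one_sided_slopes.
Context {R : realType}.

(** For concave [q] the difference quotients are monotone in the step, so this supremum, and the
    infimum in [slope_left], are the one-sided derivatives at 0. Using countably many steps makes
    them measurable in parameters. *)
Definition slope_right (q : R -> R) : R := sup (range (fun n => n.+1%:R * (q n.+1%:R^-1 - q 0))).
Definition slope_left (q : R -> R) : R := inf (range (fun n => n.+1%:R * (q 0 - q (- n.+1%:R^-1)))).

Lemma has_sup_slope (q : R -> R) (w : R) : (forall s, q s <= q 0 + s * w) ->
  has_sup (range (fun n => n.+1%:R * (q n.+1%:R^-1 - q 0))) /\
  (forall n, n.+1%:R * (q n.+1%:R^-1 - q 0) <= w).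
Proof.
move=> qw; have H n : n.+1%:R * (q n.+1%:R^-1 - q 0) <= w.
  by rewrite -ler_pdivlMl// lerBlDl; have := qw n.+1%:R^-1.
split => //; split; first by exists (1%:R * (q 1%:R^-1 - q 0)); exists 0%N.
by exists w => _ [n _ <-]; exact: H.
Qed.

Lemma has_inf_slope (q : R -> R) (w : R) : (forall s, q s <= q 0 + s * w) ->
  has_inf (range (fun n => n.+1%:R * (q 0 - q (- n.+1%:R^-1)))) /\
  (forall n, w <= n.+1%:R * (q 0 - q (- n.+1%:R^-1))).
Proof.
move=> qw; have H n : w <= n.+1%:R * (q 0 - q (- n.+1%:R^-1)).
  rewrite -ler_pdivrMl//; have := qw (- n.+1%:R^-1).
  by move: (n.+1%:R^-1) => k; lra.
split => //; split; first by exists (1%:R * (q 0 - q (- 1%:R^-1))); exists 0%N.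
by exists w => _ [n _ <-]; exact: H.
Qed.

Lemma slope_right_le (q : R -> R) w : (forall s, q s <= q 0 + s * w) -> slope_right q <= w.
Proof.
move=> qw; have [hs H] := has_sup_slope qw.
by apply: ge_sup => [|_ [n _ <-]]; [exact: hs.1|exact: H].
Qed.

Lemma slope_left_ge (q : R -> R) w : (forall s, q s <= q 0 + s * w) -> w <= slope_left q.
Proof.
move=> qw; have [hs H] := has_inf_slope qw.
by apply: lb_le_inf => [|_ [n _ <-]]; [exact: hs.1|exact: H].
Qed.

(** Concavity enters through the supporting slopes [w], which do not increase. With a step [k] below
    half the gap, the chord ending at [t'] and the chord starting at [t] are separated by
    [w (t' - k) <= w (t + k)]. *)
Lemma slope_left_le_right (l w : R -> R) (t t' : R) :
  (forall t s, l (t + s) <= l t + s * w t) -> t < t' ->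
  slope_left (fun s => l (t' + s)) <= slope_right (fun s => l (t + s)).
Proof.
move=> lw tt'.
have lw0 u s : l (u + s) <= l (u + 0) + s * w u by rewrite addr0.
have [hi _] := has_inf_slope (lw0 t'); have [hs _] := has_sup_slope (lw0 t).
have e0 : 0 < (t' - t) / 2 by rewrite divr_gt0// subr_gt0.
have [n _ /(_ n (leqnn _)) /= nP] := near_infty_natSinv_lt (PosNum e0).
set k := n.+1%:R^-1 in nP.
have k0 : 0 < k by rewrite /k invr_gt0.
apply: (@le_trans _ _ (n.+1%:R * (l (t' + 0) - l (t' + - k)))).
  by apply: ge_inf; [exact: hi.2|exists n].
apply: (@le_trans _ _ (n.+1%:R * (l (t + k) - l (t + 0)))); last first.
  by apply: ub_le_sup; [exact: hs.2|exists n].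
rewrite !addr0 ler_pM2l//.
have H1 := lw (t' - k) k; have H2 := lw (t + k) (- k).
rewrite subrK in H1; rewrite addrK in H2.
have g0 : 0 < t' - k - (t + k) by move: nP; lra.
have H3 := lw (t' - k) (- (t' - k - (t + k))); have H4 := lw (t + k) (t' - k - (t + k)).
have E3 : t' - k - (t' - k - (t + k)) = t + k by ring.
have E4 : t + k + (t' - k - (t + k)) = t' - k by ring.
rewrite E3 in H3; rewrite E4 in H4.
have H5 : w (t' - k) <= w (t + k) by rewrite -(ler_pM2l g0); lra.
have H6 : k * w (t' - k) <= k * w (t + k) by rewrite ler_pM2l.
lra.
Qed.

(** The gaps between the two slopes at distinct kinks are disjoint intervals, so a rational chosen
    in each gap identifies its kink. *)
Lemma countable_kinks (l w : R -> R) : (forall t s, l (t + s) <= l t + s * w t) ->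
  countable [set t | slope_right (fun s => l (t + s)) < slope_left (fun s => l (t + s))].
Proof.
move=> lw; set K := [set t | _].
have H t : exists r : rat, K t ->
    slope_right (fun s => l (t + s)) < ratr r < slope_left (fun s => l (t + s)).
  have [Kt|nKt] := pselect (K t); last by exists 0.
  have [r] := @rat_in_itvoo R _ _ Kt.
  by rewrite in_itv/= => ?; exists r.
have [r Hr] := choice H.
apply/countable_injP; exists (pickle \o r) => t t' /set_mem Kt /set_mem Kt' /= /(pcan_inj pickleK) rr.
have wlog_ (a b : R) : K a -> K b -> r a = r b -> ~ (a < b).
  move=> Ka Kb rab ab.
  have /andP[_ h2] := Hr _ Kb; have /andP[h1 _] := Hr _ Ka.
  have := slope_left_le_right lw ab; rewrite leNgt => /negP; apply.
  by rewrite rab in h1; exact: lt_trans h2.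
by have [ | |//] := ltgtP t t' => h; exfalso; [exact: (wlog_ t t')|exact: (wlog_ t' t)].
Qed.

End one_sided_slopes.

Section kinks.
Context {R : realType}.
Notation leb := (@lebesgue_measure R).

Definition kinks n (lp : 'rV[R]_n -> R) (i : 'I_n) : set 'rV[R]_n :=
  [set x | slope_right (fun s => lp (x + s *: delta_mx ord0 i)) <
           slope_left (fun s => lp (x + s *: delta_mx ord0 i))].

Lemma sdrop0 (u : nat -> R) : sdrop u 0 = range u.
Proof. by apply/seteqP; split => _ [k _ <-]; exists k. Qed.

Section measurable_slopes.
Variables (n : nat) (lp : 'rV[R]_n -> R) (i : 'I_n) (w : 'rV[R]_n -> R).
Hypotheses (mlp : measurable_fun setT lp)
  (lpw : forall x s, lp (x + s *: delta_mx ord0 i) <= lp x + s * w x).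

Let lpw0 x s : lp (x + s *: delta_mx ord0 i) <= lp (x + 0 *: delta_mx ord0 i) + s * w x.
Proof. by rewrite scale0r addr0. Qed.

Let mlps s : measurable_fun setT (fun x : 'rV[R]_n => lp (x + s *: delta_mx ord0 i)).
Proof. by apply: (measurableT_comp mlp); exact: measurable_fun_rVD. Qed.

Lemma measurable_slope_right :
  measurable_fun setT (fun x : 'rV[R]_n => slope_right (fun s => lp (x + s *: delta_mx ord0 i))).
Proof.
pose q k (x : 'rV[R]_n) := k.+1%:R * (lp (x + k.+1%:R^-1 *: delta_mx ord0 i) -
  lp (x + 0 *: delta_mx ord0 i)).
apply: (@eq_measurable_fun _ _ _ _ setT (fun x => sups (q ^~ x) 0)) => [x _|].
  by rewrite /sups/= sdrop0.
apply: measurable_fun_sups => [x _|k].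
  exact: (has_sup_slope (lpw0 x)).1.2.
by apply: measurable_funM => //; exact: measurable_funB.
Qed.

Lemma measurable_slope_left :
  measurable_fun setT (fun x : 'rV[R]_n => slope_left (fun s => lp (x + s *: delta_mx ord0 i))).
Proof.
pose q k (x : 'rV[R]_n) := k.+1%:R * (lp (x + 0 *: delta_mx ord0 i) -
  lp (x + (- k.+1%:R^-1) *: delta_mx ord0 i)).
apply: (@eq_measurable_fun _ _ _ _ setT (fun x => infs (q ^~ x) 0)) => [x _|].
  by rewrite /infs/= sdrop0.
apply: measurable_fun_infs => [x _|k].
  exact: (has_inf_slope (lpw0 x)).1.2.
by apply: measurable_funM => //; exact: measurable_funB.
Qed.

Lemma measurable_kinks : measurable (kinks lp i).
Proof.
have := measurable_fun_ltr measurable_slope_right measurable_slope_left.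
move=> /(_ measurableT [set true]); rewrite setTI.
by rewrite (_ : _ @^-1` _ = kinks lp i)//; apply.
Qed.

End measurable_slopes.

Lemma cons_row_shift0 n (t s : R) (y : 'rV[R]_n) :
  cons_row t y + s *: delta_mx ord0 ord0 = cons_row (t + s) y.
Proof.
apply/rowP => i; rewrite !mxE eqxx /=; case: unliftP => [j ->|->].
  by rewrite [_ == ord0]eq_sym eq_liftF mulr0 addr0.
by rewrite eqxx mulr1.
Qed.

Lemma cons_row_shiftS n (t s : R) (y : 'rV[R]_n) j :
  cons_row t y + s *: delta_mx ord0 (lift ord0 j) =
  cons_row t (y + s *: delta_mx ord0 j).
Proof.
apply/rowP => i; rewrite !mxE eqxx /=; case: unliftP => [k ->|->].
  by rewrite !mxE eqxx (inj_eq lift_inj).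
by rewrite eq_liftF mulr0 addr0.
Qed.

(** For the first coordinate, Tonelli with that coordinate innermost reduces to the countably many
    kinks on a line; for another one, slicing off the first coordinate leaves the same claim in
    lower dimension. *)
Lemma lebn_kinks0 n (lp w : 'rV[R]_n -> R) (i : 'I_n) :
  measurable_fun setT lp ->
  (forall x s, lp (x + s *: delta_mx ord0 i) <= lp x + s * w x) ->
  lebn n (kinks lp i) = 0%E.
Proof.
elim: n lp w i => [|n IH] lp w i mlp lpw; first by case: i lpw.
have mK := measurable_kinks mlp lpw.
case: (unliftP ord0 i) => [j|] iE; rewrite {}iE in lpw mK *.
  rewrite lebnSE//; apply: integral0_eq => t _.
  rewrite (_ : [set y | _] = kinks (fun y => lp (cons_row t y)) j).
    apply: (IH _ (fun y => w (cons_row t y))).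
      exact: measurable_fun_cons_rowr.
    by move=> y s; rewrite -cons_row_shiftS; exact: lpw.
  have E y : (fun s => lp (cons_row t y + s *: delta_mx ord0 (lift ord0 j))) =
      (fun s => lp (cons_row t (y + s *: delta_mx ord0 j))).
    by apply/funext => s; rewrite cons_row_shiftS.
  by apply/seteqP; split => y; rewrite /kinks/= E.
have -> : lebn n.+1 (kinks lp ord0) = (\int[lebn n.+1]_x (\1_(kinks lp ord0) x)%:E)%E.
  by rewrite integral_indic// setIT.
rewrite integral_lebnS_swap//; last first.
  by apply/measurable_EFinP; exact: measurable_indic.
apply: integral0_eq => y _.
pose K := [set t | cons_row t y \in kinks lp ord0].
have cK : countable K.
  apply: sub_countable (@countable_kinks R (fun t => lp (cons_row t y))
    (fun t => w (cons_row t y)) _); last first.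
    by move=> t s; rewrite -cons_row_shift0; exact: lpw.
  apply: subset_card_le => t; rewrite /K/= inE /kinks/=.
  rewrite (_ : (fun s => _) = (fun s => lp (cons_row (t + s) y)))//.
  by apply/funext => s; rewrite cons_row_shift0.
have mKy : measurable K.
  have := measurable_fun_pair1 y (@measurable_cons_row R n).
  move=> /(_ measurableT (kinks lp ord0) mK); rewrite setTI.
  by congr measurable; apply/seteqP; split => t; rewrite /K/= inE.
rewrite (eq_integral (fun t : measurableTypeR R => (\1_K t)%:E)).
  by rewrite integral_indic ?setIT//; exact: countable_lebesgue_measure0.
move=> t _; rewrite !indicE; congr (nat_of_bool _)%:R%:E.
by apply/idP/idP; rewrite /K !inE/= ?inE.
Qed.

(** The [i]-th component of any supergradient is trapped between the right and left slopes along
    that coordinate; away from the kinks it equals the right slope, which is measurable. *)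
Theorem ae_measurable_superdiff n (lp : 'rV[R]_n -> R) (v : 'rV[R]_n -> 'rV[R]_n) :
  measurable_fun setT lp -> (forall x, superdiff lp x (v x)) ->
  exists (v' : 'rV[R]_n -> 'rV[R]_n) (N : set 'rV[R]_n),
    [/\ measurable_fun setT v', measurable N, lebn n N = 0%E &
        forall x, ~ N x -> v x = v' x].
Proof.
move=> mlp vsup.
have lpw i x s : lp (x + s *: delta_mx ord0 i) <= lp x + s * v x ord0 i.
  have := vsup x (x + s *: delta_mx ord0 i); rewrite [_ + _ - x]addrAC subrr add0r.
  rewrite dotvZr /dotv (bigD1 i)//= big1 ?addr0 => [|j ji].
    by rewrite mxE !eqxx mulr1.
  by rewrite mxE (negbTE ji) andbF mulr0.
have mK i : measurable (kinks lp i) by exact: (measurable_kinks mlp (lpw i)).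
exists (fun x => \row_i slope_right (fun s => lp (x + s *: delta_mx ord0 i))).
exists (\bigcup_(i in [set: 'I_n]) kinks lp i); split.
- apply: measurable_fun_rV => i; under eq_fun do rewrite mxE.
  exact: (measurable_slope_right mlp (lpw i)).
- apply: fin_bigcup_measurable => [|i _]; last exact: mK.
  exact: finite_finset.
- rewrite (_ : [set: 'I_n] = [set` enum 'I_n]); last first.
    by apply/seteqP; split => i //= _; rewrite mem_enum.
  rewrite bigcup_seq; elim: (enum _) => [|i r IHr].
    by rewrite big_nil measure0.
  rewrite big_cons setUC measureU0 ?IHr//; first exact: bigsetU_measurable.
  exact: lebn_kinks0 (lpw i).
- move=> x Nx; apply/rowP => i; rewrite mxE.
  have lpw0 s : lp (x + s *: delta_mx ord0 i) <= lp (x + 0 *: delta_mx ord0 i) + s * v x ord0 i.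
    by rewrite scale0r addr0; exact: lpw.
  apply/eqP; rewrite eq_le; apply/andP; split; last exact: (slope_right_le lpw0).
  apply: le_trans (slope_left_ge lpw0) _; rewrite leNgt; apply/negP => H.
  by apply: Nx; exists i.
Qed.

End kinks.

(** * The Dirichlet form *)

Section rintegral_parametric.
Context d d' (S : measurableType d) (T : measurableType d') (R : realType).
Variable mu : {sigma_finite_measure set T -> \bar R}.

Lemma measurable_param_integral (w : S * T -> R) : measurable_fun setT w ->
  measurable_fun setT (fun x => \int[mu]_y (w (x, y))%:E)%E.
Proof.
move=> mw; have mE : measurable_fun setT (fun z => (w z)%:E) by exact/measurable_EFinP.
have mP : measurable_fun setT (fun z => ((EFin \o w)^\+ z)%E) by exact: measurable_funepos.
have mN : measurable_fun setT (fun z => ((EFin \o w)^\- z)%E) by exact: measurable_funeneg.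
have P0 z : (0 <= (EFin \o w)^\+ z)%E by exact: funepos_ge0.
have N0 z : (0 <= (EFin \o w)^\- z)%E by exact: funeneg_ge0.
have H := emeasurable_funB
  (@measurable_fun_fubini_tonelli_F _ _ S T R mu _ mP P0)
  (@measurable_fun_fubini_tonelli_F _ _ S T R mu _ mN N0).
apply: eq_measurable_fun H => x _; rewrite [RHS]integralE.
by congr (_ - _)%E; apply: eq_integral => y _; rewrite unlock.
Qed.

Lemma measurable_param_Rintegral (w : S * T -> R) : measurable_fun setT w ->
  measurable_fun setT (fun x => \int[mu]_y w (x, y)).
Proof.
move=> mw; apply: (measurableT_comp (@fine_measurable R _ measurableT)).
exact: measurable_param_integral.
Qed.

End rintegral_parametric.

Section integral_aux.
Context d (T : measurableType d) (R : realType) (mu : {measure set T -> \bar R}).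

Lemma integrable_ge0 (f : T -> R) : measurable_fun setT f -> (forall x, 0 <= f x) ->
  (\int[mu]_x (f x)%:E < +oo)%E -> mu.-integrable setT (EFin \o f).
Proof.
move=> mf f0 foo; apply/integrableP; split; first exact/measurable_EFinP.
by under eq_integral do rewrite /= ger0_norm//.
Qed.

Lemma fine_integral_ge0 (f : T -> R) : (forall x, 0 <= f x) ->
  (\int[mu]_x (f x)%:E < +oo)%E ->
  ((\int[mu]_x f x)%R)%:E = (\int[mu]_x (f x)%:E)%E.
Proof.
move=> f0 foo; rewrite /Rintegral fineK// ge0_fin_numE//.
by apply: integral_ge0 => x _; rewrite lee_fin.
Qed.

Lemma measure_pinfty_null (f : T -> \bar R) : measurable_fun setT f ->
  (forall x, 0 <= f x)%E -> (\int[mu]_x f x < +oo)%E ->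
  measurable [set x | f x = +oo%E] /\ mu [set x | f x = +oo%E] = 0%E.
Proof.
move=> mf f0 foo.
have mS : measurable [set x | f x = +oo%E].
  rewrite (_ : [set x | _] = f @^-1` [set +oo%E])//.
  by rewrite -[X in measurable X]setTI; exact: mf.
split => //; have fi : mu.-integrable setT f.
  apply/integrableP; split => //.
  by under eq_integral do rewrite gee0_abs//.
have [A [mA A0 subA]] := integrable_ae measurableT fi.
apply: (subset_measure0 mS mA _ A0) => x /= fx; apply: subA => /= /(_ I).
by rewrite fx.
Qed.

End integral_aux.

Section dirichlet_form.
Context d (T : measurableType d) (R : realType).
Variable mu : {sigma_finite_measure set T -> \bar R}.
Variables (p : T -> R) (k : T * T -> R) (u : T -> R).
Hypotheses (mp : measurable_fun setT p) (p0 : forall x, 0 <= p x)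
  (mk : measurable_fun setT k) (k0 : forall z, 0 <= k z)
  (ksym : forall x y, k (x, y) = k (y, x))
  (kp : forall x, (\int[mu]_y (k (x, y))%:E <= (p x)%:E)%E)
  (mu_ : measurable_fun setT u)
  (u2 : (\int[mu]_x (p x * u x ^+ 2)%:E < +oo)%E).

Let a z := k z * u z.1 ^+ 2.
Let a' z := k z * u z.2 ^+ 2.
Let e z := k z * (u z.1 - u z.2) ^+ 2.

Let mu1 : measurable_fun setT (fun z : T * T => u z.1).
Proof. exact: (measurableT_comp mu_ measurable_fst). Qed.
Let mu2 : measurable_fun setT (fun z : T * T => u z.2).
Proof. exact: (measurableT_comp mu_ measurable_snd). Qed.
Let ma : measurable_fun setT a.
Proof. by apply: measurable_funM => //; exact: measurable_funX. Qed.
Let ma' : measurable_fun setT a'.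
Proof. by apply: measurable_funM => //; exact: measurable_funX. Qed.
Let me : measurable_fun setT e.
Proof. by apply: measurable_funM => //; apply: measurable_funX; exact: measurable_funB. Qed.
Let a0 z : 0 <= a z. Proof. by rewrite mulr_ge0 ?sqr_ge0. Qed.
Let a'0 z : 0 <= a' z. Proof. by rewrite mulr_ge0 ?sqr_ge0. Qed.
Let e0 z : 0 <= e z. Proof. by rewrite mulr_ge0 ?sqr_ge0. Qed.

Local Open Scope ereal_scope.

Let kfin x : \int[mu]_y (k (x, y))%:E < +oo.
Proof. by apply: le_lt_trans (kp x) _; rewrite ltry. Qed.

Let aE x : \int[mu]_y (a (x, y))%:E = (u x ^+ 2)%:E * \int[mu]_y (k (x, y))%:E.
Proof.
rewrite -ge0_integralZl_EFin ?sqr_ge0//.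
- by apply: eq_integral => y _; rewrite -EFinM mulrC.
- by move=> y _; rewrite lee_fin.
- by apply/measurable_EFinP; exact: measurable_fun_pair2.
Qed.

Let afin x : \int[mu]_y (a (x, y))%:E < +oo.
Proof. by rewrite aE lte_mul_pinfty// lee_fin sqr_ge0. Qed.

Let ale x : \int[mu]_y (a (x, y))%:E <= (p x * u x ^+ 2)%:E.
Proof. rewrite aE; have -> : (p x * u x ^+ 2)%:E = (u x ^+ 2)%:E * (p x)%:E.
  by rewrite -EFinM mulrC.
by apply: lee_wpmul2l => //; rewrite lee_fin sqr_ge0. Qed.

Let mA : measurable_fun setT (fun x => \int[mu]_y (a (x, y))%:E).
Proof. exact: measurable_param_integral. Qed.
Let mA' : measurable_fun setT (fun x => \int[mu]_y (a' (x, y))%:E).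
Proof. exact: measurable_param_integral. Qed.
Let mE : measurable_fun setT (fun x => \int[mu]_y (e (x, y))%:E).
Proof. exact: measurable_param_integral. Qed.

Let A0 x : 0 <= \int[mu]_y (a (x, y))%:E.
Proof. by apply: integral_ge0 => y _; rewrite lee_fin. Qed.
Let A'0 x : 0 <= \int[mu]_y (a' (x, y))%:E.
Proof. by apply: integral_ge0 => y _; rewrite lee_fin. Qed.
Let E0 x : 0 <= \int[mu]_y (e (x, y))%:E.
Proof. by apply: integral_ge0 => y _; rewrite lee_fin. Qed.

Let mpu2 : measurable_fun setT (fun x => (p x * u x ^+ 2)%R).
Proof. by apply: measurable_funM => //; exact: measurable_funX. Qed.

Lemma dirichlet_diag_fin : \int[mu]_x \int[mu]_y (a (x, y))%:E < +oo.
Proof.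
apply: le_lt_trans u2; apply: ge0_le_integral => //.
by apply/measurable_EFinP.
Qed.

Lemma dirichlet_diag_sym :
  \int[mu]_x \int[mu]_y (a' (x, y))%:E = \int[mu]_x \int[mu]_y (a (x, y))%:E.
Proof.
have mEa : measurable_fun setT (fun z => (a z)%:E) by exact/measurable_EFinP.
have a0E z : 0 <= (a z)%:E by rewrite lee_fin; exact: a0.
rewrite (@fubini_tonelli _ _ T T R mu mu (fun z => (a z)%:E) mEa a0E).
apply: eq_integral => x _; apply: eq_integral => y _.
by rewrite /a /a'/= ksym.
Qed.

Lemma dirichlet_diag_fin_sym : \int[mu]_x \int[mu]_y (a' (x, y))%:E < +oo.
Proof. by rewrite dirichlet_diag_sym; exact: dirichlet_diag_fin. Qed.

Let ele z : (e z <= 2 * a z + 2 * a' z)%R.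
Proof.
rewrite /e /a /a'; have := sqr_ge0 (u z.1 + u z.2)%R.
rewrite -(pmulr_rge0 _ (ltr0Sn R 0)) => H.
rewrite [leRHS](_ : _ = k z * (2 * u z.1 ^+ 2 + 2 * u z.2 ^+ 2))%R; last by ring.
by apply: ler_wpM2l => //; have := sqr_ge0 (u z.1 + u z.2)%R; lra.
Qed.

Let EleAA' x : \int[mu]_y (e (x, y))%:E <=
  2%:E * \int[mu]_y (a (x, y))%:E + 2%:E * \int[mu]_y (a' (x, y))%:E.
Proof.
have maxE : measurable_fun setT (fun y => (a (x, y))%:E).
  exact/measurable_EFinP/measurable_fun_pair2.
have ma'xE : measurable_fun setT (fun y => (a' (x, y))%:E).
  exact/measurable_EFinP/measurable_fun_pair2.
have axE y : setT y -> 0 <= (a (x, y))%:E by rewrite lee_fin; move=> _; exact: a0.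
have a'xE y : setT y -> 0 <= (a' (x, y))%:E by rewrite lee_fin; move=> _; exact: a'0.
rewrite -(ge0_integralZl_EFin _ _ axE maxE)//.
rewrite -(ge0_integralZl_EFin _ _ a'xE ma'xE)//.
have two0 : 0 <= 2%:E :> \bar R by rewrite lee_fin.
rewrite -(ge0_integralD _ _ (fun y T => mule_ge0 two0 (axE y T)) _
  (fun y T => mule_ge0 two0 (a'xE y T)))//; try exact: measurable_funeM.
apply: ge0_le_integralT => y; first by rewrite lee_fin.
by rewrite -!EFinM -EFinD lee_fin ele.
Qed.

Lemma dirichlet_energy_fin :
  \int[mu]_x \int[mu]_y (k (x, y) * (u x - u y) ^+ 2)%:E < +oo.
Proof.
apply: (@le_lt_trans _ _ (\int[mu]_x (2%:E * \int[mu]_y (a (x, y))%:E +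
   2%:E * \int[mu]_y (a' (x, y))%:E))).
  by apply: ge0_le_integralT.
have two0 : 0 <= 2%:E :> \bar R by rewrite lee_fin.
rewrite (ge0_integralD _ _ (fun x _ => mule_ge0 two0 (A0 x)) _
  (fun x _ => mule_ge0 two0 (A'0 x)))//; try exact: measurable_funeM.
rewrite (ge0_integralZl_EFin _ _ (fun x _ => A0 x) mA)//.
rewrite (ge0_integralZl_EFin _ _ (fun x _ => A'0 x) mA')// dirichlet_diag_sym.
by apply: lte_add_pinfty; apply: lte_mul_pinfty; [| |exact: dirichlet_diag_fin| | |exact: dirichlet_diag_fin].
Qed.

(** Polarization: [k u(x) u(y)] is half of [k u(x)^2 + k u(y)^2 - k (u(x) - u(y))^2]. Unlike the
    product, these three terms are nonnegative, so Tonelli applies to each; the first two cancel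
    after integration by symmetry of [k]. *)
Definition dirichlet_density x : R := (p x * u x ^+ 2
  - 2^-1 * \int[mu]_y (k (x, y) * u x ^+ 2)
  + 2^-1 * \int[mu]_y (k (x, y) * u y ^+ 2)
  - 2^-1 * \int[mu]_y (k (x, y) * (u x - u y) ^+ 2))%R.

Lemma measurable_dirichlet_density : measurable_fun setT dirichlet_density.
Proof.
apply: measurable_funB; first apply: measurable_funD; first apply: measurable_funB => //.
- by apply: measurable_funM => //; exact: (measurable_param_Rintegral mu ma).
- by apply: measurable_funM => //; exact: (measurable_param_Rintegral mu ma').
- by apply: measurable_funM => //; exact: (measurable_param_Rintegral mu me).
Qed.

Let fin_I (w : T * T -> R) x : (forall z, 0 <= w z)%R -> measurable_fun setT w ->
  \int[mu]_y (w (x, y))%:E < +oo -> mu.-integrable setT (EFin \o (fun y => w (x, y))).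
Proof. by move=> w0 mw wfin; apply: integrable_ge0 => //; exact: measurable_fun_pair2. Qed.

Lemma dirichlet_densityE : exists N, [/\ measurable N, mu N = 0 &
  forall x, ~ N x ->
   mu.-integrable setT (EFin \o (fun y => k (x, y) * u y)%R) /\
   (u x * \int[mu]_y (k (x, y) * u y) + (p x - \int[mu]_y k (x, y)) * u x ^+ 2 =
    dirichlet_density x)%R].
Proof.
have [mN N0] := measure_pinfty_null mA' A'0 dirichlet_diag_fin_sym.
(* Outside this set [k(x, .) u] is integrable; on it [fine] may turn an infinite integral into 0. *)
exists [set x | \int[mu]_y (a' (x, y))%:E = +oo]; split => // x /= /eqP Nx.
have {}Nx : \int[mu]_y (a' (x, y))%:E < +oo by rewrite ltey.
have ia := fin_I a0 ma (afin x).
have ia' := fin_I a'0 ma' Nx.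
have ie : mu.-integrable setT (EFin \o (fun y => e (x, y))).
  apply: fin_I => //; apply: le_lt_trans (EleAA' x) _.
  by rewrite lte_add_pinfty// lte_mul_pinfty.
have ik := fin_I k0 mk (kfin x).
have iku : mu.-integrable setT (EFin \o (fun y => k (x, y) * u y)%R).
  apply: (@le_integrable _ _ R mu setT measurableT _
    (fun y => (k (x, y) + a' (x, y))%:E)).
  - by apply/measurable_EFinP; apply: measurable_funM => //; exact: measurable_fun_pair2.
  - move=> y _ /=; rewrite lee_fin normrM (ger0_norm (k0 _)) [leRHS]ger0_norm ?addr_ge0//.
    rewrite /a'/= -(real_normK (num_real (u y))).
    have := mulr_ge0 (k0 (x, y)) (sqr_ge0 (`|u y| - 1)%R).
    have := mulr_ge0 (k0 (x, y)) (sqr_ge0 `|u y|%R).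
    by have := k0 (x, y); lra.
  - exact: (integrableD measurableT ik ia').
split => //.
have Zi (c : R) w : mu.-integrable setT (EFin \o w) ->
    mu.-integrable setT (EFin \o (fun y => c * w y)%R).
  by move=> iw; exact: (integrableZl measurableT c iw).
rewrite /dirichlet_density.
have -> : (\int[mu]_y (k (x, y) * u x ^+ 2) = u x ^+ 2 * \int[mu]_y k (x, y))%R.
  by rewrite -RintegralZl//; apply: eq_Rintegral => y _; rewrite mulrC.
suff H : (u x * \int[mu]_y (k (x, y) * u y) = 2^-1 * (\int[mu]_y a (x, y) +
    \int[mu]_y a' (x, y) - \int[mu]_y e (x, y)))%R.
  rewrite H -[(\int[mu]_y (k (x, y) * u y ^+ 2))%R]/(\int[mu]_y a' (x, y))%R.
  rewrite -[(\int[mu]_y (k (x, y) * (u x - u y) ^+ 2))%R]/(\int[mu]_y e (x, y))%R.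
  have -> : (\int[mu]_y a (x, y) = u x ^+ 2 * \int[mu]_y k (x, y))%R.
    by rewrite -RintegralZl//; apply: eq_Rintegral => y _; rewrite /a/= mulrC.
  move: (\int[mu]_y a' (x, y))%R (\int[mu]_y e (x, y))%R (\int[mu]_y k (x, y))%R => X Y Z.
  by field.
(* The polarization identity is solved for [k u(y)] by dividing by [u x]; where [u x] vanishes, both
   sides are 0. *)
have [ux0|ux0] := eqVneq (u x) 0%R.
  rewrite ux0 mul0r; have -> : (\int[mu]_y a (x, y) = 0)%R.
    by rewrite /Rintegral integral0_eq// => y _; rewrite /a/= ux0 expr0n mulr0.
  have -> : (\int[mu]_y e (x, y) = \int[mu]_y a' (x, y))%R.
    by apply: eq_Rintegral => y _; rewrite /e /a'/= ux0 sub0r sqrrN.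
  by rewrite add0r subrr mulr0.
have iaa' : mu.-integrable setT (EFin \o (fun y => a (x, y) + a' (x, y))%R).
  exact: (integrableD measurableT ia ia').
have iaa'e : mu.-integrable setT (EFin \o (fun y => a (x, y) + a' (x, y) - e (x, y))%R).
  exact: (integrableB measurableT iaa' ie).
rewrite -RintegralD// -RintegralB//.
have kuE y : (k (x, y) * u y = (u x)^-1 * (2^-1 * (a (x, y) + a' (x, y) - e (x, y))))%R.
  by rewrite /a /a' /e/=; field.
under eq_Rintegral do rewrite kuE.
rewrite (RintegralZl _ measurableT (Zi _ _ iaa'e)).
by rewrite (RintegralZl _ measurableT iaa'e) mulVKf.
Qed.

Lemma Rintegral_dirichlet_density :
  (\int[mu]_x dirichlet_density x = \int[mu]_x (p x * u x ^+ 2) -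
   2^-1 * fine (\int[mu]_x \int[mu]_y (k (x, y) * (u x - u y) ^+ 2)%:E))%R.
Proof.
pose F (w : T * T -> R) x := (\int[mu]_y w (x, y))%R.
have intF (w : T * T -> R) : (forall z, 0 <= w z)%R -> measurable_fun setT w ->
    \int[mu]_x \int[mu]_y (w (x, y))%:E < +oo ->
    mu.-integrable setT (EFin \o F w) /\
    (\int[mu]_x F w x = fine (\int[mu]_x \int[mu]_y (w (x, y))%:E))%R.
  move=> w0 mw wfin.
  have mW := measurable_param_integral mu mw.
  have W0 x : 0 <= \int[mu]_y (w (x, y))%:E.
    by apply: integral_ge0 => y _; rewrite lee_fin.
  have mF : measurable_fun setT (F w) by exact: measurable_param_Rintegral.
  have F0 x : (0 <= F w x)%R by apply: Rintegral_ge0.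
  have [mN N0] := measure_pinfty_null mW W0 wfin.
  have FE : \int[mu]_x (F w x)%:E = \int[mu]_x \int[mu]_y (w (x, y))%:E.
    apply: (ge0_integral_off_null mN N0) => // x /= /eqP Nx.
    by rewrite /F /Rintegral fineK// ge0_fin_numE// ltey.
  split; last by rewrite /Rintegral FE.
  by apply: integrable_ge0 => //; rewrite FE.
have [iA EA] := intF _ a0 ma dirichlet_diag_fin.
have [iA' EA'] := intF _ a'0 ma' dirichlet_diag_fin_sym.
have [iE EE] := intF _ e0 me dirichlet_energy_fin.
have ip : mu.-integrable setT (EFin \o (fun x => p x * u x ^+ 2)%R).
  by apply: integrable_ge0 => // x; rewrite mulr_ge0 ?sqr_ge0.
have Zi (w : T -> R) : mu.-integrable setT (EFin \o w) ->
    mu.-integrable setT (EFin \o (fun y => 2^-1 * w y)%R).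
  by move=> iw; exact: (integrableZl measurableT 2^-1 iw).
have i1 : mu.-integrable setT (EFin \o (fun x => p x * u x ^+ 2 - 2^-1 * F a x)%R).
  exact: (integrableB measurableT ip (Zi _ iA)).
have i2 : mu.-integrable setT
    (EFin \o (fun x => p x * u x ^+ 2 - 2^-1 * F a x + 2^-1 * F a' x)%R).
  exact: (integrableD measurableT i1 (Zi _ iA')).
rewrite /dirichlet_density (RintegralB measurableT i2 (Zi _ iE)).
rewrite (RintegralD measurableT i1 (Zi _ iA')) (RintegralB measurableT ip (Zi _ iA)).
rewrite !RintegralZl//.
by rewrite EA EA' EE dirichlet_diag_sym subrK.
Qed.

End dirichlet_form.

(** * Truncation of test functions and the Poincare inequality in L^2 *)

Section clamp.
Context {R : realType}.
Implicit Types (s x y : R).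

Definition clamp s x := Num.max (- s) (Num.min x s).

Lemma clamp_cases s x : 0 < s ->
  [\/ [/\ clamp s x = x, - s <= x & x <= s], clamp s x = s /\ s < x |
      clamp s x = - s /\ x < - s].
Proof.
move=> s0; rewrite /clamp; have [xs|sx] := leP x s.
  have [sx|xs'] := leP (- s) x; first by constructor 1.
  by constructor 3.
by constructor 2; split => //; rewrite max_r//; lra.
Qed.

Lemma clamp_norm_le s x : 0 < s -> `|clamp s x| <= s.
Proof.
move=> s0; rewrite ler_norml.
by have [[-> ? ?]|[-> ?]|[-> ?]] := clamp_cases x s0; apply/andP; split; lra.
Qed.

Lemma clamp_sqr s x : 0 < s -> clamp s x ^+ 2 = Num.min (x ^+ 2) (s ^+ 2).
Proof.
move=> s0; have [[-> ? ?]|[-> ?]|[-> ?]] := clamp_cases x s0.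
- by rewrite min_l//; nra.
- by rewrite min_r//; nra.
- by rewrite sqrrN min_r//; nra.
Qed.

Lemma clamp_diff_sqr s x y : 0 < s -> (clamp s x - clamp s y) ^+ 2 <= (x - y) ^+ 2.
Proof.
move=> s0; wlog xy : x y / x <= y => [H|].
  have [|/ltW] := leP x y; first exact: H.
  by move=> /H; rewrite -sqrrN opprB -[X in _ <= X]sqrrN opprB.
have H : 0 <= clamp s y - clamp s x <= y - x.
  by have [[-> ? ?]|[-> ?]|[-> ?]] := clamp_cases x s0;
     have [[-> ? ?]|[-> ?]|[-> ?]] := clamp_cases y s0; apply/andP; split; lra.
rewrite -sqrrN opprB -[X in _ <= X]sqrrN opprB; move: H => /andP[H1 H2].
by apply: lerXn2r => //; rewrite nnegrE; lra.
Qed.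

(** The error vanishes for [|x| <= s] and is at most [|x| <= x^2 / s] beyond; hence truncating a
    centred function creates a mean of order [1 / s]. *)
Lemma clamp_error s x : 0 < s -> `|clamp s x - x| <= s^-1 * x ^+ 2.
Proof.
move=> s0; rewrite ler_pdivlMl//.
have [[-> ? ?]|[-> ?]|[-> ?]] := clamp_cases x s0.
- by rewrite subrr normr0 mulr0 sqr_ge0.
- rewrite ltr0_norm ?subr_lt0//.
  by have := sqr_ge0 (x - s / 2); have := sqr_ge0 s; nra.
- rewrite gtr0_norm ?subr_gt0//.
  by have := sqr_ge0 (x + s / 2); have := sqr_ge0 s; nra.
Qed.

Lemma measurable_clamp d (T : measurableType d) s (u : T -> R) :
  measurable_fun setT u -> measurable_fun setT (fun z => clamp s (u z)).
Proof. by move=> mu; apply: measurable_maxr => //; exact: measurable_minr. Qed.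

End clamp.

Section poincare_L2.
Context {R : realType} (n : nat).
Notation V := 'rV[R]_n.
Notation mu := (@lebn R n).
Variables (p : V -> R) (m : R) (b : V -> V) (l t : R).
Hypotheses (wp : weight mu p) (m0 : 0 < m)
  (pmid : forall x y, p x * p y * expR (m / 4 * enorm (x - y) ^+ 2) <=
     p (2^-1 *: (x + y)) ^+ 2)
  (mb : measurable_fun setT b) (l0 : 0 < l)
  (blip : forall x y, enorm (b x - b y) <= l * enorm (x - y)) (t0 : 0 < t).
Variable (u : V -> R).
Hypotheses (mu_ : measurable_fun setT u)
  (u2 : (\int[mu]_x (p x * u x ^+ 2)%:E < +oo)%E)
  (u0 : \int[mu]_x (p x * u x) = 0).

Let C := 16 * (l ^+ 2 / (m * t)) + 2.

Let mp : measurable_fun setT p. Proof. by case: wp. Qed.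
Let p0 x : 0 <= p x. Proof. by case: wp. Qed.
Let mpu2 : measurable_fun setT (fun x => p x * u x ^+ 2).
Proof. by apply: measurable_funM => //; exact: measurable_funX. Qed.
Let pu2_ge0 x : 0 <= p x * u x ^+ 2. Proof. by rewrite mulr_ge0 ?sqr_ge0. Qed.

Let ip : mu.-integrable setT (EFin \o p).
Proof. by apply: integrable_ge0 => //; case: wp => _ _ ->; rewrite ltry. Qed.
Let ipu2 : mu.-integrable setT (EFin \o (fun x => p x * u x ^+ 2)).
Proof. exact: integrable_ge0. Qed.

Lemma integrable_pu : mu.-integrable setT (EFin \o (fun x => p x * u x)).
Proof.
apply: (@le_integrable _ _ R mu setT measurableT _ (fun x => (p x + p x * u x ^+ 2)%:E)).
- by apply/measurable_EFinP; exact: measurable_funM.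
- move=> x _ /=; rewrite lee_fin normrM (ger0_norm (p0 x)) [leRHS]ger0_norm ?addr_ge0//.
  rewrite -(real_normK (num_real (u x))).
  have := mulr_ge0 (p0 x) (sqr_ge0 (`|u x| - 1)).
  have := mulr_ge0 (p0 x) (sqr_ge0 `|u x|).
  by have := p0 x; lra.
- exact: (integrableD measurableT ip ipu2).
Qed.

Let energy := (\int[mu]_x \int[mu]_y (p x * gaussd t (y - b x) * (u x - u y) ^+ 2)%:E)%E.
Let S := \int[mu]_x (p x * u x ^+ 2).

Lemma clamp_mean_le s : 0 < s -> `|EV mu p (fun x => clamp s (u x))| <= s^-1 * S.
Proof.
move=> s0; have bc : bmf (fun x => clamp s (u x)).
  by split; [exact: measurable_clamp|exists s => x; exact: clamp_norm_le].
have ic := EV_integrable wp bc.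
have id := integrableB measurableT ic integrable_pu.
have -> : EV mu p (fun x => clamp s (u x)) =
    \int[mu]_x (p x * clamp s (u x) - p x * u x).
  by rewrite (RintegralB measurableT ic integrable_pu) u0 subr0.
apply: le_trans (le_normr_Rintegral measurableT id) _.
rewrite /S -(RintegralZl _ measurableT ipu2).
apply: le_Rintegral => //.
- exact: (integrable_abse id).
- exact: (integrableZl measurableT s^-1 ipu2).
- move=> x _; rewrite -mulrBr normrM ger0_norm// mulrCA.
  by apply: ler_wpM2l => //; exact: clamp_error.
Qed.

Lemma clamp_local_var_le s : 0 < s ->
  ((EV mu p (local_var b t (fun x => clamp s (u x))))%:E <= energy)%E.
Proof.
move=> s0; have mc : measurable_fun setT (fun x => clamp s (u x)) by exact: measurable_clamp.
have cs x : `|clamp s (u x)| <= s by exact: clamp_norm_le.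
have bJ := local_var_bmf mb t0 mc s0 cs.
rewrite (EFin_EV wp bJ); apply: ge0_le_integralT => x.
  by rewrite lee_fin mulr_ge0// (local_var_ge0 b t0 (fun x => clamp s (u x)) x).
have wG := weight_gaussd t0 (b x).
have bd : bmf (fun y => (clamp s (u x) - clamp s (u y)) ^+ 2).
  by apply: bmfX; apply: bmfB; [exact: bmf_cst|split => //; exists s].
rewrite EFinM local_varE (EFin_EV wG bd) -ge0_integralZl_EFin//; last 2 first.
- by move=> y _; rewrite lee_fin mulr_ge0 ?sqr_ge0// ltW// gaussd_gt0.
- by apply/measurable_EFinP; apply: measurable_funM; [case: wG|case: bd].
apply: ge0_le_integralT => y.
  rewrite -EFinM lee_fin; apply: mulr_ge0 => //.
  by apply: mulr_ge0; [rewrite ltW// gaussd_gt0|exact: sqr_ge0].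
rewrite -EFinM lee_fin -mulrA; apply: ler_wpM2l => //.
by apply: ler_wpM2l; [rewrite ltW// gaussd_gt0|exact: clamp_diff_sqr].
Qed.

(** Truncation is 1-Lipschitz, hence does not increase the energy, and at height [sqrt (k + 1)] it
    creates a squared mean of at most [S^2 / (k + 1)]. Monotone convergence in [k] concludes. *)
Theorem poincare_L2 : (\int[mu]_x (p x * u x ^+ 2)%:E <= C%:E * energy)%E.
Proof.
have C0 : 0 < C.
  by rewrite /C addr_gt0// mulr_gt0// divr_gt0 ?exprn_gt0// mulr_gt0.
have E0 : (0 <= energy)%E.
  apply: integral_ge0 => x _; apply: integral_ge0 => y _.
  rewrite lee_fin; apply: mulr_ge0; last exact: sqr_ge0.
  by apply: mulr_ge0 => //; rewrite ltW// gaussd_gt0.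
have [->|Efin] := eqVneq energy +oo%E.
  by rewrite gt0_muley ?leey// lte_fin.
have {}Efin : energy \is a fin_num by rewrite ge0_fin_numE// ltey.
have Eq : energy = (fine energy)%:E by rewrite fineK.
have bound k : \int[mu]_x (p x * Num.min (u x ^+ 2) k.+1%:R) <=
    C * fine energy + k.+1%:R^-1 * S ^+ 2.
  pose s := Num.sqrt k.+1%:R : R; have s0 : 0 < s by rewrite sqrtr_gt0.
  have s2 : s ^+ 2 = k.+1%:R by rewrite sqr_sqrtr.
  have mc : measurable_fun setT (fun x => clamp s (u x)) by exact: measurable_clamp.
  have cs x : `|clamp s (u x)| <= s by exact: clamp_norm_le.
  have := poincare_bounded wp m0 pmid mb l0 blip t0 mc s0 cs.
  have -> : EV mu p (fun x => clamp s (u x) ^+ 2) =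
      \int[mu]_x (p x * Num.min (u x ^+ 2) k.+1%:R).
    by apply: eq_Rintegral => x _; rewrite clamp_sqr// s2.
  have H1 : EV mu p (local_var b t (fun x => clamp s (u x))) <= fine energy.
    by rewrite -lee_fin -Eq clamp_local_var_le.
  have H2 : EV mu p (fun x => clamp s (u x)) ^+ 2 <= k.+1%:R^-1 * S ^+ 2.
    rewrite -s2 -exprVn -exprMn -(real_normK (num_real (EV _ _ _))).
    apply: lerXn2r (clamp_mean_le s0); rewrite ?nnegrE//.
    by rewrite mulr_ge0 ?invr_ge0 ?(ltW s0)//; exact: Rintegral_ge0.
  have H3 : C * EV mu p (local_var b t (fun x => clamp s (u x))) <= C * fine energy.
    by rewrite ler_pM2l.
  move=> H; rewrite -lerBlDr; apply: le_trans H3; apply: le_trans H.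
  by rewrite lerD2l lerN2.
pose w k x := (p x * Num.min (u x ^+ 2) k.+1%:R)%:E.
have cw : ((fun k => \int[mu]_x w k x) @ \oo --> \int[mu]_x (p x * u x ^+ 2)%:E)%E.
  rewrite (_ : \int[mu]_x (p x * u x ^+ 2)%:E = \int[mu]_x limn (w ^~ x))%E.
    apply: cvg_monotone_convergence => //.
    - move=> k; apply/measurable_EFinP; apply: measurable_funM => //.
      by apply: measurable_minr => //; exact: measurable_funX.
    - by move=> k x _; rewrite lee_fin mulr_ge0// le_min sqr_ge0/=.
    - move=> x _ k j kj; rewrite lee_fin; apply: ler_wpM2l => //.
      by rewrite le_min !ge_min lexx/= ler_nat ltnS kj orbT.
  apply: eq_integral => x _; apply/esym/cvg_lim => //.
  apply: cvg_near_cst; exists (Num.truncn (u x ^+ 2)).+1 => // k /= xk.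
  rewrite /w min_l//; apply: le_trans (ltW (truncnS_gt _)) _.
  by rewrite ler_nat (leq_trans xk).
rewrite Eq -EFinM; apply/lee_addgt0Pr => e e0.
apply: (cvge_to_le cw).
have K0 : 0 < e / (S ^+ 2 + 1) by rewrite divr_gt0// ltr_wpDl// sqr_ge0.
have [j _ jP] := near_infty_natSinv_lt (PosNum K0).
exists j => // k /jP /= kj.
have wE : (\int[mu]_x w k x)%E = (\int[mu]_x (p x * Num.min (u x ^+ 2) k.+1%:R))%:E.
  rewrite fine_integral_ge0// => [x|].
    by rewrite mulr_ge0// le_min sqr_ge0/=.
  apply: le_lt_trans u2; apply: ge0_le_integralT => x.
    by rewrite lee_fin mulr_ge0// le_min sqr_ge0/=.
  by rewrite lee_fin ler_wpM2l// ge_min lexx.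
rewrite wE -EFinD lee_fin; apply: le_trans (bound k) _; rewrite lerD2l.
apply: (@le_trans _ _ (e / (S ^+ 2 + 1) * S ^+ 2)).
  by apply: ler_wpM2r; [exact: sqr_ge0|exact: ltW].
rewrite mulrAC ler_pdivrMr ?ltr_wpDl ?sqr_ge0//.
by rewrite ler_pM2l// lerDl.
Qed.

End poincare_L2.

(** * The spectral gap *)

Section Rint.
Context {R : realType}.

Lemma Rint_off_null n (f g : 'rV[R]_n -> R) N : measurable N -> lebn n N = 0%E ->
  measurable_fun setT g -> (forall x, ~ N x -> f x = g x) ->
  Defs.Rint f = \int[lebn n]_x g x.
Proof.
move=> mN N0 mg fg; rewrite /Defs.Rint /Rintegral integralE; congr (fine (_ - _)).
- rewrite (@iint_off_null _ _ _ (fun x => (Num.max (g x) 0)%:E) N)//.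
  + by apply: eq_integral => x _; rewrite unlock EFin_max.
  + by move=> x; rewrite lee_fin le_max lexx orbT.
  + by move=> x; rewrite lee_fin le_max lexx orbT.
  + by apply/measurable_EFinP; exact: measurable_maxr.
  + by move=> x /fg ->.
- rewrite (@iint_off_null _ _ _ (fun x => (Num.max (- g x) 0)%:E) N)//.
  + by apply: eq_integral => x _; rewrite unlock EFin_max.
  + by move=> x; rewrite lee_fin le_max lexx orbT.
  + by move=> x; rewrite lee_fin le_max lexx orbT.
  + by apply/measurable_EFinP; apply: measurable_maxr => //; exact: measurable_funN.
  + by move=> x /fg ->.
Qed.

Lemma RintE n (g : 'rV[R]_n -> R) : measurable_fun setT g ->
  Defs.Rint g = \int[lebn n]_x g x.
Proof. by move=> mg; apply: (@Rint_off_null _ _ _ set0). Qed.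

End Rint.

Section measurable_grad.
Context {R : realType} (d : nat).
Notation V := 'rV[R]_d.

(** Each partial derivative is the limit of difference quotients along the steps [1 / (k + 1)]. *)
Lemma measurable_grad (f : V -> R) : (forall x, differentiable f x) ->
  measurable_fun setT (grad f).
Proof.
move=> df; apply: measurable_fun_rV => i.
have cf : continuous f by move=> x; exact: differentiable_continuous.
have mf := continuous_measurable_rV cf.
pose v : V := delta_mx ord0 i.
pose q k (x : V) : R := (k.+1%:R^-1)^-1 *: (f (k.+1%:R^-1 *: v + x) - f x).
apply: (@measurable_fun_cvg _ _ _ _ q) => [k|x _].
  apply: measurable_funM => //; apply: measurable_funB => //.
  by apply: (measurableT_comp mf); apply: measurable_fun_rVD.
have dv : derivable f x v by exact: diff_derivable.
rewrite mxE -/v -deriveE//.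
have cvg0 : (fun k : nat => k.+1%:R^-1 : R) @ \oo --> 0^'.
  move=> A [e /= e0 eA].
  have [j _ jP] := near_infty_natSinv_lt (PosNum e0).
  exists j => // k /jP /= kj; apply: eA => /=.
    by rewrite sub0r normrN ger0_norm.
  by rewrite invr_eq0 pnatr_eq0.
have dv' : (fun s : R => s^-1 *: (f (s *: v + x) - f x)) @ 0^' --> 'D_v f x by exact: dv.
exact: (cvg_comp _ _ cvg0 dv').
Qed.

End measurable_grad.

Section ae_monotone.
Context d (T : measurableType d) (R : realType) (mu : {measure set T -> \bar R}).

Lemma ge0_le_integral_off_null (f g : T -> \bar R) N : measurable N -> mu N = 0%E ->
  measurable_fun setT f -> measurable_fun setT g ->
  (forall x, 0 <= f x)%E -> (forall x, 0 <= g x)%E ->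
  (forall x, ~ N x -> f x <= g x)%E ->
  (\int[mu]_x f x <= \int[mu]_x g x)%E.
Proof.
move=> mN N0 mf mg f0 g0 fg; apply: ae_ge0_le_integral => //.
by exists N; split => // x /= /not_implyP[_]; apply: contra_notP => /fg.
Qed.

End ae_monotone.

Lemma metropolis_ratioE (R : realFieldType) (a q c : R) : 0 < a -> 0 < q ->
  Num.min 1 (c / (a * q)) * q = a^-1 * Num.min (a * q) c.
Proof.
move=> a0 q0; have aq0 : 0 < a * q by rewrite mulr_gt0.
have -> : Num.min (a * q) c = a * q * Num.min 1 (c / (a * q)).
  by rewrite minr_pMr ?(ltW aq0)// mulr1 [a * q * (c / _)]mulrC divfK// gt_eqF.
by move: (Num.min _ _) => r; rewrite -mulrA mulKf ?gt_eqF// mulrC.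
Qed.

Section mala.
Context {R : realType} (d : nat).
Notation V := 'rV[R]_d.
Notation mu := (@lebn R d).
Variables (p f g : V -> R) (M L m h : R) (v : V -> V).
Hypotheses (d0 : (0 < d)%N) (M0 : 0 < M) (L0 : 0 <= L) (m0 : 0 < m)
  (p0 : forall x, 0 < p x) (mp : measurable_fun setT p) (p1 : Defs.Rint p = 1)
  (lpE : forall x, ln (p x) = f x + g x)
  (df : forall x, differentiable f x)
  (gradM : forall x y, enorm (grad f x - grad f y) <= M * enorm (x - y))
  (gL : forall x y, `|g x - g y| <= L * enorm (x - y))
  (lpm : forall x y (lam : R), 0 < lam < 1 ->
     lam * ln (p x) + (1 - lam) * ln (p y) +
       m / 2 * lam * (1 - lam) * enorm (x - y) ^+ 2
     <= ln (p (lam *: x + (1 - lam) *: y)))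
  (vsup : forall x, superdiff (fun y => ln (p y)) x (v x))
  (h0 : 0 < h) (hM : 200 * h * d%:R * (M / m) * M <= 1)
  (hL : 200 * h * d%:R * L ^+ 2 <= 1).

Let b (x : V) : V := x + h *: grad f x.
Let t := shrunk_step d h.
Let l := 1 + h * M.

Let t0 : 0 < t. Proof. exact: shrunk_step_gt0. Qed.
Let l0 : 0 < l. Proof. by rewrite addr_gt0// mulr_gt0. Qed.

Let mb : measurable_fun setT b.
Proof. by apply: measurable_fun_rVD => //; apply: measurable_fun_rVZ; exact: measurable_grad. Qed.

Let blip x y : enorm (b x - b y) <= l * enorm (x - y).
Proof.
have -> : b x - b y = (x - y) + h *: (grad f x - grad f y).
  by rewrite /b; move: (grad f x) (grad f y) => gx gy; rewrite opprD addrACA scalerBr.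
apply: le_trans (enormD _ _) _; rewrite /l mulrDl mul1r lerD2l enormZ gtr0_norm//.
by rewrite -mulrA ler_pM2l.
Qed.

Lemma weight_target : weight mu p.
Proof.
split => // [x|]; first exact: ltW.
move: p1; rewrite RintE// /Rintegral.
have : (0 <= \int[mu]_x (p x)%:E)%E by apply: integral_ge0 => x _; rewrite lee_fin ltW.
case: (\int[mu]_x (p x)%:E)%E => [r| |] //= _; first by move=> ->.
by move=> /eqP; rewrite eq_sym oner_eq0.
Qed.

Lemma target_midpoint x y :
  p x * p y * expR (m / 4 * enorm (x - y) ^+ 2) <= p (2^-1 *: (x + y)) ^+ 2.
Proof.
have pE z : p z = expR (ln (p z)) by rewrite lnK// posrE.
rewrite (pE x) (pE y) (pE (2^-1 *: _)) -expRM_natl -!expRD ler_expR.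
by rewrite (lp_midpoint lpm).
Qed.

(** Built from a measurable version of [v], the kernel [k] is measurable, symmetric and dominated by
    [p] everywhere, including on [N]; it agrees with the kernel of [v] itself off [N]. *)
Lemma mala_kernel_version : exists (k : V * V -> R) (N : set V),
  [/\ measurable N /\ mu N = 0%E,
      measurable_fun setT k /\ (forall z, 0 <= k z),
      (forall x y, k (x, y) = k (y, x)),
      (forall x, (\int[mu]_y (k (x, y))%:E <= (p x)%:E)%E) &
      forall x y, ~ N x -> ~ N y ->
        k (x, y) = Num.min (p x * Qdens v h x y) (p y * Qdens v h y x)].
Proof.
have mlp : measurable_fun setT (fun x => ln (p x)).
  exact: (measurableT_comp (@measurable_ln R)).
have [v' [N [mv mN N0 vv']]] := ae_measurable_superdiff mlp vsup.
pose q (z : V * V) := p z.1 * gaussd h (z.2 - z.1 - h *: v' z.1).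
have mfst : measurable_fun setT (fst : V * V -> V) by exact: measurable_fst.
have msnd : measurable_fun setT (snd : V * V -> V) by exact: measurable_snd.
have mq : measurable_fun setT q.
  apply: measurable_funM; first exact: (measurableT_comp mp mfst).
  apply: measurable_gaussd; apply: measurable_fun_rVB; first exact: measurable_fun_rVB.
  by apply: measurable_fun_rVZ; exact: (measurableT_comp mv mfst).
have q0 z : 0 <= q z.
  by apply: mulr_ge0; [exact: (ltW (p0 _)) | apply: ltW; exact: gaussd_gt0].
have qE x y : q (x, y) = p x * gaussd h (y - x - h *: v' x) by [].
move: q q0 mq qE => q q0 mq qE.
exists (fun z => Num.min (q z) (q (z.2, z.1))), N; split.
- by split.
- split; last by move=> z; rewrite le_min !q0.
  apply: measurable_minr => //.
  exact: (measurableT_comp mq (@measurable_swap _ _ V V)).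
- by move=> x y; rewrite /= minC.
- move=> x; apply: (@le_trans _ _ (\int[mu]_y (q (x, y))%:E)%E).
    apply: ge0_le_integralT => y; first by rewrite lee_fin le_min !q0.
    by rewrite lee_fin ge_min lexx.
  have [mG G0 G1] := weight_gaussd h0 (x + h *: v' x).
  rewrite (eq_integral (fun y : V => (p x)%:E * (gaussd h (y - (x + h *: v' x)))%:E)%E).
    rewrite ge0_integralZl_EFin ?G1 ?mule1//; last exact: ltW.
      by move=> y _; rewrite lee_fin.
    exact/measurable_EFinP.
  by move=> y _; rewrite -EFinM qE opprD addrA.
- by move=> x y Nx Ny; rewrite /= !qE !QdensE (vv' _ Nx) (vv' _ Ny).
Qed.

Section test_function.
Variable u : V -> R.
Hypotheses (mu_ : measurable_fun setT u)
  (u2 : (\int[mu]_x (p x * u x ^+ 2)%:E < +oo)%E)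
  (u0 : \int[mu]_x (p x * u x) = 0).

Let S := \int[mu]_x (p x * u x ^+ 2).

(** [D] is the double integral of [k (u(x) - u(y))^2]. The factor [expR 2] inverts the minorization
    constant; the bracket is the constant of [poincare_L2], with [l] the Lipschitz constant of
    [b]. *)
Lemma mala_dirichlet_ge : exists D : R,
  [/\ 0 <= D, Epi p (fun x => u x * Pop p v h u x) = S - 2^-1 * D &
      S <= (16 * (l ^+ 2 / (m * t)) + 2) * (expR 2 * D)].
Proof.
have [k [N [[mN N0] [mk k0] ksym kp kE]]] := mala_kernel_version.
have pge x : 0 <= p x by exact: ltW.
have Dfin := dirichlet_energy_fin mp mk k0 ksym kp mu_ u2.
set E := (\int[mu]_x \int[mu]_y (k (x, y) * (u x - u y) ^+ 2)%:E)%E in Dfin.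
have E0 : (0 <= E)%E.
  apply: integral_ge0 => x _; apply: integral_ge0 => y _.
  by rewrite lee_fin mulr_ge0// sqr_ge0.
have EE : E = (fine E)%:E by rewrite fineK// ge0_fin_numE.
exists (fine E); split.
- by rewrite fine_ge0.
- have [N2 [mN2 N20 dE]] := dirichlet_densityE mp mk k0 ksym kp mu_ u2.
  rewrite -(Rintegral_dirichlet_density mp pge mk k0 ksym kp mu_ u2).
  rewrite /Epi; apply: (@Rint_off_null _ _ _ _ (N `|` N2)).
  + exact: measurableU.
  + by rewrite measureU0.
  + exact: measurable_dirichlet_density.
  move=> x /not_orP[Nx N2x]; have [iku <-] := dE x N2x.
  have mkx : measurable_fun setT (fun y => k (x, y)) by exact: measurable_fun_pair2.
  have mku : measurable_fun setT (fun y => k (x, y) * u y) by exact: measurable_funM.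
  have ik : mu.-integrable setT (EFin \o (fun y => k (x, y))).
    by apply: integrable_ge0 => //; apply: le_lt_trans (kp x) _; rewrite ltry.
  have aQ y : ~ N y -> alpha p v h x y * Qdens v h x y = (p x)^-1 * k (x, y).
    move=> Ny; rewrite kE// /alpha.
    have Q0 : 0 < Qdens v h x y by rewrite QdensE gaussd_gt0.
    exact: metropolis_ratioE.
  rewrite /Pop.
  rewrite (@Rint_off_null _ _ _ (fun y => (p x)^-1 * (k (x, y) * u y)) N)//; last 2 first.
  - exact: measurable_funM.
  - by move=> y Ny; rewrite aQ// mulrA.
  rewrite (@Rint_off_null _ _ _ (fun y => (p x)^-1 * k (x, y)) N)//; last first.
    exact: measurable_funM.
  rewrite (RintegralZl _ measurableT iku) (RintegralZl _ measurableT ik).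
  move: (\int[mu]_y (k (x, y) * u y)) (\int[mu]_y k (x, y)) => X Y.
  by field; rewrite gt_eqF.
- have wp := weight_target.
  have PL := poincare_L2 wp m0 target_midpoint mb l0 blip t0 mu_ u2 u0.
  rewrite -lee_fin fine_integral_ge0//; last first.
    by move=> x; rewrite mulr_ge0// sqr_ge0.
  apply: le_trans PL _; rewrite EFinM; apply: lee_wpmul2l.
    by rewrite lee_fin addr_ge0// mulr_ge0// divr_ge0 ?sqr_ge0// mulr_ge0// ltW.
  rewrite EFinM -EE.
  have mG : measurable_fun setT (fun z : V * V =>
      p z.1 * gaussd t (z.2 - b z.1) * (u z.1 - u z.2) ^+ 2).
    apply: measurable_funM; first apply: measurable_funM.
    - exact: (measurableT_comp mp measurable_fst).
    - exact: measurable_gaussd_joint.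
    - apply: measurable_funX; apply: measurable_funB.
        exact: (measurableT_comp mu_ measurable_fst).
      exact: (measurableT_comp mu_ measurable_snd).
  have mK : measurable_fun setT (fun z : V * V => k z * (u z.1 - u z.2) ^+ 2).
    apply: measurable_funM => //; apply: measurable_funX; apply: measurable_funB.
      exact: (measurableT_comp mu_ measurable_fst).
    exact: (measurableT_comp mu_ measurable_snd).
  have G0 x y : 0 <= p x * gaussd t (y - b x) * (u x - u y) ^+ 2.
    apply: mulr_ge0; last exact: sqr_ge0.
    by apply: mulr_ge0 => //; rewrite ltW// gaussd_gt0.
  have K0 x y : 0 <= k (x, y) * (u x - u y) ^+ 2 by rewrite mulr_ge0// sqr_ge0.
  have mKI := measurable_param_integral mu mK.
  have mGI := measurable_param_integral mu mG.
  rewrite -ge0_integralZl_EFin ?expR_ge0//; last first.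
    by move=> x _; apply: integral_ge0 => y _; rewrite lee_fin.
  apply: (ge0_le_integral_off_null mN N0) => //.
  + exact: measurable_funeM.
  + by move=> x; apply: integral_ge0 => y _; rewrite lee_fin.
  + move=> x; apply: mule_ge0; first by rewrite lee_fin expR_ge0.
    by apply: integral_ge0 => y _; rewrite lee_fin.
  move=> x Nx.
  have mGx : measurable_fun setT (fun y : V => p x * gaussd t (y - b x) * (u x - u y) ^+ 2).
    exact: (measurable_fun_pair2 x mG).
  have mKx : measurable_fun setT (fun y : V => k (x, y) * (u x - u y) ^+ 2).
    exact: (measurable_fun_pair2 x mK).
  rewrite -ge0_integralZl_EFin ?expR_ge0//; last 2 first.
  - by move=> y _; rewrite lee_fin.
  - exact/measurable_EFinP.
  apply: (ge0_le_integral_off_null mN N0) => //.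
  + exact/measurable_EFinP.
  + by apply: measurable_funeM; exact/measurable_EFinP.
  + by move=> y; rewrite lee_fin.
  + by move=> y; rewrite -EFinM lee_fin mulr_ge0 ?expR_ge0.
  move=> y Ny; rewrite -EFinM lee_fin [leRHS]mulrA; apply: ler_wpM2r; first exact: sqr_ge0.
  rewrite kE//.
  have := mala_minorization d0 M0 L0 m0 p0 lpE df gradM gL lpm vsup h0 hM hL x y.
  rewrite expRN ler_pdivrMl ?expR_gt0//.
Qed.

End test_function.

(** From [h <= 3 t], [l^2 <= 2], [expR 2 <= 10] and [m h <= 1 / 50], the bracket is at most
    [100 / (m h)] and the right side at least [m h / 2000], a wide margin against [40000 pi]. *)
Lemma mala_rate_constant :
  (4 * 10 ^+ 4 * pi)^-1 * m * h <= (2 * ((16 * (l ^+ 2 / (m * t)) + 2) * expR 2))^-1.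
Proof.
have hdM := hdM_le d0 M0 L0 m0 lpE df gradM gL lpm h0 hM.
have mM := strong_concavity_le d0 M0 L0 lpE df gradM gL lpm.
have D1 : 1 <= d%:R :> R by rewrite ler1n.
have hM1 : 100 * (h * M) <= 1.
  apply: le_trans hdM; rewrite ler_pM2l// [leRHS]mulrAC.
  by rewrite ler_peMr// mulr_ge0// ltW.
have mh0 : 0 < m * h by rewrite mulr_gt0.
have mh1 : 50 * (m * h) <= 1.
  have : m * h <= 2 * M * h by rewrite ler_pM2r.
  by lra.
have th : h <= 3 * t.
  rewrite /t /shrunk_step mulrCA -[leLHS]mulr1 ler_pM2l//.
  rewrite ler_pdivlMr ?mul1r; last by rewrite ltr_wpDr// divr_ge0.
  have : (d%:R)^-1 <= 1 :> R by rewrite invf_le1// (lt_le_trans _ D1).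
  by lra.
have l2 : l ^+ 2 <= 2.
  have : 0 <= h * M by rewrite mulr_ge0// ltW.
  by rewrite /l; move: hM1; move: (h * M) => q; nra.
(* [expR (- 1 / 4) >= 3 / 4], and [(3 / 4)^8] is just above [1 / 10]. *)
have e2 : expR 2 <= 10 :> R.
  have -> : 2 = - (- 4^-1 * 8%:R) :> R by lra.
  rewrite expRN expRM_natr -[leRHS]invrK lef_pV2 ?posrE ?exprn_gt0 ?expR_gt0//.
  apply: (@le_trans _ _ ((3 / 4) ^+ 8)); first by lra.
  apply: lerXn2r; rewrite ?nnegrE ?expR_ge0//.
  by have := expR_ge1Dx (- 4^-1 : R); lra.
have A1 : l ^+ 2 / (m * t) <= 6 / (m * h).
  have mt0 : 0 < m * t by rewrite mulr_gt0.
  rewrite ler_pdivrMr// mulrAC ler_pdivlMr//.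
  have : m * h <= 3 * (m * t) by rewrite mulrCA ler_pM2l.
  by have := sqr_ge0 l; nra.
have K : 2 * ((16 * (l ^+ 2 / (m * t)) + 2) * expR 2) <= 2 * 10 ^+ 3 / (m * h).
  have A2 : 16 * (l ^+ 2 / (m * t)) + 2 <= 100 / (m * h).
    have : 2 <= 1 / (m * h) by rewrite ler_pdivlMr//; lra.
    by rewrite mulrC in A1 *; lra.
  have A0 : 0 <= 16 * (l ^+ 2 / (m * t)) + 2.
    by rewrite addr_ge0// mulr_ge0// divr_ge0 ?sqr_ge0// mulr_ge0// ltW.
  have : (16 * (l ^+ 2 / (m * t)) + 2) * expR 2 <= 100 / (m * h) * 10.
    by apply: ler_pM => //; exact: expR_ge0.
  move: (_ * expR 2) => c; move: (m * h)^-1 => r H.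
  have -> : 2 * 10 ^+ 3 * r = 2 * (100 * r * 10) by ring.
  by rewrite ler_pM2l.
have Kpos : 0 < 2 * ((16 * (l ^+ 2 / (m * t)) + 2) * expR 2).
  rewrite mulr_gt0// mulr_gt0 ?expR_gt0// ltr_wpDl// mulr_ge0//.
  by rewrite divr_ge0 ?sqr_ge0// mulr_ge0// ltW.
apply: (@le_trans _ _ (2 * 10 ^+ 3 / (m * h))^-1); last by rewrite lef_pV2 ?posrE// divr_gt0.
rewrite invf_div -mulrA mulrC ler_pM2l// lef_pV2 ?posrE ?mulr_gt0 ?pi_gt0//.
by have := @pi_ge2 R; lra.
Qed.

Theorem mala_gap : (((4 * 10 ^+ 4 * pi)^-1 * m * h)%:E <= Gap p v h)%E.
Proof.
apply: le_ereal_inf_tmp => _ [u [[bu u2] Eu0 Eu2 ->]].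
have mu_ := (borel_funP u).1 bu.
have mpu2 : measurable_fun setT (fun x => p x * u x ^+ 2).
  by apply: measurable_funM => //; exact: measurable_funX.
have pu2_ge0 x : 0 <= p x * u x ^+ 2 by rewrite mulr_ge0 ?sqr_ge0// ltW.
rewrite iintE// in u2; last first.
  exact/measurable_EFinP.
rewrite /Epi RintE in Eu0; last exact: measurable_funM.
move: Eu2; rewrite {1 3}/Epi RintE// => S0.
have [D [D0 -> SD]] := mala_dirichlet_ge mu_ u2 Eu0.
move: S0 SD; set S := \int[mu]_x (p x * u x ^+ 2) => S0 SD.
have Spos : 0 < S by rewrite lt_def S0 Rintegral_ge0.
rewrite lee_fin; apply: le_trans mala_rate_constant _.
have -> : 1 - (S - 2^-1 * D) / S = D / (2 * S) by field.
set C := 16 * (l ^+ 2 / (m * t)) + 2 in SD *.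
have C0 : 0 < C.
  rewrite ltr_wpDl// mulr_ge0// divr_ge0 ?sqr_ge0//.
  by apply: mulr_ge0; exact: ltW.
rewrite ler_pdivlMr ?mulr_gt0// ler_pdivrMl ?mulr_gt0 ?expR_gt0//.
by rewrite -!mulrA ler_pM2l.
Qed.

End mala.

Theorem mainTheorem7 (R : realType) (d : nat) (p : 'rV[R]_d -> R)
  (M L m : R) (v : 'rV[R]_d -> 'rV[R]_d) (h : R) :
  (0 < d)%N -> 0 < M -> 0 <= L -> 0 < m ->
  MALA_assumption p M L m ->
  (forall x, superdiff (fun y => ln (p y)) x (v x)) ->
  0 < h ->
  200 * h * d%:R * (M / m) * M <= 1 ->
  200 * h * d%:R * L ^+ 2 <= 1 ->
  ((((4 * 10 ^+ 4) * pi)^-1 * m * h)%:E <= Gap p v h)%E.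
Proof.
move=> d0 M0 L0 m0 [p0 bp p1 [f [g [lpE _ [df gradM] gL lpm]]]] vsup h0 hM hL.
exact: (mala_gap d0 M0 L0 m0 p0 ((borel_funP p).1 bp) p1 lpE df gradM gL lpm vsup h0 hM hL).
Qed.
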